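(* Let $p$ be a non-negative integer and let $(\mathcal{A},\mathcal{H},D)$ be a $p+$ summable spectral triple which has the weak heat kernel asymptotic expansion property. Then the spectral triple $(\mathcal{A},\mathcal{H},D)$ is regular and has finite simple dimension spectrum. Moreover the dimension spectrum is contained in $\{1,2,\dots,p\}$.
   Context: Asymptotic expansions. A continuous function $\phi:(0,\infty)\to\mathbb{C}$ has an asymptotic power series expansion (near $0$) if there is a sequence $(a_r)_{r\ge 0}$ of complex numbers such that for every $N$ there exist $\epsilon,M>0$ with $|\phi(t)-\sum_{r=0}^{N}a_rt^r|\le Mt^{N+1}$ for all $t\in(0,\epsilon)$. Spectral triples. A spectral triple $(\mathcal{A},\mathcal{H},D)$ for a $C^*$-algebra $A$ consists of a Hilbert space $\mathcal{H}$ on which $A$ is represented, a dense $*$-subalgebra $\mathcal{A}\subset A$ (viewed in the algebra $B(\mathcal H)$ of bounded operators on $\mathcal{H}$), and a self-adjoint operator $D$ on $\mathcal{H}$ with compact resolvent such that $[D,a]$ extends to a bounded operator for every $a\in\mathcal{A}$. It is $p+$ summable if $|D|^{-q}$ is trace class for every $q>p$. Throughout, $|D|^{-z}$ is set to be $0$ on $\ker D$ when $D$ is not invertible. Let $\delta:=[|D|,\cdot\,]$ (an unbounded derivation on $B(\mathcal{H})$) and $d:=[D,\cdot\,]$. Let $F:=\mathrm{sign}(D)$, with the convention $\mathrm{sign}(0)=1$. Weak heat kernel asymptotic expansion property. A $p+$ summable spectral triple $(\mathcal{A},\mathcal{H},D)$ has this property if there is a $*$-subalgebra $\mathcal{B}\subset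 B(\mathcal{H})$ such that: (1) $\mathcal{B}\supset\mathcal{A}$; (2) $\mathcal{B}$ lies in the domain of $\delta$ and $\delta(\mathcal{B})\subset\mathcal{B}$, and $d$ maps $\mathcal{A}$ into $\mathcal{B}$; (3) $F\mathcal{B}\subset\mathcal{B}$; (4) for every $b\in\mathcal{B}$, the function $\tau_{p,b}:(0,\infty)\to\mathbb{C}$, $\tau_{p,b}(t)=t^p\,\mathrm{Tr}(be^{-t|D|})$, has an asymptotic power series expansion. Regularity and dimension spectrum. The spectral triple is regular if $\mathcal{A}$ and $[D,\mathcal{A}]$ are contained in the domain of $\delta^n$ for all $n\ge0$. It has dimension spectrum $\Sigma\subset\mathbb{C}$ if for every $b$ in the smallest algebra containing $\mathcal{A}$ and $[D,\mathcal{A}]$ and closed under $\delta$, the function $\zeta_b(z)=\mathrm{Tr}(b|D|^{-z})$, a priori defined for $\mathrm{Re}(z)>p$, extends to a meromorphic function on $\mathbb{C}$ with poles contained in $\Sigma$. The dimension spectrum is finite if $\Sigma$ is finite, and simple if all poles of all these $\zeta_b$ are simple. *)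

(* Defs.v *)
From HB Require Import structures.
From mathcomp Require Import all_boot all_order all_algebra.
From mathcomp Require Import all_classical all_reals all_analysis.
From mathcomp Require Import complex.
From mathcomp.analysis.showcase Require summability.

Set Implicit Arguments.
Unset Strict Implicit.
Unset Printing Implicit Defensive.

Import Order.TTheory GRing.Theory Num.Theory.
Import numFieldNormedType.Exports.

Local Open Scope classical_set_scope.
Local Open Scope complex_scope.
Local Open Scope ring_scope.

(* The form [ip] is linear in its first argument and conjugate-linear in its
   second one. *)
Record hilbert (R : realType) := Hilbert {
  hilbert_sort :> completeNormedModType R[i];
  ip : {dot hilbert_sort for Num.conj};
  ip_norm : forall x : hilbert_sort, `|x| ^+ 2 = ip x x }.
Arguments ip {R h}.

(* C*-algebras need not be unital. *)
Record cstar_algebra (R : realType) := CStarAlgebra {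
  cstar_sort :> completeNormedModType R[i];
  cmul : cstar_sort -> cstar_sort -> cstar_sort;
  cstar : cstar_sort -> cstar_sort;
  cmulA : forall x y z, cmul x (cmul y z) = cmul (cmul x y) z;
  cmulDl : forall x y z, cmul (x + y) z = cmul x z + cmul y z;
  cmulDr : forall x y z, cmul x (y + z) = cmul x y + cmul x z;
  cmulZl : forall (k : R[i]) x y, cmul (k *: x) y = k *: cmul x y;
  cmulZr : forall (k : R[i]) x y, cmul x (k *: y) = k *: cmul x y;
  cstarK : forall x, cstar (cstar x) = x;
  cstarD : forall x y, cstar (x + y) = cstar x + cstar y;
  cstarZ : forall (k : R[i]) x, cstar (k *: x) = Num.conj k *: cstar x;
  cstarM : forall x y, cstar (cmul x y) = cmul (cstar y) (cstar x);
  cmul_norm : forall x y, `|cmul x y| <= `|x| * `|y|;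
  cstar_norm : forall x, `|cmul (cstar x) x| = `|x| ^+ 2 }.

Section bounded_operators.
Context {R : realType} {H : hilbert R}.
Implicit Types (b c S T : H -> H) (B : set (H -> H)) (E : set H).

Definition bounded_op b := linear b /\ continuous b.

Definition is_adjoint b c := forall x y : H, ip (b x) y = ip x (c y).

Definition compact_op b :=
  bounded_op b /\ precompact (b @` [set x : H | `|x| <= 1]).

(* Not necessarily containing the identity operator. *)
Definition subalgebra B :=
  [/\ B `<=` bounded_op,
      B (fun=> 0),
      forall (k : R[i]) b c, B b -> B c -> B (fun x => k *: b x + c x) &
      forall b c, B b -> B c -> B (b \o c)].

Definition star_subalgebra B :=
  subalgebra B /\ forall b, B b -> exists2 c, B c & is_adjoint b c.

Definition orthonormal_basis E :=
  (forall e f, E e -> E f -> ip e f = (e == f)%:R) /\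
  (forall x : H, (forall e, E e -> ip x e = 0) -> x = 0).

(* S = |T|, the positive square root of T^* T *)
Definition is_modulus T S :=
  [/\ bounded_op S, forall x : H, 0 <= ip (S x) x &
      exists2 T', is_adjoint T T' & S \o S = T' \o T].

Definition trace_class T :=
  bounded_op T /\
  exists S E, [/\ is_modulus T S, orthonormal_basis E &
    (\esum_(e in E) (complex.Re (ip (S e) e))%:E < +oo)%E].

(* The sum of <T e, e> over e in E is the limit of the net of finite partial
   sums.  For a trace class operator it exists and does not depend on the
   orthonormal basis E. *)
Definition is_trace T (z : R[i]) :=
  forall E, orthonormal_basis E ->
    summability.partial_sum
      (fun e : H => if `[< E e >] then ip (T e) e else 0 : R[i]^o) A
      @[A --> summability.totally] --> (z : R[i]^o).

Definition trace T : R[i] := xget 0 [set z | is_trace T z].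

End bounded_operators.

(* Only the values of [uop] on [udom] are meaningful. *)
Record unbounded_op (R : realType) (H : hilbert R) := UnboundedOp {
  udom : set H;
  uop :> H -> H }.

Section unbounded_operators.
Context {R : realType} {H : hilbert R}.
Implicit Types (D : unbounded_op H) (b c : H -> H).

Definition linear_on_domain D :=
  udom D 0 /\
  forall (k : R[i]) x y, udom D x -> udom D y ->
    udom D (k *: x + y) /\ D (k *: x + y) = k *: D x + D y.

(* The right-hand side of the equivalence is the graph of D, and its left-hand
   side is the graph of the adjoint of D. *)
Definition self_adjoint D :=
  [/\ linear_on_domain D, dense (udom D) &
      forall y z : H,
        (forall x, udom D x -> ip (D x) y = ip x z) <->
        udom D y /\ D y = z].

Definition is_resolvent D (l : R[i]) (T : H -> H) :=
  [/\ bounded_op T,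
      forall y, udom D (T y) /\ D (T y) - l *: T y = y &
      forall x, udom D x -> T (D x - l *: x) = x].

Definition has_compact_resolvent D :=
  exists l T, is_resolvent D l T /\ compact_op T.

(* c is the bounded extension of [D, b]. *)
Definition is_commutator D b c :=
  [/\ bounded_op b, bounded_op c &
      forall x, udom D x -> udom D (b x) /\ D (b x) - b (D x) = c x].

(* Functional calculus f(D) for a self-adjoint D with compact resolvent.  Such
   a D is diagonal in an orthonormal basis (e_n) of eigenvectors, with real
   eigenvalues (l_n), and f(D) x = \sum_n f(l_n) <x, e_n> e_n on the domain of
   those x for which this series converges.  The definition says the same
   without choosing a basis: y = f(D) x if and only if <y, e> = f(l) <x, e>
   for every eigenvector e, with l the eigenvalue of e. *)
Definition fun_calc_graph D (f : R -> R[i]) (x y : H) :=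
  forall (l : R) e, udom D e -> D e = l%:C *: e -> ip y e = f l * ip x e.

Definition fun_calc D (f : R -> R[i]) : unbounded_op H :=
  UnboundedOp [set x | exists y, fun_calc_graph D f x y]
              (fun x => xget 0 [set y | fun_calc_graph D f x y]).

Definition abs_op D := fun_calc D (fun l => `|l|%:C).

Definition sign_op D := fun_calc D (fun l => if 0 <= l then 1 else - 1).

(* e^{-t|D|} *)
Definition heat_op D (t : R) :=
  fun_calc D (fun l => (expR (- (t * `|l|)))%:C).

(* |l|^{-z} = e^{- z ln |l|}, and 0 for l = 0 *)
Definition abs_powN (z : R[i]) (l : R) : R[i] :=
  if l == 0 then 0 else
    (expR (- (complex.Re z * ln `|l|)))%:C *
    (cos (complex.Im z * ln `|l|) -i* sin (complex.Im z * ln `|l|)).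

(* |D|^{-z}, which is 0 on the kernel of D *)
Definition abs_powN_op D (z : R[i]) := fun_calc D (abs_powN z).

(* b is in the domain of delta^n, where delta = [|D|, .]. *)
Fixpoint dom_delta D (n : nat) b : Prop :=
  if n is m.+1 then
    exists2 c, is_commutator (abs_op D) b c & dom_delta D m c
  else bounded_op b.

End unbounded_operators.

Record spectral_triple (R : realType) := SpectralTriple {
  st_A : cstar_algebra R;
  st_H : hilbert R;
  st_rep : st_A -> st_H -> st_H;
  st_rep_bounded : forall a, bounded_op (st_rep a);
  st_repP : forall (k : R[i]) a a',
    st_rep (k *: a + a') = (fun x => k *: st_rep a x + st_rep a' x);
  st_repM : forall a a', st_rep (cmul a a') = st_rep a \o st_rep a';
  st_repS : forall a, is_adjoint (st_rep a) (st_rep (cstar a));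
  st_calA : set st_A;
  st_calA0 : st_calA 0;
  st_calAP : forall (k : R[i]) a a',
    st_calA a -> st_calA a' -> st_calA (k *: a + a');
  st_calAM : forall a a', st_calA a -> st_calA a' -> st_calA (cmul a a');
  st_calAS : forall a, st_calA a -> st_calA (cstar a);
  st_calA_dense : dense st_calA;
  st_D : unbounded_op st_H;
  st_D_self_adjoint : self_adjoint st_D;
  st_D_compact_resolvent : has_compact_resolvent st_D;
  st_D_commutator : forall a, st_calA a ->
    exists c, is_commutator st_D (st_rep a) c }.

(* Asymptotic power series expansion at 0 of a function on (0, +oo). *)
Definition has_power_expansion (R : realType) (phi : R -> R[i]) :=
  {in `]0, +oo[%R, continuous (phi : R -> R[i]^o)} /\
  exists a : nat -> R[i], forall N : nat, exists eps M : R,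
    [/\ 0 < eps, 0 < M & forall t : R, 0 < t -> t < eps ->
      `|phi t - \sum_(r < N.+1) a r * t%:C ^+ r| <= (M * t ^+ N.+1)%:C].

Section meromorphic.
Context {R : realType}.
Implicit Types (f : R[i]^o -> R[i]^o) (z : R[i]^o).

Definition holomorphic_at f z := \forall w \near z, derivable f w 1.

(* f becomes holomorphic at z once its value at z is suitably changed. *)
Definition removable f z :=
  exists2 g : R[i]^o -> R[i]^o, holomorphic_at g z &
    \forall w \near z^', f w = g w.

Definition pole f z :=
  ~ removable f z /\ exists n : nat, removable (fun w => (w - z) ^+ n * f w) z.

Definition simple_pole f z :=
  pole f z /\ removable (fun w => (w - z) * f w) z.

(* The value of f at a pole is irrelevant. *)
Definition meromorphic f := forall z, holomorphic_at f z \/ pole f z.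

End meromorphic.

Section spectral_triples.
Context {R : realType} (T : spectral_triple R).
Local Notation H := (st_H T).
Local Notation D := (st_D T).
Implicit Types (B : set (H -> H)) (b : H -> H).

Definition algA : set (H -> H) := @st_rep R T @` @st_calA R T.

Definition comm_algA : set (H -> H) :=
  [set c | exists2 a, algA a & is_commutator D a c].

(* p+ summability *)
Definition summable_plus (p : R) :=
  forall q : R, p < q -> trace_class (abs_powN_op D q%:C).

Definition weak_heat_expansion (p : nat) :=
  exists B, [/\ star_subalgebra B,
    algA `<=` B,
    (forall b, B b -> exists2 c, is_commutator (abs_op D) b c & B c) /\
      comm_algA `<=` B,
    (forall b, B b -> B (sign_op D \o b)) &
    forall b, B b ->
      has_power_expansion
        (fun t : R => (t ^+ p)%:C * trace (b \o heat_op D t))].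

Definition regular :=
  forall n b, (algA `|` comm_algA) b -> dom_delta D n b.

(* The smallest algebra containing A and [D, A] and closed under delta. *)
Definition delta_algebra : set (H -> H) :=
  smallest
    [set B | subalgebra B /\
             forall b c, B b -> is_commutator (abs_op D) b c -> B c]
    (algA `|` comm_algA).

Definition zeta b (z : R[i]) : R[i] := trace (b \o abs_powN_op D z).

(* The triple is p+ summable, so that zeta b is defined for Re z > p.  The
   meromorphic extension f of zeta b is unique. *)
Definition simple_dimension_spectrum (p : R) (Sigma : set R[i]) :=
  forall b, delta_algebra b ->
    exists f : R[i]^o -> R[i]^o,
      [/\ meromorphic f,
          forall z : R[i], p < complex.Re z -> f z = zeta b z,
          pole f `<=` Sigma &
          forall z, pole f z -> simple_pole f z].

End spectral_triples.

(* Main.v *)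
Require Import Defs.
From HB Require Import structures.
From mathcomp Require Import all_boot all_order all_algebra.
From mathcomp Require Import all_classical all_reals all_analysis.
From mathcomp Require Import measurable_realfun complex finmap ring lra.
From mathcomp.analysis.showcase Require summability.

(** Diagonalise D in an orthonormal basis (e) of eigenvectors, with eigenvalues
   l_e.  Then zeta_b(z) is the sum of |l_e|^{-z} <b e, e> over l_e <> 0, and
   Tr(b e^{-t|D|}) = theta(t) + k0, where k0 is the contribution of the finite
   dimensional kernel of D.  The Mellin transform of theta is
   Gamma(z) zeta_b(z) for Re z > p.  If theta(t) has coefficients a_r at
   t^{r-p}, subtracting the terms r < p + N on (0, 1] extends it to Re z > -N
   as a holomorphic function plus the sum of a_r / (z - (p - r)).  The function
   Gamma has no zero and a simple pole at each non-positive integer: dividing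
   by it cancels the poles with r >= p and leaves simple poles at
   1, ..., p only.  Regularity holds because the algebra given by the heat
   expansion property is stable under delta. *)

Set Implicit Arguments.
Unset Strict Implicit.
Unset Printing Implicit Defensive.

Import Order.TTheory GRing.Theory Num.Theory.
Import numFieldNormedType.Exports.
Local Open Scope classical_set_scope.
Local Open Scope complex_scope.
Local Open Scope ring_scope.
Local Notation normc := Normc.normc.

(** * Complex-valued integrals and Laplace transforms *)

Section complex_modulus.
Context {R : realType}.
Implicit Types (z w : R[i]) (x y : R).

(** Under t = e^{-u}, scaling t by an eigenvalue becomes a translation, and every convergence
    question becomes domination by e^{-e|u|}. Two exchanges of limits are avoided. Differentiation
    under the integral is an explicit quadratic estimate of e^w - 1 - w. Instead of integrating the
    series of theta term by term, theta and zeta_b(z) are approximated at once by the same finite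
    sums, with two exponential weights whose rates enclose Re z. Gamma is never continued beyond Re
    z > 0: numerator and denominator are multiplied by z (z + 1) ... (z + N - 1), so that only
    Gamma(z + N) with Re (z + N) > 0 is inverted. The resolvent is given at one point l, possibly
    non-real, so it need not be self-adjoint; the eigenvectors come from S T, where S is its
    adjoint. [is_trace] speaks of all orthonormal bases and [trace_class] of some basis, whereas the
    estimates live in the eigenbasis: [is_trace_diag] and [trace_class_diag_summable] make the two
    transfers. The constant k0 only shifts the coefficient a_p, whose pole at 0 is among the
    cancelled ones. *)

Lemma normC_normc z : `|z| = (normc z)%:C. Proof. by []. Qed.

Lemma normc_ge0 z : 0 <= normc z.
Proof. by rewrite -ler0c -normC_normc. Qed.

Lemma normc_eq0 z : (normc z == 0) = (z == 0).
Proof.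
by rewrite -(inj_eq (@complexI R)) -normC_normc normr_eq0.
Qed.

Lemma normc_gt0 z : (0 < normc z) = (z != 0).
Proof. by rewrite lt_def normc_ge0 andbT normc_eq0. Qed.

Lemma normc_real x : normc x%:C = `|x|.
Proof. by rewrite /= expr0n addr0 sqrtr_sqr. Qed.

Lemma normcB z w : normc (z - w) <= normc z + normc w.
Proof. by rewrite (le_trans (le_normcD _ _))// normcN. Qed.

Lemma normc_distC z w : normc (z - w) = normc (w - z).
Proof. by rewrite -normcN opprB. Qed.

Lemma normc_conj z : normc z^* = normc z.
Proof. by case: z => a b /=; rewrite sqrrN. Qed.

Lemma ler_normc_Re z : `|complex.Re z| <= normc z.
Proof.
by case: z => a b /=; rewrite -sqrtr_sqr ler_wsqrtr// lerDl sqr_ge0.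
Qed.

Lemma ler_normc_Im z : `|complex.Im z| <= normc z.
Proof.
by case: z => a b /=; rewrite -sqrtr_sqr ler_wsqrtr// lerDr sqr_ge0.
Qed.

Lemma ler_normc_ReIm z : normc z <= `|complex.Re z| + `|complex.Im z|.
Proof.
case: z => a b /=; rewrite -[leRHS]ger0_norm ?addr_ge0// -sqrtr_sqr.
rewrite ler_wsqrtr// sqrrD !real_normK ?num_real//.
by rewrite lerD2r lerDl mulrn_wge0// mulr_ge0.
Qed.

Lemma normcX z n : normc (z ^+ n) = normc z ^+ n.
Proof.
by elim: n => [|n ih]; rewrite ?Normc.normc1// !exprS Normc.normcM ih.
Qed.

Lemma normc_sum (I : Type) (s : seq I) (P : pred I) (F : I -> R[i]) :
  normc (\sum_(i <- s | P i) F i) <= \sum_(i <- s | P i) normc (F i).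
Proof.
elim/big_rec2: _ => [|i y1 y2 _ h]; first by rewrite Normc.normc0.
by rewrite (le_trans (le_normcD _ _))// lerD2l.
Qed.

Lemma ReM z w : complex.Re (z * w) =
  complex.Re z * complex.Re w - complex.Im z * complex.Im w.
Proof. by case: z; case: w. Qed.

Lemma ImM z w : complex.Im (z * w) =
  complex.Re z * complex.Im w + complex.Im z * complex.Re w.
Proof. by case: z; case: w. Qed.

Lemma ReD z w : complex.Re (z + w) = complex.Re z + complex.Re w.
Proof. by case: z; case: w. Qed.

Lemma ImD z w : complex.Im (z + w) = complex.Im z + complex.Im w.
Proof. by case: z; case: w. Qed.

Lemma ReN z : complex.Re (- z) = - complex.Re z.
Proof. by case: z. Qed.

Lemma ImN z : complex.Im (- z) = - complex.Im z.
Proof. by case: z. Qed.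

Lemma Re_nat n : complex.Re (n%:R : R[i]) = n%:R.
Proof. by rewrite -(rmorph_nat (real_complex R)). Qed.

Lemma Im_nat n : complex.Im (n%:R : R[i]) = 0.
Proof. by rewrite -(rmorph_nat (real_complex R)). Qed.

Lemma complex_ext z w : complex.Re z = complex.Re w ->
  complex.Im z = complex.Im w -> z = w.
Proof. by case: z; case: w => a b c d /= -> ->. Qed.

End complex_modulus.

(** * Taylor estimates for the complex exponential *)

Section complex_exponential.
Context {R : realType}.
Implicit Types (z w : R[i]) (x y : R).

Definition cexp z : R[i] :=
  (expR (complex.Re z) * cos (complex.Im z)) +i*
  (expR (complex.Re z) * sin (complex.Im z)).

Lemma cexp0 : cexp 0 = 1.
Proof. by rewrite /cexp /= expR0 cos0 sin0 mulr1 mulr0. Qed.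

Lemma cexpD z w : cexp (z + w) = cexp z * cexp w.
Proof.
apply: complex_ext; rewrite ?ReM ?ImM /= ReD ImD expRD ?cosD ?sinD; ring.
Qed.

Lemma normc_cexp z : normc (cexp z) = expR (complex.Re z).
Proof.
rewrite /= !exprMn -mulrDr cos2Dsin2 mulr1 sqrtr_sqr.
by rewrite ger0_norm// expR_ge0.
Qed.

Lemma cexp_real x : cexp x%:C = (expR x)%:C.
Proof. by rewrite /cexp /= cos0 sin0 mulr1 mulr0. Qed.

(** Each bound obtained from it serves as the derivative bound of the next one; this produces all
    the Taylor estimates below. *)
Lemma ler_MVT0 (f df : R -> R) (K x : R) : f 0 = 0 ->
  (forall y, is_derive y 1 f (df y)) ->
  (forall y, `|y| <= `|x| -> `|df y| <= K) -> `|f x| <= K * `|x|.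
Proof.
move=> f0 fd dK.
have fc : continuous f.
  move=> y; apply: differentiable_continuous; apply/derivable1_diffP.
  exact: (@ex_derive _ _ _ _ _ _ _ (fd y)).
have fw (A : set R) : {within A, continuous f} by exact: continuous_subspaceT.
have [x0|x0|->] := ltgtP x 0; last by rewrite f0 !normr0 mulr0.
- have [c] := @MVT _ f df x 0 x0 (fun y _ => fd y) (fw _).
  rewrite in_itv/= => /andP[xc c0].
  rewrite f0 !sub0r mulrN => /oppr_inj ->.
  rewrite normrM ler_wpM2r// dK// !ltr0_norm// lerN2; exact: ltW.
- have [c] := @MVT _ f df 0 x x0 (fun y _ => fd y) (fw _).
  rewrite in_itv/= => /andP[c0 cx].
  rewrite f0 !subr0 => ->.
  by rewrite normrM ler_wpM2r// dK// !gtr0_norm// ltW.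
Qed.

Lemma ler_expR_sub1 x : `|expR x - 1| <= `|x| * expR `|x|.
Proof.
rewrite mulrC.
apply: (@ler_MVT0 (fun x => expR x - 1) expR); rewrite ?expR0 ?subrr//.
  by move=> y; apply: is_derive_eq; rewrite subr0.
move=> y yx; rewrite ger0_norm ?expR_ge0// ler_expR.
exact: (le_trans (ler_norm _)).
Qed.

Lemma ler_expR_sub1_sub x : `|expR x - 1 - x| <= `|x| ^+ 2 * expR `|x|.
Proof.
have -> : `|x| ^+ 2 * expR `|x| = (`|x| * expR `|x|) * `|x| by ring.
apply: (@ler_MVT0 (fun x => expR x - 1 - x) (fun x => expR x - 1)).
- by rewrite expR0 subrr subr0.
- by move=> y; apply: is_derive_eq; rewrite subr0.
move=> y yx; apply: (le_trans (ler_expR_sub1 _)).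
by rewrite ler_pM ?expR_ge0// ler_expR.
Qed.

Lemma normr_sin_le x : `|sin x| <= `|x|.
Proof.
rewrite -[leRHS]mul1r; apply: (@ler_MVT0 sin cos); first exact: sin0.
by move=> y _; rewrite ler_norml cos_geN1 cos_le1.
Qed.

Lemma normr_cos_sub1_le x : `|cos x - 1| <= `|x| ^+ 2.
Proof.
rewrite expr2; apply: (@ler_MVT0 (fun x => cos x - 1) (fun x => - sin x)).
- by rewrite cos0 subrr.
- by move=> y; apply: is_derive_eq; rewrite subr0.
by move=> y yx; rewrite normrN (le_trans (normr_sin_le _)).
Qed.

Lemma normr_sin_sub_le x : `|sin x - x| <= `|x| ^+ 2 * 2.
Proof.
(* A quadratic bound is wanted for all x: the cubic Taylor bound gives it for small x, the triangle
   inequality for large x. *)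
have [x1|x1] := leP `|x| 1; last first.
  rewrite (le_trans (ler_normB _ _))// (le_trans (lerD (normr_sin_le _) (lexx _)))//.
  nra.
rewrite (@le_trans _ _ (`|x| ^+ 2 * `|x|))//; last by nra.
apply: (@ler_MVT0 (fun x => sin x - x) (fun x => cos x - 1)).
  by rewrite sin0 subrr.
move=> y yx; rewrite (le_trans (normr_cos_sub1_le _))//.
by rewrite lerXn2r ?nnegrE.
Qed.

(** Needed for differentiating under the integral sign, where z is proportional to u and hence
    unbounded. The constant 6 = 2 + 4 adds the contributions of the real and imaginary parts. *)
Lemma cexp_sub1_sub_le z :
  normc (cexp z - 1 - z) <= 6 * normc z ^+ 2 * expR (normc z).
Proof.
set r := normc z; set a := complex.Re z; set b := complex.Im z.
have ha : `|a| <= r by exact: ler_normc_Re.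
have hb : `|b| <= r by exact: ler_normc_Im.
have r0 : 0 <= r by exact: normc_ge0.
have a0 := normr_ge0 a; have b0 := normr_ge0 b.
set e := expR r; have e1 : 1 <= e by rewrite -expR0 ler_expR.
have ea : expR `|a| <= e by rewrite ler_expR.
have ea' : expR a <= e by rewrite ler_expR (le_trans (ler_norm _)).
have ea0 : 0 <= expR a by exact: expR_ge0.
have ea1 : 0 <= expR `|a| by exact: expR_ge0.
have a2 : `|a| ^+ 2 <= r ^+ 2 by rewrite lerXn2r ?nnegrE.
have b2 : `|b| ^+ 2 <= r ^+ 2 by rewrite lerXn2r ?nnegrE.
have r20 : 0 <= r ^+ 2 by exact: sqr_ge0.
have H1 : `|complex.Re (cexp z - 1 - z)| <= 2 * r ^+ 2 * e.
  rewrite !ReD !ReN /= -/a -/b.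
  have -> : expR a * cos b - 1 - a = (expR a - 1 - a) + expR a * (cos b - 1).
    by ring.
  rewrite (le_trans (ler_normD _ _))//.
  rewrite mulr_natl mulr2n mulrDl lerD//.
    by rewrite (le_trans (ler_expR_sub1_sub _))// ler_pM// sqr_ge0.
  rewrite normrM (ger0_norm ea0) mulrC ler_pM//.
  by rewrite (le_trans (normr_cos_sub1_le _)).
have H2 : `|complex.Im (cexp z - 1 - z)| <= 4 * r ^+ 2 * e.
  rewrite !ImD !ImN /= -/a -/b subr0.
  have -> : expR a * sin b - b = expR a * (sin b - b) + (expR a - 1) * b.
    by ring.
  rewrite (le_trans (ler_normD _ _))//.
  have -> : 4 * r ^+ 2 * e = e * (r ^+ 2 * 2) + (r * e) * r + e * r ^+ 2 by ring.
  have h3 : `|expR a * (sin b - b)| <= e * (r ^+ 2 * 2).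
    rewrite normrM (ger0_norm ea0) ler_pM//.
    by rewrite (le_trans (normr_sin_sub_le _))// ler_wpM2r.
  have h4 : `|(expR a - 1) * b| <= (r * e) * r.
    rewrite normrM ler_pM// (le_trans (ler_expR_sub1 _))//.
    by rewrite ler_pM.
  have h5 : 0 <= e * r ^+ 2 by rewrite mulr_ge0// (le_trans ler01).
  lra.
rewrite (le_trans (ler_normc_ReIm _))//; lra.
Qed.

End complex_exponential.

Section complex_derivative.
Context {R : realType}.

(** An integrated Taylor remainder has exactly this form, which spares any passage to the limit
    inside an integral. *)
Lemma derivable_quadratic (f : R[i]^o -> R[i]^o) (z L : R[i]) (K e : R) :
  0 < e ->
  (forall h : R[i], normc h < e ->
     normc (f (h + z) - f z - L * h) <= K * normc h ^+ 2) ->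
  derivable f z 1.
Proof.
move=> e0 H; apply/cvg_ex; exists (L : R[i]^o).
apply/cvgrPdist_le => /= d.
rewrite ltcE => /andP[/eqP/= d2]; case: d d2 => d ? /= -> d0.
near=> h.
have h0 : h != 0 by near: h; exists 1 => [|x _ /=]; [exact: ltr01|].
have he : normc h < e.
  near: h; exists e%:C => [|x /= + _]; first by rewrite /= ltcR.
  by rewrite sub0r normrN normC_normc ltcR.
have hd : normc h < d / (`|K| + 1).
  near: h; exists (d / (`|K| + 1))%:C => [|x /= + _].
    by rewrite /= ltcR divr_gt0// ltr_wpDl.
  by rewrite sub0r normrN normC_normc ltcR.
have -> : L - h^-1 *: (f (h *: (1 : R[i]^o) + z) - f z) =
   - (h^-1 * (f (h + z) - f z - L * h)).
  rewrite /GRing.scale/= mulr1; field; exact: h0.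
rewrite normrN normC_normc lecR Normc.normcM Normc.normcV.
have hp : 0 < normc h by rewrite normc_gt0.
rewrite ler_pdivrMl// [leRHS]mulrC.
apply: le_trans (H _ he) _.
have K1 : K < `|K| + 1 by rewrite (le_lt_trans (ler_norm _))// ltrDl.
rewrite expr2 mulrA ler_wpM2r ?normc_ge0//.
rewrite ltr_pdivlMr ?ltr_wpDl// in hd.
apply: le_trans (ltW hd).
by rewrite mulrC ler_wpM2l ?normc_ge0// ltW.
Unshelve. all: by end_near. Qed.

End complex_derivative.

Section complex_integral.
Context {R : realType}.
Local Notation mu := (@lebesgue_measure R).
Implicit Types (f g : R -> R[i]) (e C : R).

Lemma expR_lin_continuous (e : R) : continuous (fun u : R => expR (e * u)).
Proof.
move=> u; apply: continuous_comp; last exact: continuous_expR.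
by apply: continuousM; [exact: cvg_cst|exact: cvg_id].
Qed.

Lemma expR_abs_continuous (e : R) : continuous (fun u : R => expR (- (e * `|u|))).
Proof.
move=> u; apply: continuous_comp; last exact: continuous_expR.
apply: continuousN; apply: continuousM; first exact: cvg_cst.
exact: norm_continuous.
Qed.

Lemma expRN_cvg0 (e : R) : 0 < e -> expR (- e * u) @[u --> +oo] --> (0 : R).
Proof.
move=> e0; apply/cvgrPdist_le => /= d d0; near=> u.
rewrite sub0r normrN ger0_norm ?expR_ge0// mulNr expRN.
have u0 : 0 < u by near: u; exact: nbhs_pinfty_gt.
rewrite -[leRHS]invrK lef_pV2 ?posrE ?expR_gt0 ?invr_gt0//.
rewrite (@le_trans _ _ (1 + e * u))//; last first.
  by rewrite expR_ge1Dx.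
rewrite -lerBlDl -ler_pdivrMl//.
Unshelve. all: by end_near. Qed.

Lemma integral_expRN (e : R) : 0 < e ->
  (\int[mu]_(u in `[0%R, +oo[) (expR (- e * u))%:E)%E = (e^-1)%:E.
Proof.
move=> e0.
have -> : (e^-1)%:E = (0%:E - ((- e^-1) * expR (- e * 0))%:E)%E.
  by rewrite mulr0 expR0 mulr1 -EFinB sub0r opprK.
have dF (x : R) : is_derive x 1 (fun u : R => - e^-1 * expR (- e * u)) (expR (- e * x)).
  apply: is_derive_eq.
  by rewrite /GRing.scale /=; field; rewrite gt_eqF.
apply: (@ge0_continuous_FTC2y R _ (fun u => - e^-1 * expR (- e * u)) 0 0).
- by move=> x _; exact: expR_ge0.
- by apply: continuous_subspaceT; exact: expR_lin_continuous.
- rewrite -(mulr0 (- e^-1)); apply: cvgM; first exact: cvg_cst.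
  exact: expRN_cvg0.
- by move=> x _; exact: (@ex_derive _ _ _ _ _ _ _ (dF x)).
- apply: cvg_at_right_filter; apply: cvgM; first exact: cvg_cst.
  exact: expR_lin_continuous.
by move=> x _; rewrite derive1E (@derive_val _ _ _ _ _ _ _ (dF x)).
Qed.

Lemma integrable_expRN_abs (e : R) : 0 < e ->
  mu.-integrable setT (EFin \o (fun u : R => expR (- (e * `|u|)))).
Proof.
move=> e0; apply/integrableP; split.
  apply/measurable_EFinP; apply: continuous_measurable_fun.
  exact: expR_abs_continuous.
under eq_integral => u _ do rewrite /= ger0_norm ?expR_ge0//.
rewrite ge0_symfun_integralT.
- have -> : [set x : R | 0 <= x] = `[0, +oo[%classic.
    by apply/seteqP; split => x /=; rewrite in_itv/= andbT.
  set I := integral _ _ _; have -> : I = (e^-1)%:E; last by rewrite -EFinM ltry.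
  rewrite -integral_expRN//; apply: eq_integral => u /set_mem.
  by rewrite /= in_itv/= andbT => u0; rewrite ger0_norm// -mulNr.
- by move=> u; exact: expR_ge0.
- exact: expR_abs_continuous.
- by move=> u /=; rewrite normrN.
Qed.

Definition measurable_C f :=
  measurable_fun setT (fun u => complex.Re (f u)) /\
  measurable_fun setT (fun u => complex.Im (f u)).

(** A two-sided exponential bound is stable under sums and multiples and, at the price of a smaller
    rate, under exponential weights. The rate is strict, which later leaves room for a small change
    of z. *)
Definition exp_dominated f :=
  measurable_C f /\
  exists C e, 0 < e /\ forall u, normc (f u) <= C * expR (- (e * `|u|)).

Definition cint f : R[i] :=
  (\int[mu]_u complex.Re (f u)) +i* (\int[mu]_u complex.Im (f u)).

(** The factor 2 pays for estimating the real and imaginary parts separately in [cint_le]. *)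
Definition exp_mass (e : R) : R := 2 * \int[mu]_u expR (- (e * `|u|)).

Lemma exp_mass_ge0 e : 0 <= exp_mass e.
Proof. by rewrite mulr_ge0// Rintegral_ge0// => u _; exact: expR_ge0. Qed.

Lemma integrable_dominated (h : R -> R) C e : 0 < e ->
  measurable_fun setT h -> (forall u, `|h u| <= C * expR (- (e * `|u|))) ->
  mu.-integrable setT (EFin \o h).
Proof.
move=> e0 mh hC.
apply: (@le_integrable _ _ _ mu setT measurableT _
  (EFin \o (fun u : R => C * expR (- (e * `|u|))))).
- exact/measurable_EFinP.
- move=> u _ /=; rewrite lee_fin; apply: (le_trans (hC u)); exact: ler_norm.
- have := integrableZl measurableT C (integrable_expRN_abs e0).
  by apply: eq_integrable.
Qed.

Lemma dominated_integrable_Re f : exp_dominated f ->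
  mu.-integrable setT (EFin \o (fun u => complex.Re (f u))).
Proof.
move=> [[m1 m2] [C [e [e0 H]]]]; apply: (integrable_dominated e0 m1) => u.
exact: le_trans (ler_normc_Re _) (H u).
Qed.

Lemma dominated_integrable_Im f : exp_dominated f ->
  mu.-integrable setT (EFin \o (fun u => complex.Im (f u))).
Proof.
move=> [[m1 m2] [C [e [e0 H]]]]; apply: (integrable_dominated e0 m2) => u.
exact: le_trans (ler_normc_Im _) (H u).
Qed.

Lemma measurable_CD f g : measurable_C f -> measurable_C g ->
  measurable_C (fun u => f u + g u).
Proof.
move=> [f1 f2] [g1 g2]; split.
  under eq_fun do rewrite ReD; exact: measurable_funD.
under eq_fun do rewrite ImD; exact: measurable_funD.
Qed.

Lemma measurable_CM f g : measurable_C f -> measurable_C g ->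
  measurable_C (fun u => f u * g u).
Proof.
move=> [f1 f2] [g1 g2]; split.
  under eq_fun do rewrite ReM.
  by apply: measurable_funB; exact: measurable_funM.
under eq_fun do rewrite ImM.
by apply: measurable_funD; exact: measurable_funM.
Qed.

Lemma measurable_C_cst k : measurable_C (fun=> k).
Proof. by split; exact: measurable_cst. Qed.

Lemma measurable_C_real (h : R -> R) : measurable_fun setT h ->
  measurable_C (fun u => (h u)%:C).
Proof. by move=> mh; split => //; exact: measurable_cst. Qed.

Lemma exp_dominatedD f g : exp_dominated f -> exp_dominated g ->
  exp_dominated (fun u => f u + g u).
Proof.
move=> [mf [C [e [e0 H]]]] [mg [C' [e' [e'0 H']]]]; split.
  exact: measurable_CD.
exists (C + C'), (Num.min e e'); split; first by rewrite lt_min e0 e'0.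
have C0 : 0 <= C.
  have := le_trans (normc_ge0 _) (H 0); by rewrite pmulr_lge0 ?expR_gt0.
have C'0 : 0 <= C'.
  have := le_trans (normc_ge0 _) (H' 0); by rewrite pmulr_lge0 ?expR_gt0.
move=> u; rewrite (le_trans (le_normcD _ _))// mulrDl lerD//.
  apply: (le_trans (H u)); rewrite ler_wpM2l// ler_expR lerN2 ler_wpM2r//.
  by rewrite ge_min lexx.
apply: (le_trans (H' u)); rewrite ler_wpM2l// ler_expR lerN2 ler_wpM2r//.
by rewrite ge_min lexx orbT.
Qed.

Lemma exp_dominatedZ k f : exp_dominated f -> exp_dominated (fun u => k * f u).
Proof.
move=> [mf [C [e [e0 H]]]]; split.
  by apply: measurable_CM => //; exact: measurable_C_cst.
exists (normc k * C), e; split => // u.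
by rewrite Normc.normcM -mulrA ler_wpM2l ?normc_ge0.
Qed.

Lemma cintD f g : exp_dominated f -> exp_dominated g ->
  cint (fun u => f u + g u) = cint f + cint g.
Proof.
move=> df dg; apply: complex_ext; rewrite /cint ?ReD ?ImD /=.
  under eq_Rintegral do rewrite ReD.
  by rewrite RintegralD//; exact: dominated_integrable_Re.
under eq_Rintegral do rewrite ImD.
by rewrite RintegralD//; exact: dominated_integrable_Im.
Qed.

Lemma cintZ k f : exp_dominated f -> cint (fun u => k * f u) = k * cint f.
Proof.
move=> df.
have i1 := dominated_integrable_Re df.
have i2 := dominated_integrable_Im df.
have iZ (h : R -> R) c : mu.-integrable setT (EFin \o h) ->
    mu.-integrable setT (EFin \o (fun u => c * h u)).
  by move=> ih; have := integrableZl measurableT c ih; exact: eq_integrable.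
apply: complex_ext; rewrite /cint ?ReM ?ImM /=.
  under eq_Rintegral do rewrite ReM.
  by rewrite RintegralB ?RintegralZl//; exact: iZ.
under eq_Rintegral do rewrite ImM.
by rewrite RintegralD ?RintegralZl//; exact: iZ.
Qed.

Lemma cint_le f C e : 0 < e -> measurable_C f ->
  (forall u, normc (f u) <= C * expR (- (e * `|u|))) ->
  normc (cint f) <= C * exp_mass e.
Proof.
move=> e0 mf H.
have df : exp_dominated f by split=> //; exists C, e.
have i0 := integrable_expRN_abs e0.
have iC : mu.-integrable setT (EFin \o (fun u => C * expR (- (e * `|u|)))).
  by have := integrableZl measurableT C i0; exact: eq_integrable.
rewrite (le_trans (ler_normc_ReIm _))// /exp_mass mulrCA mulr_natl mulr2n.
have K (h : R -> R) : mu.-integrable setT (EFin \o h) ->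
    (forall u, `|h u| <= C * expR (- (e * `|u|))) ->
    `|\int[mu]_u h u| <= C * \int[mu]_u expR (- (e * `|u|)).
  move=> ih hC; apply: (le_trans (le_normr_Rintegral _ ih)) => //.
  rewrite -RintegralZl//; apply: le_Rintegral => //.
  have := integrable_norm ih; exact: eq_integrable.
rewrite lerD// K//.
- exact: dominated_integrable_Re.
- by move=> u; apply: le_trans (H u); exact: ler_normc_Re.
- exact: dominated_integrable_Im.
- by move=> u; apply: le_trans (H u); exact: ler_normc_Im.
Qed.

Lemma ge0_integral_shift (h : R -> R) (a : R) : continuous h ->
  (forall u, 0 <= h u) ->
  (\int[mu]_u (h (u + a))%:E = \int[mu]_u (h u)%:E)%E.
Proof.
move=> ch h0.
have dF : derive1 (fun u : R => u + a) = cst 1.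
  apply/funext => u; rewrite derive1E.
  have dx : is_derive u (1 : R) (fun u : R => u + a) (1 : R).
    by apply: is_derive_eq; rewrite addr0.
  exact: (@derive_val _ _ _ _ _ _ _ dx).
rewrite (@increasing_ge0_integration_by_substitutionT R (fun u => u + a) h)//.
- by apply: eq_integral => u _ /=; rewrite dF /= mulr1.
- by move=> x y xy; rewrite ltrD2r.
- by rewrite dF; exact: cst_continuous.
- by rewrite dF; exact: is_cvg_cst.
- by rewrite dF; exact: is_cvg_cst.
- exact: cvg_addrr_Ny.
- exact: cvg_addrr.
Qed.

Lemma Rintegral_shift (h : R -> R) (a : R) : continuous h ->
  mu.-integrable setT (EFin \o h) ->
  mu.-integrable setT (EFin \o (fun u => h (u + a))) ->
  \int[mu]_u h (u + a) = \int[mu]_u h u.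
Proof.
move=> ch ih ih'.
(* k is the difference of the non-negative functions k + |k| and |k|, to which the substitution rule
   for non-negative integrands applies. *)
have E (k : R -> R) : mu.-integrable setT (EFin \o k) ->
   \int[mu]_u k u = \int[mu]_u (k u + `|k u|) - \int[mu]_u `|k u|.
  move=> ik.
  have ia : mu.-integrable setT (EFin \o (fun u => `|k u|)).
    by have := integrable_norm ik; exact: eq_integrable.
  have iD : mu.-integrable setT (EFin \o (fun u => k u + `|k u|)).
    by have := integrableD measurableT ik ia; exact: eq_integrable.
  by rewrite RintegralD// addrK.
rewrite [LHS]E// [RHS]E//; congr (_ - _); rewrite /Rintegral; congr fine.
  apply: (@ge0_integral_shift (fun u => h u + `|h u|)).
    move=> u; apply: cvgD; first exact: ch.
    by apply: continuous_comp; [exact: ch|exact: norm_continuous].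
  by move=> u; have := ler_norm (- h u); rewrite normrN; lra.
apply: (@ge0_integral_shift (fun u => `|h u|)) => //.
by move=> u; apply: continuous_comp; [exact: ch|exact: norm_continuous].
Qed.

Lemma cint_shift f a : continuous (fun u => complex.Re (f u)) ->
  continuous (fun u => complex.Im (f u)) -> exp_dominated f ->
  exp_dominated (fun u => f (u + a)) ->
  cint (fun u => f (u + a)) = cint f.
Proof.
move=> c1 c2 df dfa; rewrite /cint; congr (_ +i* _).
  apply: (Rintegral_shift c1); exact: dominated_integrable_Re.
apply: (Rintegral_shift c2); exact: dominated_integrable_Im.
Qed.

End complex_integral.

Section laplace.
Context {R : realType}.
Local Notation mu := (@lebesgue_measure R).
Implicit Types (f g : R -> R[i]) (e C : R) (z : R[i]).

Lemma ler_id_expR (x : R) : x <= expR x.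
Proof. have := expR_ge1Dx x; lra. Qed.

Lemma ler_sqr_expR (x : R) : 0 <= x -> x ^+ 2 <= 4 * expR x.
Proof.
move=> x0; have -> : expR x = expR (x / 2) ^+ 2.
  by rewrite -expRM_natl; congr expR; field.
have := expR_ge1Dx (x / 2) => h.
have -> : 4 * expR (x / 2) ^+ 2 = (2 * expR (x / 2)) ^+ 2 by ring.
by rewrite lerXn2r ?nnegrE ?mulr_ge0 ?expR_ge0//; lra.
Qed.

Lemma exp_dominated_weight f g C C' e e' : e' < e -> 0 < e ->
  measurable_C f -> measurable_C g ->
  (forall u, normc (f u) <= C * expR (- (e * `|u|))) ->
  (forall u, normc (g u) <= C' * expR (e' * `|u|)) ->
  exp_dominated (fun u => g u * f u).
Proof.
move=> ee' e0 mf mg H H'; split; first exact: measurable_CM.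
exists (C' * C), (e - e'); split; first by rewrite subr_gt0.
move=> u; rewrite Normc.normcM.
have -> : C' * C * expR (- ((e - e') * `|u|)) =
   (C' * expR (e' * `|u|)) * (C * expR (- (e * `|u|))).
  rewrite mulrACA -expRD; congr (_ * expR _); ring.
by rewrite ler_pM ?normc_ge0.
Qed.

Lemma exp_dominated_sides f C1 e1 C2 e2 : measurable_C f -> 0 < e1 -> 0 < e2 ->
  (forall u, 0 <= u -> normc (f u) <= C1 * expR (- (e1 * u))) ->
  (forall u, u < 0 -> normc (f u) <= C2 * expR (e2 * u)) ->
  exp_dominated f.
Proof.
move=> mf e10 e20 H1 H2; split => //.
exists (`|C1| + `|C2|), (Num.min e1 e2); split; first by rewrite lt_min e10 e20.
move=> u; have [u0|u0] := leP 0 u.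
  apply: (le_trans (H1 _ u0)); rewrite (le_trans (ler_norm _))//.
  rewrite normrM (ger0_norm (expR_ge0 _)) ler_pM// ?expR_ge0//.
    by rewrite lerDl.
  by rewrite ler_expR lerN2 ger0_norm// ler_wpM2r// ge_min lexx.
apply: (le_trans (H2 _ u0)); rewrite (le_trans (ler_norm _))//.
rewrite normrM (ger0_norm (expR_ge0 _)) ler_pM// ?expR_ge0//.
  by rewrite lerDr.
rewrite ler_expR ltr0_norm// mulrN opprK ler_wnM2r//; first exact: ltW.
by rewrite ge_min lexx orbT.
Qed.

Lemma cexp_lin_continuous z :
  continuous (fun u : R => complex.Re (cexp (z * u%:C))) /\
  continuous (fun u : R => complex.Im (cexp (z * u%:C))).
Proof.
have E1 (u : R) : complex.Re (z * u%:C) = complex.Re z * u.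
  by rewrite ReM /= mulr0 subr0.
have E2 (u : R) : complex.Im (z * u%:C) = complex.Im z * u.
  by rewrite ImM /= mulr0 add0r.
have cl (k : R) : continuous (fun u : R => k * u).
  by move=> u; apply: cvgM; [exact: cvg_cst|exact: cvg_id].
split=> u.
  rewrite /cexp/=; under eq_fun do rewrite !E1 !E2.
  apply: cvgM; apply: continuous_comp; try exact: cl.
    exact: continuous_expR.
  exact: continuous_cos.
rewrite /cexp/=; under eq_fun do rewrite !E1 !E2.
apply: cvgM; apply: continuous_comp; try exact: cl.
  exact: continuous_expR.
exact: continuous_sin.
Qed.

Lemma measurable_C_cexp z : measurable_C (fun u : R => cexp (z * u%:C)).
Proof.
by split; apply: continuous_measurable_fun; have [] := cexp_lin_continuous z.
Qed.

Definition laplace g z := cint (fun u => cexp (- z * u%:C) * g u).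

Definition laplace_dom g z := exp_dominated (fun u => cexp (- z * u%:C) * g u).

Lemma normc_cexp_lin z (u : R) :
  normc (cexp (z * u%:C)) = expR (complex.Re z * u).
Proof. by rewrite normc_cexp ReM /= mulr0 subr0. Qed.

Lemma laplace_derivable g z : measurable_C g -> laplace_dom g z ->
  derivable (laplace g : R[i]^o -> R[i]^o) z 1.
Proof.
move=> mg [mf [C [e [e0 H]]]].
set f := (fun u => cexp (- z * u%:C) * g u) in mf H.
have C0 : 0 <= C.
  by have := le_trans (normc_ge0 _) (H 0); rewrite pmulr_lge0 ?expR_gt0.
have mid : measurable_C (fun u : R => - u%:C).
  rewrite -[X in measurable_C X]/(fun u : R => - (u%:C)).
  under eq_fun do rewrite -rmorphN.
  by apply: measurable_C_real; exact: measurable_funN.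
have df1 : exp_dominated (fun u => - u%:C * f u).
  apply: (@exp_dominated_weight f _ C (2 / e) e (e / 2)) => //; first lra.
  move=> u; rewrite normcN normc_real.
  have := ler_id_expR (e / 2 * `|u|).
  rewrite -ler_pdivlMl ?divr_gt0// => /le_trans; apply.
  by rewrite invf_div.
have dexp (h : R[i]) : normc h < e / 4 ->
    exp_dominated (fun u => cexp (- h * u%:C) * f u).
  move=> he; apply: (@exp_dominated_weight f _ C 1 e (e / 4)) => //; first lra.
    exact: measurable_C_cexp.
  move=> u; rewrite normc_cexp_lin mul1r ler_expR ReN.
  rewrite (le_trans (ler_norm _))// normrM normrN ler_wpM2r//.
  by rewrite (le_trans (ler_normc_Re _))// ltW.
(* The rate e is shared out: a quarter absorbs u^2, at the cost of the factor 16 / e^2 * 4 from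
   [ler_sqr_expR]; a quarter absorbs e^{|h u|}, whence |h| < e / 4; the remaining half is
   integrated. *)
apply: (@derivable_quadratic R _ z (cint (fun u => - u%:C * f u))
  ((C * (6 * (16 / e ^+ 2) * 4)) * exp_mass (e / 2)) (e / 4)).
  by rewrite divr_gt0.
move=> h he.
have dh := dexp _ he.
have d0 : exp_dominated f by split => //; exists C, e.
have -> : laplace g (h + z) - laplace g z - cint (fun u => - u%:C * f u) * h =
    cint (fun u => (cexp (- h * u%:C) - 1 - (- h * u%:C)) * f u).
  have -> : laplace g (h + z) = cint (fun u => cexp (- h * u%:C) * f u).
    congr cint; apply/funext => u.
    by rewrite /f mulrA -cexpD -mulrDl opprD.
  have -> : cint (fun u => - u%:C * f u) * h = - (- h) * cint (fun u => - u%:C * f u).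
    by rewrite opprK mulrC.
  rewrite mulNr opprK.
  rewrite -cintZ//.
  have -> : - laplace g z = cint (fun u => -1 * f u) by rewrite cintZ// mulN1r.
  have d1 := exp_dominatedZ (-1) d0.
  have d2 := exp_dominatedZ (- h) df1.
  rewrite -cintD// -cintD//; last exact: exp_dominatedD.
  congr cint; apply/funext => u; ring.
have -> : C * (6 * (16 / e ^+ 2) * 4) * exp_mass (e / 2) * normc h ^+ 2 =
  (C * (6 * (16 / e ^+ 2) * 4) * normc h ^+ 2) * exp_mass (e / 2) by ring.
apply: cint_le; first by rewrite divr_gt0.
  apply: measurable_CM => //.
  have -> : (fun u : R => cexp (- h * u%:C) - 1 - - h * u%:C) =
      (fun u : R => (cexp (- h * u%:C) + -1) + - h * - u%:C).
    by apply/funext => u; ring.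
  apply: measurable_CD.
    apply: measurable_CD; [exact: measurable_C_cexp|exact: measurable_C_cst].
  by apply: measurable_CM => //; exact: measurable_C_cst.
move=> u; rewrite Normc.normcM.
apply: (@le_trans _ _ ((6 * normc (- h * u%:C) ^+ 2 *
   expR (normc (- h * u%:C))) * (C * expR (- (e * `|u|))))).
  by rewrite ler_pM ?normc_ge0//; [exact: cexp_sub1_sub_le|exact: H].
rewrite Normc.normcM normcN normc_real exprMn.
have h1 : `|u| ^+ 2 <= 16 / e ^+ 2 * 4 * expR (e / 4 * `|u|).
  have := @ler_sqr_expR (e / 4 * `|u|).
  rewrite mulr_ge0 ?divr_ge0 ?(ltW e0)// => /(_ isT).
  rewrite exprMn -ler_pdivlMl ?exprn_gt0 ?divr_gt0// => /le_trans; apply.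
  by rewrite le_eqVlt; apply/orP; left; apply/eqP; field; rewrite gt_eqF.
have h2 : expR (normc h * `|u|) <= expR (e / 4 * `|u|).
  by rewrite ler_expR ler_wpM2r// ltW.
have -> : expR (- (e / 2 * `|u|)) =
  expR (e / 4 * `|u|) * expR (e / 4 * `|u|) * expR (- (e * `|u|)).
  by rewrite -!expRD; congr expR; field.
set A := expR (e / 4 * `|u|) in h1 h2 *.
have hn : 0 <= normc h ^+ 2 by exact: sqr_ge0.
rewrite (_ : 6 * _ * _ * _ = (6 * normc h ^+ 2 * C * expR (- (e * `|u|))) *
  (`|u| ^+ 2 * expR (normc h * `|u|))); last by ring.
rewrite (_ : C * _ * _ * _ = (6 * normc h ^+ 2 * C * expR (- (e * `|u|))) *
  ((16 / e ^+ 2 * 4 * A) * A)); last by ring.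
rewrite ler_wpM2l ?mulr_ge0 ?expR_ge0 ?normc_ge0//.
by rewrite ler_pM ?expR_ge0 ?sqr_ge0.
Qed.

Lemma laplaceD f g z : laplace_dom f z -> laplace_dom g z ->
  laplace (fun u => f u + g u) z = laplace f z + laplace g z.
Proof.
move=> df dg; rewrite /laplace -cintD//; congr cint.
by apply/funext => u; rewrite mulrDr.
Qed.

Lemma laplaceZ k g z : laplace_dom g z ->
  laplace (fun u => k * g u) z = k * laplace g z.
Proof.
move=> dg; rewrite /laplace -cintZ//; congr cint.
by apply/funext => u; rewrite mulrCA.
Qed.

Lemma laplace_domD f g z : laplace_dom f z -> laplace_dom g z ->
  laplace_dom (fun u => f u + g u) z.
Proof.
move=> df dg; have := exp_dominatedD df dg; congr exp_dominated.
by apply/funext => u; rewrite mulrDr.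
Qed.

Lemma laplace_domZ k g z : laplace_dom g z -> laplace_dom (fun u => k * g u) z.
Proof.
move=> dg; have := exp_dominatedZ k dg; congr exp_dominated.
by apply/funext => u; rewrite mulrCA.
Qed.

Lemma integral_FTCy (F f : R -> R) (C e a : R) : 0 < e ->
  continuous f -> (forall u : R, is_derive u (1 : R) F (f u)) ->
  (forall u, a <= u -> `|f u| <= C * expR (- (e * u))) ->
  F u @[u --> +oo] --> (0 : R) ->
  \int[mu]_(u in `[a, +oo[) f u = - F a.
Proof.
move=> e0 cf dF fC F0.
(* The majorant g of |f| has the explicit primitive G. Since f + g >= 0, the half-line theorem for
   non-negative integrands applies to f + g and to g; the claim is the difference. *)
pose g u := C * expR (- e * u); pose G u := - (C / e) * expR (- e * u).
have dG (u : R) : is_derive u (1 : R) G (g u).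
  apply: is_derive_eq; rewrite /g /GRing.scale /=; field; exact: lt0r_neq0.
have cg : continuous g.
  by move=> u; apply: cvgM; [exact: cvg_cst|exact: expR_lin_continuous].
have cF : continuous F.
  move=> y; apply: differentiable_continuous; apply/derivable1_diffP.
  exact: (@ex_derive _ _ _ _ _ _ _ (dF y)).
have cG : continuous G.
  by move=> u; apply: cvgM; [exact: cvg_cst|exact: expR_lin_continuous].
have G0 : G u @[u --> +oo] --> (0 : R).
  rewrite -(mulr0 (- (C / e))); apply: cvgM; first exact: cvg_cst.
  exact: expRN_cvg0.
have fg0 u : a <= u -> `|f u| <= g u.
  by move=> au; rewrite /g mulNr fC.
have g0 u : a <= u -> 0 <= g u by move=> au; rewrite (le_trans _ (fg0 u au)).
have Ig : (\int[mu]_(u in `[a, +oo[) (g u)%:E = - (G a)%:E)%E.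
  rewrite (@ge0_continuous_FTC2y R g G a 0)//.
  - by rewrite sub0e.
  - exact: continuous_subspaceT.
  - by apply: cvg_at_right_filter; exact: cG.
  - by move=> x _; rewrite derive1E (@derive_val _ _ _ _ _ _ _ (dG x)).
have Ifg : (\int[mu]_(u in `[a, +oo[) (f u + g u)%:E = - (F a + G a)%:E)%E.
  rewrite (@ge0_continuous_FTC2y R _ (F + G) a 0)//.
  - by rewrite sub0e.
  - by move=> u au; have := ler_norm (- f u); rewrite normrN; have := fg0 u au; lra.
  - by apply: continuous_subspaceT => u; apply: cvgD; [exact: cf|exact: cg].
  - by rewrite -(addr0 0); apply: cvgD.
  - by apply: cvg_at_right_filter; apply: cvgD; [exact: cF|exact: cG].
  - move=> x _; have dFG : is_derive x (1 : R) (F + G) (f x + g x).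
      by apply: is_deriveD.
    by rewrite derive1E (@derive_val _ _ _ _ _ _ _ dFG).
have ig : mu.-integrable `[a, +oo[ (EFin \o g).
  apply/integrableP; split.
    apply/measurable_EFinP; apply: measurable_funTS.
    exact: continuous_measurable_fun.
  under eq_integral => u.
    move=> /set_mem/=; rewrite in_itv/= andbT => au; rewrite ger0_norm ?g0//; over.
  by rewrite Ig -EFinN ltry.
have if_ : mu.-integrable `[a, +oo[ (EFin \o f).
  apply: le_integrable ig => //.
    apply/measurable_EFinP; apply: measurable_funTS.
    exact: continuous_measurable_fun.
  move=> u /=; rewrite in_itv/= andbT => au.
  by rewrite lee_fin (ger0_norm (g0 u au)) fg0.
have : \int[mu]_(u in `[a, +oo[) (f u + g u) = - (F a + G a).
  by rewrite /Rintegral Ifg.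
rewrite RintegralD// {2}/Rintegral Ig/=; lra.
Qed.

End laplace.

(** * Complex integrals of derivatives over half-lines *)

Section complex_FTC.
Context {R : realType}.
Local Notation mu := (@lebesgue_measure R).
Implicit Types (e C : R) (z : R[i]).

Lemma expRN_bound_cvg0 (h : R -> R) (C e a : R) : 0 < e ->
  (forall u, a <= u -> `|h u| <= C * expR (- (e * u))) ->
  h u @[u --> +oo] --> (0 : R).
Proof.
move=> e0 H.
have E : C * expR (- e * u) @[u --> +oo] --> (0 : R).
  rewrite -(mulr0 C); apply: cvgM; [exact: cvg_cst|exact: expRN_cvg0].
have E' : - (C * expR (- e * u)) @[u --> +oo] --> (0 : R).
  by rewrite -oppr0; apply: cvgN.
apply: (squeeze_cvgr _ E' E); near=> u.
have au : a <= u by near: u; apply: nbhs_pinfty_ge; exact: num_real.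
by have := H u au; rewrite ler_norml mulNr.
Unshelve. all: by end_near. Qed.

(** The integrand is the derivative of e^{-zu} h(u), which vanishes at +oo by the last hypothesis.
    The choice h = 1 gives the transform 1/z of a half-line, and h = [gamma_ker] the functional
    equation of Gamma. *)
Lemma cint_FTCy (h h' : R -> R) z (a C C' e : R) : 0 < e ->
  continuous h' -> (forall u : R, is_derive u (1 : R) h (h' u)) ->
  (forall u, a <= u ->
    normc (cexp (- z * u%:C) * ((h' u)%:C - z * (h u)%:C)) <= C * expR (- (e * u))) ->
  (forall u, a <= u ->
    normc (cexp (- z * u%:C) * (h u)%:C) <= C' * expR (- (e * u))) ->
  cint (fun u => if a <= u then
      cexp (- z * u%:C) * ((h' u)%:C - z * (h u)%:C) else 0) =
  - (cexp (- z * a%:C) * (h a)%:C).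
Proof.
move=> e0 ch' dh H1 H2.
pose F u := cexp (- z * u%:C) * (h u)%:C.
pose f u := cexp (- z * u%:C) * ((h' u)%:C - z * (h u)%:C).
have ch : continuous h.
  move=> y; apply: differentiable_continuous; apply/derivable1_diffP.
  exact: (@ex_derive _ _ _ _ _ _ _ (dh y)).
have E (k : R -> R) : \int[mu]_u (if a <= u then k u else 0) =
    \int[mu]_(u in `[a, +oo[) k u.
  rewrite [RHS]Rintegral_mkcond; apply: eq_Rintegral => u _.
  rewrite /patch; case: ifPn => au.
    by rewrite mem_set//= in_itv/= andbT.
  by rewrite memNset//= in_itv/= andbT; exact/negP.
have [cR cI] := cexp_lin_continuous (- z).
have e1 (u : R) : complex.Re (- z * u%:C) = - complex.Re z * u.
  by rewrite ReM ReN /= mulr0 subr0.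
have e2 (u : R) : complex.Im (- z * u%:C) = - complex.Im z * u.
  by rewrite ImM ImN /= mulr0 add0r.
rewrite /cint; apply: complex_ext => /=.
- rewrite -[RHS]/(complex.Re (- F a)) ReN.
  under eq_Rintegral do rewrite (fun_if (@complex.Re R)) /=.
  rewrite E; apply: (@integral_FTCy R (fun u => complex.Re (F u))
     (fun u => complex.Re (f u)) C e a e0).
  + under eq_fun do rewrite /f ReM !ReD !ReN !ImD !ImN !ReM !ImM /=.
    move=> u; apply: cvgB; apply: cvgM; [exact: cR| |exact: cI|].
      apply: cvgB; first exact: ch'.
      by apply: cvgB; apply: cvgM; [exact: cvg_cst|exact: ch|exact: cvg_cst|exact: cvg_cst].
    apply: cvgB; first exact: cvg_cst.
    by apply: cvgD; apply: cvgM; [exact: cvg_cst|exact: cvg_cst|exact: cvg_cst|exact: ch].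
  + move=> u; rewrite /F /f.
    under eq_fun do rewrite ReM /= mulr0 subr0 -/(complex.Im _) e1 e2.
    apply: is_derive_eq.
    rewrite /GRing.scale/= ReM !ReD !ReN !ImD !ImN !ReM !ImM /= e1 e2.
    ring.
  + by move=> u au; apply: le_trans (H1 u au); exact: ler_normc_Re.
  + apply: (@expRN_bound_cvg0 _ C' e a) => // u au.
    by apply: le_trans (H2 u au); exact: ler_normc_Re.
- rewrite -[RHS]/(complex.Im (- F a)) ImN.
  under eq_Rintegral do rewrite (fun_if (@complex.Im R)) /=.
  rewrite E; apply: (@integral_FTCy R (fun u => complex.Im (F u))
     (fun u => complex.Im (f u)) C e a e0).
  + under eq_fun do rewrite /f ImM !ReD !ReN !ImD !ImN !ReM !ImM /=.
    move=> u; apply: cvgD; apply: cvgM; [exact: cR| |exact: cI|].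
      apply: cvgB; first exact: cvg_cst.
      by apply: cvgD; apply: cvgM; [exact: cvg_cst|exact: cvg_cst|exact: cvg_cst|exact: ch].
    apply: cvgB; first exact: ch'.
    by apply: cvgB; apply: cvgM; [exact: cvg_cst|exact: ch|exact: cvg_cst|exact: cvg_cst].
  + move=> u; rewrite /F /f.
    under eq_fun do rewrite ImM /= mulr0 add0r -/(complex.Re _) e1 e2.
    apply: is_derive_eq.
    rewrite /GRing.scale/= ImM !ReD !ReN !ImD !ImN !ReM !ImM /= e1 e2.
    ring.
  + by move=> u au; apply: le_trans (H1 u au); exact: ler_normc_Im.
  + apply: (@expRN_bound_cvg0 _ C' e a) => // u au.
    by apply: le_trans (H2 u au); exact: ler_normc_Im.
Qed.

Lemma measurable_C_if (a : R) (f : R -> R[i]) : measurable_C f ->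
  measurable_C (fun u => if a <= u then f u else 0).
Proof.
move=> [m1 m2].
have mb : measurable_fun setT (fun u : R => a <= u).
  by apply: measurable_fun_ler => //; exact: measurable_cst.
by split; under eq_fun do rewrite fun_if; apply: measurable_fun_ifT => //;
  exact: measurable_cst.
Qed.

Lemma halfline_dominated z : 0 < complex.Re z ->
  exp_dominated (fun u => if 0 <= u then cexp (- z * u%:C) else 0).
Proof.
move=> z0; apply: (@exp_dominated_sides _ _ 1 (complex.Re z) 1 1) => //.
- by apply: measurable_C_if; exact: measurable_C_cexp.
- by move=> u u0; rewrite u0 normc_cexp_lin ReN mul1r mulNr.
- move=> u u0.
  have -> : (0 <= u) = false by apply/negbTE; rewrite -ltNge.
  by rewrite Normc.normc0 mul1r expR_ge0.
Qed.

Lemma cint_halfline z : 0 < complex.Re z ->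
  cint (fun u => if 0 <= u then cexp (- z * u%:C) else 0) = z^-1.
Proof.
move=> z0.
have z_neq0 : z != 0 by apply: contraTneq z0 => ->; rewrite ltxx.
have H := @cint_FTCy (fun=> 1) (fun=> 0) z 0 (normc z) 1 (complex.Re z) z0.
apply: (mulfI z_neq0); rewrite divff// -cintZ; last exact: halfline_dominated.
apply: (@oppr_inj R[i]).
have := H (@cst_continuous _ _ 0) _ _ _.
rewrite mulr0 cexp0 mul1r => <-.
- rewrite -mulN1r -cintZ.
    congr cint; apply/funext => u; case: ifPn => _; last by rewrite !mulr0.
    by rewrite rmorph0 rmorph1; ring.
  exact/exp_dominatedZ/halfline_dominated.
- move=> u u0; rewrite rmorph0 rmorph1 mulr1 sub0r mulrN normcN Normc.normcM.
  by rewrite normc_cexp_lin ReN mulNr mulrC.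
- by move=> u u0; rewrite rmorph1 mulr1 normc_cexp_lin ReN mulNr mul1r.
Qed.

End complex_FTC.

(** * The Gamma function *)

Section gamma_function.
Context {R : realType}.
Implicit Types (e C x : R) (z : R[i]).

(* In the variable u = - ln t, Mellin transforms in t become bilateral Laplace
   transforms in u, and e^{-t} becomes this kernel. *)
Definition gamma_ker (u : R) : R := expR (- expR (- u)).

Definition gammac (z : R[i]) : R[i] := laplace (fun u => (gamma_ker u)%:C) z.

Lemma gamma_ker_ge0 u : 0 <= gamma_ker u. Proof. exact: expR_ge0. Qed.

Lemma gamma_ker_le1 u : gamma_ker u <= 1.
Proof. by rewrite -expR0 ler_expR oppr_le0 expR_ge0. Qed.

(** s^a e^{-s} is maximal at s = a, with value (a / e)^a; the proof is 1 + x <= e^x at x = ln (s /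
    a). *)
Lemma expRN_le_pow (a s : R) : 0 < a -> 0 < s ->
  expR (- s) <= expR (a * (ln a - 1)) * expR (- (a * ln s)).
Proof.
move=> a0 s0; rewrite -expRD ler_expR.
have := expR_ge1Dx (ln s - ln a).
rewrite expRD expRN !lnK ?posrE// ler_pdivlMr//; nra.
Qed.

Lemma gamma_ker_le (a u : R) : 0 < a ->
  gamma_ker u <= expR (a * (ln a - 1)) * expR (a * u).
Proof.
move=> a0; have := @expRN_le_pow a (expR (- u)) a0 (expR_gt0 _).
by rewrite expRK mulrN opprK.
Qed.

Lemma continuous_gamma_ker : continuous gamma_ker.
Proof.
move=> u; apply: continuous_comp; last exact: continuous_expR.
apply: cvgN; apply: continuous_comp; last exact: continuous_expR.
by apply: cvgN; exact: cvg_id.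
Qed.

Lemma measurable_gamma_ker : measurable_C (fun u => (gamma_ker u)%:C).
Proof.
apply: measurable_C_real; apply: continuous_measurable_fun.
exact: continuous_gamma_ker.
Qed.

(** At +oo the kernel tends to 1, so Re z > 0 provides the decay. At -oo the kernel beats every
    exponential, and the exponent Re z + 1 leaves a factor e^u. *)
Lemma gamma_dom z : 0 < complex.Re z -> laplace_dom (fun u => (gamma_ker u)%:C) z.
Proof.
move=> z0; apply: (@exp_dominated_sides _ _ 1 (complex.Re z)
  (expR ((complex.Re z + 1) * (ln (complex.Re z + 1) - 1))) 1) => //.
- by apply: measurable_CM; [exact: measurable_C_cexp|exact: measurable_gamma_ker].
- move=> u u0; rewrite Normc.normcM normc_real normc_cexp_lin ReN mulNr mul1r.
  by rewrite ger0_norm ?gamma_ker_ge0// ler_piMr ?expR_ge0 ?gamma_ker_le1.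
- move=> u u0; rewrite Normc.normcM normc_real normc_cexp_lin ReN mulNr mul1r.
  rewrite ger0_norm ?gamma_ker_ge0//.
  have x1 : 0 < complex.Re z + 1 by lra.
  apply: (le_trans (ler_wpM2l (expR_ge0 _) (gamma_ker_le u x1))).
  rewrite mulrCA ler_wpM2l ?expR_ge0// -expRD ler_expR; lra.
Qed.

Lemma gammac_derivable z : 0 < complex.Re z ->
  derivable (gammac : R[i]^o -> R[i]^o) z 1.
Proof.
move=> z0; apply: laplace_derivable; first exact: measurable_gamma_ker.
exact: gamma_dom.
Qed.

Lemma is_derive_gamma_ker (u : R) :
  is_derive u (1 : R) gamma_ker (expR (- u) * gamma_ker u).
Proof.
apply: is_derive_eq; rewrite /gamma_ker /GRing.scale/= /GRing.scale/=; ring.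
Qed.

(** This stands for letting a tend to -oo in the proof of the functional equation; a is chosen so
    that the bound is at most c / 2. *)
Lemma le_expR_eq0 (c A e : R) : 0 < e -> 0 <= c ->
  (forall a, a <= 0 -> c <= A * expR (e * a)) -> c = 0.
Proof.
move=> e0 c0 H; apply/eqP; rewrite eq_le c0 andbT leNgt; apply/negP => cp.
pose b := c / (`|A| + 1) / 2.
have A1 : 0 < `|A| + 1 by rewrite ltr_wpDl.
have b0 : 0 < b by rewrite !divr_gt0.
pose a := Num.min 0 (ln b / e).
have := H a; rewrite ge_min lexx => /(_ isT).
have h1 : expR (e * a) <= b.
  rewrite -[leRHS]lnK ?posrE// ler_expR -ler_pdivlMl// mulrC.
  by rewrite ge_min lexx orbT.
have h2 : A * expR (e * a) <= (`|A| + 1) * b.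
  apply: (@le_trans _ _ ((`|A| + 1) * expR (e * a))).
    by rewrite ler_wpM2r ?expR_ge0// (le_trans (ler_norm _))// lerDl.
  by rewrite ler_wpM2l// ltW.
have -> : c = 2 * ((`|A| + 1) * b) by rewrite /b; field; rewrite gt_eqF.
have : 0 < (`|A| + 1) * b by rewrite mulr_gt0.
lra.
Qed.

(** Integration by parts: f is the derivative of e^{-zu} [gamma_ker u]. Its integral is computed
    only on [a, +oo[, so the whole integral is at most the boundary term at a plus the tail below a.
    Both are O(e^{da/2}) for a <= 0. *)
Lemma gammacS z : 0 < complex.Re z -> gammac (z + 1) = z * gammac z.
Proof.
move=> z0; pose x := complex.Re z.
have z10 : 0 < complex.Re (z + 1) by rewrite ReD /=; lra.
pose f (u : R) := cexp (- z * u%:C) *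
  ((expR (- u) * gamma_ker u)%:C - z * (gamma_ker u)%:C).
have fE : f = (fun u => cexp (- (z + 1) * u%:C) * (gamma_ker u)%:C +
     - z * (cexp (- z * u%:C) * (gamma_ker u)%:C)).
  apply/funext => u; rewrite /f rmorphM mulrDr; congr (_ + _); last by ring.
  rewrite mulrA; congr (_ * _).
  rewrite -[X in _ * X]/((expR (- u))%:C) -cexp_real -cexpD; congr cexp.
  by rewrite rmorphN; ring.
have df : exp_dominated f.
  rewrite fE; apply: exp_dominatedD; first exact: gamma_dom.
  apply: exp_dominatedZ; exact: gamma_dom.
have If : cint f = gammac (z + 1) - z * gammac z.
  rewrite fE cintD; last 2 first.
    exact: gamma_dom.
    apply: exp_dominatedZ; exact: gamma_dom.
  by rewrite cintZ ?mulNr//; exact: gamma_dom.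
apply/eqP; rewrite -subr_eq0 -If -normc_eq0; apply/eqP.
have [mf [C [e [e0 H]]]] := df.
have [_ [C' [e' [e'0 H']]]] := gamma_dom z0.
pose d := Num.min e e'.
have d0 : 0 < d by rewrite lt_min e0 e'0.
have C0 : 0 <= C.
  by have := le_trans (normc_ge0 _) (H 0); rewrite pmulr_lge0 ?expR_gt0.
have C'0 : 0 <= C'.
  by have := le_trans (normc_ge0 _) (H' 0); rewrite pmulr_lge0 ?expR_gt0.
have Hd (u : R) : normc (f u) <= C * expR (- (d * `|u|)).
  apply: (le_trans (H u)); rewrite ler_wpM2l// ler_expR lerN2 ler_wpM2r//.
  by rewrite ge_min lexx.
have Hd' (u : R) : normc (cexp (- z * u%:C) * (gamma_ker u)%:C) <=
    C' * expR (- (d * `|u|)).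
  apply: (le_trans (H' u)); rewrite ler_wpM2l// ler_expR lerN2 ler_wpM2r//.
  by rewrite ge_min lexx orbT.
apply: (@le_expR_eq0 _ (C' + C * exp_mass (d / 2)) (d / 2)).
- by rewrite divr_gt0.
- exact: normc_ge0.
move=> a a0.
have ed (u : R) : expR (- (d * `|u|)) <= expR (- (d * u)).
  by rewrite ler_expR lerN2 ler_wpM2l ?ler_norm// ltW.
have ca : continuous (fun u => expR (- u) * gamma_ker u).
  move=> u; apply: cvgM; last exact: continuous_gamma_ker.
  apply: continuous_comp; last exact: continuous_expR.
  by apply: cvgN; exact: cvg_id.
have I1 := @cint_FTCy R gamma_ker _ z a C C' d d0 ca is_derive_gamma_ker
  (fun u _ => le_trans (Hd u) (ler_wpM2l C0 (ed u)))
  (fun u _ => le_trans (Hd' u) (ler_wpM2l C'0 (ed u))).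
have da : exp_dominated (fun u => if a <= u then f u else 0).
  split; first exact: measurable_C_if.
  exists C, d; split=> // u; case: ifPn => // _.
  by rewrite Normc.normc0 mulr_ge0 ?expR_ge0.
pose r u := f u + -1 * (if a <= u then f u else 0).
have dr : exp_dominated r by apply: exp_dominatedD => //; exact: exp_dominatedZ.
have -> : cint f = cint r - (cexp (- z * a%:C) * (gamma_ker a)%:C).
  rewrite -[X in _ = _ + X]I1 cintD//; last exact: exp_dominatedZ.
  by rewrite cintZ// mulN1r subrK.
rewrite (le_trans (normcB _ _))// mulrDl addrC lerD//.
  apply: (le_trans (Hd' a)); rewrite ler_wpM2l// ler_expR ler0_norm// mulrN opprK.
  by rewrite ler_wnM2r//; lra.
rewrite mulrAC; apply: cint_le; first by rewrite divr_gt0.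
  by case: dr.
move=> u; rewrite /r; have [au|au] := leP a u.
  by rewrite mulN1r subrr Normc.normc0 !mulr_ge0 ?expR_ge0.
rewrite mulr0 addr0; apply: (le_trans (Hd u)).
rewrite -mulrA ler_wpM2l// -expRD ler_expR.
have u0 : u <= 0 by rewrite (le_trans (ltW au)).
rewrite ler0_norm//; nra.
Qed.

(** Replacing t by l t translates u by - ln l, and the translation comes out of the transform as
    l^{-z}. *)
Lemma gammac_scale z (l : R) : 0 < complex.Re z -> 0 < l ->
  laplace (fun u => (expR (- (l * expR (- u))))%:C) z =
  cexp (- z * (ln l)%:C) * gammac z.
Proof.
move=> z0 l0.
pose f u := cexp (- z * u%:C) * (gamma_ker u)%:C.
pose g u := cexp (- z * u%:C) * (expR (- (l * expR (- u))))%:C.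
have gE u : g u = cexp (- z * (ln l)%:C) * f (u + - ln l).
  rewrite /f /g mulrA -cexpD -mulrDr -rmorphD addrC subrK /gamma_ker.
  by rewrite opprB expRD lnK.
have [cR cI] := cexp_lin_continuous (- z).
have dg : exp_dominated (fun u => f (u + - ln l)).
  have [[m1 m2] [C [e [e0 H]]]] := gamma_dom z0.
  have mt : measurable_fun setT (fun u : R => u + - ln l).
    by apply: measurable_funD => //; exact: measurable_cst.
  split.
    split.
      by apply: (measurableT_comp m1 mt).
    by apply: (measurableT_comp m2 mt).
  exists (C * expR (e * `|ln l|)), e; split => // u.
  have C0 : 0 <= C.
    by have := le_trans (normc_ge0 _) (H 0); rewrite pmulr_lge0 ?expR_gt0.
  apply: (le_trans (H _)); rewrite -mulrA ler_wpM2l// -expRD ler_expR.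
  have := ler_normD (u - ln l) (ln l); rewrite subrK; nra.
rewrite /laplace -/g.
have -> : cint g = cint (fun u => cexp (- z * (ln l)%:C) * f (u + - ln l)).
  by congr cint; apply/funext => u; rewrite gE.
have Es : cint (fun u => f (u + - ln l)) = gammac z.
  apply: (@cint_shift R f (- ln l)); last exact: dg; last exact: gamma_dom.
    under eq_fun do rewrite /f ReM /= mulr0 subr0.
    by move=> u; apply: cvgM; [exact: cR|exact: continuous_gamma_ker].
  under eq_fun do rewrite /f ImM /= mulr0 add0r.
  by move=> u; apply: cvgM; [exact: cI|exact: continuous_gamma_ker].
by rewrite (cintZ _ dg) Es.
Qed.

End gamma_function.

Section gamma_nonvanishing.
Context {R : realType}.
Local Notation mu := (@lebesgue_measure R).
Implicit Types (x y : R) (z : R[i]).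

Definition gamma_re x : R := \int[mu]_u (expR (- x * u) * gamma_ker u).

Lemma gammac_real x : gammac x%:C = (gamma_re x)%:C.
Proof.
have E u : cexp (- x%:C * u%:C) * (gamma_ker u)%:C =
    (expR (- x * u) * gamma_ker u)%:C.
  by rewrite [RHS]rmorphM/= -rmorphN -rmorphM/= cexp_real.
have -> : gammac x%:C = cint (fun u => (expR (- x * u) * gamma_ker u)%:C).
  by congr cint; apply/funext => u; exact: E.
rewrite /cint /=; apply: complex_ext => //=.
by rewrite Rintegral_cst// mul0r.
Qed.

Lemma gamma_re_integrable x : 0 < x ->
  mu.-integrable setT (EFin \o (fun u => expR (- x * u) * gamma_ker u)).
Proof.
move=> x0; have := dominated_integrable_Re (@gamma_dom R x%:C x0).
apply: eq_integrable => // u _; congr EFin.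
by rewrite -rmorphN -rmorphM cexp_real -rmorphM.
Qed.

Lemma gamma_reS x : 0 < x -> gamma_re (x + 1) = x * gamma_re x.
Proof.
move=> x0; apply: complexI; rewrite rmorphM/= -!gammac_real.
by rewrite rmorphD rmorph1 gammacS.
Qed.

(** For u >= 0 the kernel is at least e^{-1}, and this half-line alone contributes e^{-1} / x. *)
Lemma gamma_re_gt0 x : 0 < x -> 0 < gamma_re x.
Proof.
move=> x0; pose h (u : R) : R[i] := if 0 <= u then cexp (- x%:C * u%:C) else 0.
have dh : exp_dominated h by exact: halfline_dominated.
have ih := dominated_integrable_Re dh.
have Ih : \int[mu]_u complex.Re (h u) = x^-1.
  have := @cint_halfline R x%:C x0.
  by rewrite -fmorphV => /(congr1 (@complex.Re R)).
apply: (@lt_le_trans _ _ (expR (-1) * x^-1)).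
  by rewrite mulr_gt0 ?expR_gt0 ?invr_gt0.
rewrite -Ih -RintegralZl//; apply: le_Rintegral => //.
- by have := integrableZl measurableT (expR (-1)) ih; exact: eq_integrable.
- exact: gamma_re_integrable.
move=> u _; rewrite /h; case: ifPn => u0; last first.
  by rewrite mulr0 mulr_ge0 ?expR_ge0.
rewrite -rmorphN -rmorphM cexp_real /= mulrC ler_wpM2l ?expR_ge0//.
by rewrite ler_expR lerN2 -expR0 ler_expR oppr_le0.
Qed.

(** The right-hand side is (2 sinh (x/2))^2. By parity it suffices that s <= sinh s for s >= 0,
    which follows from cosh >= 1 and the mean value theorem. *)
Lemma sqr_le_expRDexpRN x : x ^+ 2 <= expR x + expR (- x) - 2.
Proof.
wlog x0 : x / 0 <= x.
  move=> H; have [/H//|x0] := leP 0 x.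
  by have := H (- x); rewrite opprK sqrrN [_ + expR x]addrC; apply; lra.
have E : expR x + expR (- x) - 2 = (expR (x / 2) - expR (- (x / 2))) ^+ 2.
  rewrite sqrrB -!expRM_natl -expRD subrr expR0.
  have -> : 2%:R * (x / 2) = x by field.
  have -> : 2%:R * - (x / 2) = - x by field.
  by ring.
rewrite E.
have x20 : 0 <= x / 2 by lra.
have -> : x = 2 * (x / 2) by field.
move: (x / 2) x20 => s s0 {x x0 E}.
have -> : 2 * s / 2 = s by field.
rewrite lerXn2r ?nnegrE ?mulr_ge0//.
  by rewrite subr_ge0 ler_expR; lra.
rewrite -subr_ge0.
pose f (s : R) := expR s - expR (- s) - 2 * s.
rewrite -[leRHS]/(f s).
have df (t : R) : is_derive t (1 : R) f (expR t + expR (- t) - 2).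
  by apply: is_derive_eq; rewrite /GRing.scale/= /GRing.scale/=; ring.
have cf (A : set R) : {within A, continuous f}.
  apply: continuous_subspaceT => y.
  apply: differentiable_continuous; apply/derivable1_diffP.
  exact: (@ex_derive _ _ _ _ _ _ _ (df y)).
have [c _] := MVT_segment s0 (fun y _ => df y) (cf _).
have f0 : f 0 = 0 by rewrite /f oppr0 expR0 subrr mulr0 subr0.
rewrite f0 !subr0 => ->.
apply: mulr_ge0 => //.
have e0 := expR_gt0 c.
rewrite expRN; set E := expR c in e0 *.
have -> : E + E^-1 - 2 = (E - 1) ^+ 2 / E by field; rewrite gt_eqF.
by rewrite divr_ge0 ?sqr_ge0 ?ltW.
Qed.

(* At z = x + i y the real part of e^{- i y ln x} Gamma(z) is the integral of
   t^{x-1} e^{-t} cos (y ln (t / x)).  With cos v >= 1 - v^2 and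
   ln^2 s <= s + 1 / s - 2, it is at least (x - 1 - y^2) Gamma(x - 1). *)
Lemma gammac_neq0_large z : 1 < complex.Re z ->
  complex.Im z ^+ 2 < complex.Re z - 1 -> gammac z != 0.
Proof.
set x := complex.Re z; set y := complex.Im z => x1 yx.
have x0 : 0 < x by lra.
pose c := ln x.
pose w : R[i] := Complex 0 (- (y * c)).
pose P x u := expR (- x * u) * gamma_ker u.
suff : 0 < complex.Re (cexp w * gammac z).
  by apply: contraTneq => ->; rewrite mulr0 ltxx.
rewrite -cintZ; last exact: gamma_dom.
have ReI h : complex.Re (cint h) = \int[mu]_u complex.Re (h u) by [].
rewrite ReI.
set f := (X in Rintegral _ _ X).
have fE u : f u = P x u * cos (y * (u + c)).
  rewrite /f mulrA -cexpD ReM /= mulr0 subr0 !ReD !ImD !ReM !ImM !ReN !ImN /=.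
  rewrite -/x -/y !mulr0 subr0 !add0r /P.
  rewrite -[in LHS]cosN mulrAC; congr (expR _ * _ * cos _); ring.
pose g u := (1 + 2 * y ^+ 2) * P x u - y ^+ 2 / x * P (x + 1) u -
   y ^+ 2 * x * P (x - 1) u.
have gf u : g u <= f u.
  rewrite fE.
  have E1 : P (x + 1) u = P x u * expR (- u).
    by rewrite /P [RHS]mulrAC -[in RHS]expRD; congr (expR _ * _); ring.
  have E2 : P (x - 1) u = P x u * expR u.
    by rewrite /P [RHS]mulrAC -[in RHS]expRD; congr (expR _ * _); ring.
  have P0 : 0 <= P x u by rewrite mulr_ge0 ?expR_ge0.
  rewrite /g E1 E2.
  have -> : (1 + 2 * y ^+ 2) * P x u - y ^+ 2 / x * (P x u * expR (- u)) -
     y ^+ 2 * x * (P x u * expR u) =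
     P x u * (1 - y ^+ 2 * (expR (u + c) + expR (- (u + c)) - 2)).
    rewrite opprD !expRD expRN (expRN c) lnK ?posrE//; ring.
  rewrite ler_wpM2l//.
  have := normr_cos_sub1_le (y * (u + c)); rewrite ler_norml => /andP[+ _].
  rewrite real_normK ?num_real// exprMn.
  have := ler_wpM2l (sqr_ge0 y) (sqr_le_expRDexpRN (u + c)); lra.
have i1 := gamma_re_integrable x0.
have x10 : 0 < x + 1 by lra.
have x11 : 0 < x - 1 by lra.
have i2 := gamma_re_integrable x10.
have i3 := gamma_re_integrable x11.
have iZ (h : R -> R) k : mu.-integrable setT (EFin \o h) ->
    mu.-integrable setT (EFin \o (fun u => k * h u)).
  by move=> ih; have := integrableZl measurableT k ih; exact: eq_integrable.
have iB (h k : R -> R) : mu.-integrable setT (EFin \o h) ->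
    mu.-integrable setT (EFin \o k) ->
    mu.-integrable setT (EFin \o (fun u => h u - k u)).
  by move=> ih ik; have := integrableB measurableT ih ik; exact: eq_integrable.
have ig : mu.-integrable setT (EFin \o g).
  exact: (iB _ _ (iB _ _ (iZ _ _ i1) (iZ _ _ i2)) (iZ _ _ i3)).
have if_ : mu.-integrable setT (EFin \o f).
  apply: dominated_integrable_Re (exp_dominatedZ _ _).
  exact: gamma_dom.
apply: (@lt_le_trans _ _ (\int[mu]_u g u)); last exact: le_Rintegral.
rewrite /g RintegralB//; [|exact: (iB _ _ (iZ _ _ i1) (iZ _ _ i2))|exact: iZ].
rewrite RintegralB//; [|exact: iZ|exact: iZ].
rewrite !RintegralZl// -/(gamma_re x) -/(gamma_re (x + 1)) -/(gamma_re (x - 1)).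
rewrite gamma_reS//.
have := gamma_reS x11; rewrite subrK => E.
have g0 := gamma_re_gt0 x11.
rewrite E.
have -> : (1 + 2 * y ^+ 2) * ((x - 1) * gamma_re (x - 1)) -
  y ^+ 2 / x * (x * ((x - 1) * gamma_re (x - 1))) -
  y ^+ 2 * x * gamma_re (x - 1) = (x - 1 - y ^+ 2) * gamma_re (x - 1).
  by field; rewrite gt_eqF.
by rewrite mulr_gt0// subr_gt0.
Qed.

Lemma gammac_neq0 z : 0 < complex.Re z -> gammac z != 0.
Proof.
move=> z0; apply/negP => /eqP gz.
have H n : gammac (z + n%:R) = 0.
  (* A zero of Gamma would propagate to the region of gammac_neq0_large. *)
  elim: n => [|n ih]; first by rewrite addr0.
  rewrite -natr1 addrA gammacS ?ih ?mulr0//.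
  by rewrite ReD Re_nat ltr_wpDr.
pose n := (Num.truncn (complex.Im z ^+ 2 + 1)).+1.
have hn : complex.Im z ^+ 2 + 1 < n%:R by apply: truncnS_gt.
have := @gammac_neq0_large (z + n%:R).
rewrite H eqxx ReD ImD Re_nat Im_nat addr0 => F.
by apply: notF; apply: F; have := sqr_ge0 (complex.Im z); lra.
Qed.

End gamma_nonvanishing.

(** * Meromorphic continuation *)

Section derivable_closure.
Context {R : realType}.
Local Notation C := (R[i]^o).
Implicit Types (f g : C -> C) (z : C).

(** Since the scalars are [R[i]], the derivative in the single direction 1 is the complex
    derivative. *)
Definition cderivable f z := derivable f z 1.

Lemma cderivable_cst (k : C) z : cderivable (fun=> k) z.
Proof. exact: derivable_cst. Qed.

Lemma cderivable_id z : cderivable (fun w => w) z.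
Proof. exact: derivable_id. Qed.

Lemma cderivableD f g z : cderivable f z -> cderivable g z ->
  cderivable (fun w => f w + g w) z.
Proof. exact: derivableD. Qed.

Lemma cderivableM f g z : cderivable f z -> cderivable g z ->
  cderivable (fun w => f w * g w) z.
Proof. exact: derivableM. Qed.

Lemma cderivableV f z : f z != 0 -> cderivable f z ->
  cderivable (fun w => (f w)^-1) z.
Proof. exact: derivableV. Qed.

Lemma cderivable_sum n (f : 'I_n -> C -> C) z :
  (forall i, cderivable (f i) z) -> cderivable (fun w => \sum_(i < n) f i w) z.
Proof.
move=> H; rewrite (_ : (fun w => _) = \sum_(i < n) f i); last first.
  by apply/funext => w; rewrite fct_sumE.
exact: derivable_sum.
Qed.

Lemma cderivable_prod (I : Type) (s : seq I) (P : pred I) (f : I -> C -> C) z :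
  (forall i, cderivable (f i) z) ->
  cderivable (fun w => \prod_(i <- s | P i) f i w) z.
Proof.
move=> H; elim: s => [|i s ih].
  by under eq_fun do rewrite big_nil; exact: cderivable_cst.
have [Pi|Pi] := boolP (P i).
  have -> : (fun w => \prod_(j <- i :: s | P j) f j w) =
      (fun w => f i w * \prod_(j <- s | P j) f j w).
    by apply/funext => w; rewrite big_cons Pi.
  exact: (cderivableM (H i) ih).
have -> : (fun w => \prod_(j <- i :: s | P j) f j w) =
    (fun w => \prod_(j <- s | P j) f j w); last exact: ih.
by apply/funext => w; rewrite big_cons (negbTE Pi).
Qed.

Lemma cderivable_shift f (k z : C) : cderivable f (z + k) ->
  cderivable (fun w => f (w + k)) z.
Proof.
rewrite /cderivable /derivable => H.
have -> : (fun w => f (w + k)) \o shift z = f \o shift (z + k) by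
  apply/funext => w; rewrite /= addrA.
exact: H.
Qed.

Lemma cderivable_continuous f z : cderivable f z -> {for z, continuous f}.
Proof. by move=> H; apply/differentiable_continuous/derivable1_diffP. Qed.

Lemma nbhs_normc (z : C) (P : set C) (e : R) : 0 < e ->
  (forall w : C, normc (w - z) < e -> P w) -> \forall w \near z, P w.
Proof.
move=> e0 H; exists e%:C; first by rewrite /= ltcR.
by move=> w /=; rewrite normC_normc ltcR normc_distC => /H.
Qed.

Lemma near_eq_cderivable f g z : (\forall w \near z, f w = g w) ->
  cderivable f z -> cderivable g z.
Proof. by apply: near_eq_derivable; rewrite oner_neq0. Qed.

Lemma continuous_dnbhs_eq0 f z : {for z, continuous f} ->
  (\forall w \near z^', f w = 0) -> f z = 0.
Proof.
move=> cf H; apply: (@cvg_unique _ (@norm_hausdorff _ R[i]^o) (f x @[x --> z^'])).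
  exact/continuous_withinNx.
exact: cvg_near_cst.
Qed.

End derivable_closure.

(* Here tu is a function of u = - ln t. *)
Section mellin_continuation.
Context {R : realType}.
Local Notation C := (R[i]).
Variables (p : nat) (tu : R -> C) (zeta : C -> C) (a : nat -> C).
Hypothesis mtu : measurable_C tu.
Hypothesis growth : forall q : R, p%:R < q -> exists K : R, forall u,
  normc (tu u) <= K * expR (q * u).
Hypothesis mellin : forall z, p%:R < complex.Re z ->
  laplace tu z = gammac z * zeta z.

Definition expansion n (u : R) : C :=
  \sum_(r < n) a r * (expR ((p%:R - r%:R) * u))%:C.

Hypothesis expand : forall n, exists e M : R, [/\ 0 <= e, 0 <= M &
  forall u, e < u -> normc (tu u - expansion n.+1 u) <=
    M * expR ((p%:R - n.+1%:R) * u)].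

Definition remainder n (u : R) : C := tu u - (if 0 <= u then expansion n u else 0).

Lemma measurable_expansion n : measurable_C (expansion n).
Proof.
elim: n => [|n ih].
  by rewrite /expansion; under eq_fun do rewrite big_ord0; exact: measurable_C_cst.
rewrite /expansion; under eq_fun do rewrite big_ord_recr.
apply: measurable_CD => //; apply: measurable_CM; first exact: measurable_C_cst.
apply: measurable_C_real; apply: continuous_measurable_fun.
exact: expR_lin_continuous.
Qed.

Lemma measurable_remainder n : measurable_C (remainder n).
Proof.
rewrite /remainder; under eq_fun do rewrite -[X in _ - X]mul1r -mulNr.
apply: measurable_CD => //; apply: measurable_CM; first exact: measurable_C_cst.
by apply: measurable_C_if; exact: measurable_expansion.
Qed.

Lemma normc_expansion n u : normc (expansion n u) <=
  (\sum_(r < n) normc (a r)) * expR (p%:R * `|u| + n%:R * `|u|).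
Proof.
rewrite mulr_suml (le_trans (normc_sum _ _ _))// ler_sum// => r _.
rewrite Normc.normcM normc_real ger0_norm ?expR_ge0// ler_wpM2l ?normc_ge0//.
rewrite ler_expR -mulrDl (le_trans (ler_norm _))// normrM ler_wpM2r//.
rewrite (le_trans (ler_normB _ _))// !ger0_norm// lerD2l ler_nat ltnW//.
Qed.

(** Beyond e the expansion gives decay at the rate Re z - (p - n - 1); on [0, e] boundedness is
    enough; for u < 0 nothing has been subtracted and [growth] applies. *)
Lemma remainder_dom n z : p%:R - n.+1%:R < complex.Re z ->
  laplace_dom (remainder n.+1) z.
Proof.
move=> nz; set x := complex.Re z in nz.
have [e [M [e0 M0 H]]] := expand n.
(* q exceeds p, as [growth] requires, and exceeds Re z, so that e^{(q - Re z) u} decays as u tends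
   to -oo. *)
pose q := Num.max p%:R x + 1.
have pq : p%:R < q by rewrite /q (@le_lt_trans _ _ (Num.max p%:R x)) ?ltrDl// le_max lexx.
have qx : 0 < q - x.
  by rewrite subr_gt0 /q (@le_lt_trans _ _ (Num.max p%:R x)) ?ltrDl// le_max lexx orbT.
have [K HK] := growth pq.
(* A bounds the remainder on [0, e]. *)
pose A := (\sum_(r < n.+1) normc (a r)) * expR (p%:R * e + n.+1%:R * e) + `|K| * expR (q * e).
pose d := x - (p%:R - n.+1%:R).
have d0 : 0 < d by rewrite subr_gt0.
have q0 : 0 < q by rewrite /q ltr_wpDl// le_max ler0n.
apply: (@exp_dominated_sides _ _ (M + A * expR (`|x| * e) * expR (d * e)) d `|K| (q - x)) => //.
- by apply: measurable_CM; [exact: measurable_C_cexp|exact: measurable_remainder].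
- move=> u u0; rewrite Normc.normcM normc_cexp_lin ReN -/x /remainder u0.
  have [eu|ue] := ltP e u.
    apply: (@le_trans _ _ (expR (- x * u) * (M * expR ((p%:R - n.+1%:R) * u)))).
      by rewrite ler_wpM2l ?expR_ge0// H.
    rewrite mulrCA -expRD -mulrDl -/d.
    have -> : - x + (p%:R - n.+1%:R) = - d by rewrite /d; ring.
    rewrite mulNr ler_wpM2r ?expR_ge0// lerDl !mulr_ge0 ?expR_ge0// /A.
    by rewrite addr_ge0// mulr_ge0 ?expR_ge0// sumr_ge0// => i _; exact: normc_ge0.
  have hA : normc (tu u - expansion n.+1 u) <= A.
    rewrite (le_trans (normcB _ _))// addrC lerD//.
      rewrite (le_trans (normc_expansion _ _))// ler_wpM2l//.
        by rewrite sumr_ge0// => i _; exact: normc_ge0.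
      by rewrite ler_expR ger0_norm// lerD// ler_wpM2l.
    rewrite (le_trans (HK u))// ler_pM ?expR_ge0//.
    - by have := le_trans (normc_ge0 _) (HK u); rewrite pmulr_lge0 ?expR_gt0.
    - exact: ler_norm.
    - by rewrite ler_expR ler_wpM2l// ltW.
  have A0 := le_trans (normc_ge0 _) hA.
  have h1 : expR (- x * u) <= expR (`|x| * e).
    rewrite ler_expR (le_trans (ler_norm _))// normrM normrN (ger0_norm u0).
    by rewrite ler_wpM2l.
  have h2 : 1 <= expR (d * e) * expR (- (d * u)).
    by rewrite -expRD -expR0 ler_expR -mulrBr mulr_ge0 ?subr_ge0// ltW.
  apply: (@le_trans _ _ (expR (`|x| * e) * A)).
    by rewrite ler_pM ?expR_ge0 ?normc_ge0.
  rewrite mulrDl -[leLHS]add0r lerD ?mulr_ge0 ?expR_ge0//.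
  rewrite -[leRHS]mulrA [A * _]mulrC -[leLHS]mulr1 ler_wpM2l ?mulr_ge0 ?expR_ge0//.
- move=> u u0.
  have -> : remainder n.+1 u = tu u.
    by rewrite /remainder ifF ?subr0//; apply/negbTE; rewrite -ltNge.
  rewrite Normc.normcM normc_cexp_lin ReN -/x.
  apply: (@le_trans _ _ (expR (- x * u) * (`|K| * expR (q * u)))).
    rewrite ler_wpM2l ?expR_ge0// (le_trans (HK u))// ler_wpM2r ?expR_ge0//.
    exact: ler_norm.
  by rewrite mulrCA -expRD -mulrDl [- x + q]addrC.
Qed.

Definition halfterm n (u : R) : C := if 0 <= u then (expR ((p%:R - n%:R) * u))%:C else 0.

Lemma halftermE n z u : cexp (- z * u%:C) * halfterm n u =
  if 0 <= u then cexp (- (z - p%:R + n%:R) * u%:C) else 0.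
Proof.
rewrite /halfterm; case: ifP => _; last by rewrite mulr0.
rewrite -cexp_real -cexpD; congr cexp.
by rewrite rmorphM rmorphB/= !(rmorph_nat (real_complex R)); ring.
Qed.

Lemma Re_shift n (z : C) : complex.Re (z - p%:R + n%:R) = complex.Re z - (p%:R - n%:R).
Proof. by rewrite !ReD ReN !Re_nat; ring. Qed.

Lemma halfterm_dom n z : p%:R - n%:R < complex.Re z -> laplace_dom (halfterm n) z.
Proof.
move=> nz; rewrite /laplace_dom; under eq_fun do rewrite halftermE.
by apply: halfline_dominated; rewrite Re_shift subr_gt0.
Qed.

Lemma laplace_halfterm n z : p%:R - n%:R < complex.Re z ->
  laplace (halfterm n) z = (z - p%:R + n%:R)^-1.
Proof.
move=> nz; rewrite /laplace; under eq_fun do rewrite halftermE.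
by apply: cint_halfline; rewrite Re_shift subr_gt0.
Qed.

(** One more subtracted term differs by an exponential on u >= 0, whose transform is the explicit
    fraction; the transform on the right converges on a half-plane wider by 1. *)
Lemma remainder_step n z : p%:R - n%:R < complex.Re z ->
  laplace (remainder n) z =
  laplace (remainder n.+1) z + a n * (z - p%:R + n%:R)^-1.
Proof.
move=> nz; have nz' : p%:R - n.+1%:R < complex.Re z.
  by rewrite (lt_trans _ nz)// ltrD2l ltrN2 ltr_nat.
have hd := halfterm_dom nz; have rd := remainder_dom nz'.
rewrite -laplace_halfterm// -laplaceZ// -laplaceD//; last exact: laplace_domZ.
congr (laplace _ z); apply/funext => u; rewrite /remainder /halfterm.
case: ifP => _; last by rewrite mulr0 addr0.
by rewrite /expansion big_ord_recr/= opprD addrA subrK.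
Qed.

Lemma laplace_expand n z : p%:R < complex.Re z ->
  laplace tu z = \sum_(r < n) a r * (z - p%:R + r%:R)^-1 + laplace (remainder n) z.
Proof.
move=> pz; elim: n => [|n ih].
  rewrite big_ord0 add0r; congr (laplace _ z); apply/funext => u.
  by rewrite /remainder /expansion big_ord0 if_same subr0.
rewrite ih big_ord_recr /= remainder_step ?addrA; first by rewrite addrAC.
by rewrite (le_lt_trans _ pz)// lerBlDr lerDl.
Qed.

Definition Pprod N (z : C) : C := \prod_(i < N) (z + i%:R).

(* Pprod N z / (z - (p - r)): when r >= p the pole is one of the factors of
   Pprod N. *)
Definition Qprod N r (z : C) : C :=
  if (r < p)%N then Pprod N z * (z - (p - r)%:R)^-1
  else \prod_(i < N | (i : nat) != (r - p)%N) (z + i%:R).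

(** For Re z > p this is [Pprod N z * laplace tu z], by [laplace_expand]. In this form it contains
    no quotient that vanishes at a non-positive integer of the half-plane Re z > - N. *)
Definition Fnum N (z : C) : C :=
  \sum_(r < p + N) a r * Qprod N r z + Pprod N z * laplace (remainder (p + N)) z.

(* Gamma(z + N) = Pprod N z * Gamma(z). *)
Definition Fcont N (z : C) : C := Fnum N z * (gammac (z + N%:R))^-1.

Lemma PprodS N z : Pprod N.+1 z = Pprod N z * (z + N%:R).
Proof. by rewrite /Pprod big_ord_recr. Qed.

Lemma QprodS N r z : (r < p + N)%N -> Qprod N.+1 r z = Qprod N r z * (z + N%:R).
Proof.
move=> rN; rewrite /Qprod; case: ltnP => rp; first by rewrite PprodS mulrAC.
rewrite big_mkcond big_ord_recr/= -big_mkcond/= ifT//.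
by rewrite neq_ltn ltn_subLR// rN orbT.
Qed.

Lemma Qprod_last N z : Qprod N.+1 (p + N) z = Pprod N z.
Proof.
rewrite /Qprod ltnNge leq_addr/= addKn big_mkcond big_ord_recr/= eqxx mulr1.
by apply: eq_bigr => i _; rewrite neq_ltn ltn_ord.
Qed.

Lemma Re_gt_addn_neq0 N (z : C) : - N%:R < complex.Re z -> z + N%:R != 0.
Proof.
move=> zN; apply/eqP => /(congr1 (@complex.Re R)).
by rewrite ReD Re_nat /=; lra.
Qed.

(** Passing from N to N + 1 multiplies both the numerator and Gamma(z + N) by z + N, which is
    non-zero on this half-plane. *)
Lemma FcontS N (z : C) : - N%:R < complex.Re z -> Fcont N.+1 z = Fcont N z.
Proof.
move=> zN; have z0 := Re_gt_addn_neq0 zN.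
have zN0 : 0 < complex.Re (z + N%:R) by rewrite ReD Re_nat; lra.
have g0 := gammac_neq0 zN0.
have pN : p%:R - (p + N)%:R < complex.Re z by rewrite natrD; lra.
have E : Fnum N.+1 z = (z + N%:R) * Fnum N z.
  rewrite /Fnum addnS big_ord_recr /= Qprod_last PprodS.
  rewrite (remainder_step pN).
  have -> : z - p%:R + (p + N)%:R = z + N%:R by rewrite natrD; ring.
  under eq_bigr => r _ do rewrite QprodS// mulrA.
  rewrite -mulr_suml; field.
  exact: z0.
rewrite /Fcont E -natr1 addrA gammacS// invfM.
by rewrite mulrACA divff// mul1r.
Qed.

Lemma Fcont_le N M z : (N <= M)%N -> - N%:R < complex.Re z -> Fcont M z = Fcont N z.
Proof.
move=> + zN; elim: M => [|M ih]; first by rewrite leqn0 => /eqP ->.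
rewrite leq_eqVlt => /predU1P[->//|NM]; rewrite FcontS ?ih//.
by rewrite (le_lt_trans _ zN)// lerN2 ler_nat.
Qed.

Lemma Fcont_zeta N z : p%:R < complex.Re z -> Fcont N z = zeta z.
Proof.
move=> pz; have z0 : 0 < complex.Re z by rewrite (le_lt_trans _ pz).
rewrite (@Fcont_le 0 N)// ?oppr0// /Fcont /Fnum addr0 addn0.
have P0 : Pprod 0 z = 1 by rewrite /Pprod big_ord0.
rewrite P0 mul1r.
have -> : \sum_(r < p) a r * Qprod 0 r z = \sum_(r < p) a r * (z - p%:R + r%:R)^-1.
  apply: eq_bigr => r _; rewrite /Qprod ltn_ord P0 mul1r natrB 1?ltnW//.
  by rewrite opprB addrA [_ + r%:R - _]addrAC.
by rewrite -laplace_expand// mellin// mulrAC divff ?gammac_neq0// mul1r.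
Qed.

Definition Nbound (z : C) : nat := (Num.truncn `|complex.Re z|).+1.

Lemma NboundP z : - (Nbound z)%:R < complex.Re z.
Proof.
have := truncnS_gt `|complex.Re z|; rewrite -/(Nbound z) => H.
by have := ler_norm (- complex.Re z); rewrite normrN; lra.
Qed.

(** N varies with z, but around each point one fixed N serves, by [zeta_cont_near]; local questions
    thus reduce to a single [Fcont N]. *)
Definition zeta_cont (z : C) : C := Fcont (Nbound z) z.

Lemma zeta_contE N z : - N%:R < complex.Re z -> zeta_cont z = Fcont N z.
Proof.
move=> zN; rewrite /zeta_cont; have [NM|MN] := leqP N (Nbound z).
  exact: Fcont_le.
by rewrite [RHS](@Fcont_le (Nbound z))//; [exact: ltnW|exact: NboundP].
Qed.

Lemma zeta_cont_near N z : - N%:R < complex.Re z ->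
  \forall w \near (z : R[i]^o), zeta_cont w = Fcont N w.
Proof.
move=> zN; apply: (@nbhs_normc R z _ (complex.Re z + N%:R)); first lra.
move=> w wz; apply: zeta_contE.
have := le_lt_trans (ler_normc_Re _) wz.
by rewrite ReD ReN ltr_norml => /andP[]; lra.
Qed.

Lemma cderivable_Pprod N (z : R[i]^o) : cderivable (Pprod N : R[i]^o -> R[i]^o) z.
Proof.
apply: cderivable_prod => i; apply: cderivableD; first exact: cderivable_id.
exact: cderivable_cst.
Qed.

Lemma cderivable_Qprod N r (z : R[i]^o) : ((r < p)%N -> z != (p - r)%:R) ->
  cderivable (Qprod N r : R[i]^o -> R[i]^o) z.
Proof.
rewrite /Qprod; case: ltnP => rp H.
  apply: cderivableM; first exact: cderivable_Pprod.
  apply: cderivableV; first by rewrite subr_eq0 H.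
  by apply: cderivableD; [exact: cderivable_id|exact: cderivable_cst].
apply: cderivable_prod => i; apply: cderivableD; first exact: cderivable_id.
exact: cderivable_cst.
Qed.

Lemma cderivable_invgamma N (z : R[i]^o) : - N%:R < complex.Re z ->
  cderivable ((fun w => (gammac (w + N%:R))^-1) : R[i]^o -> R[i]^o) z.
Proof.
move=> zN; have zN0 : 0 < complex.Re (z + N%:R) by rewrite ReD Re_nat; lra.
apply: cderivableV; first exact: gammac_neq0.
by apply: cderivable_shift; exact: gammac_derivable.
Qed.

Definition Fterm N r (z : C) : C := a r * Qprod N r z.

Lemma cderivable_Fterm N r (z : R[i]^o) :
  ((r < p)%N -> a r != 0 -> z != (p - r)%:R) ->
  cderivable (Fterm N r : R[i]^o -> R[i]^o) z.
Proof.
rewrite /Fterm; have [a0|a0] := eqVneq (a r) 0 => H.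
  by under eq_fun do rewrite a0 mul0r; exact: cderivable_cst.
apply: cderivableM; first exact: cderivable_cst.
by apply: cderivable_Qprod => rp; exact: H.
Qed.

Lemma cderivable_tail N (z : R[i]^o) : (0 < N)%N -> - N%:R < complex.Re z ->
  cderivable ((fun w => Pprod N w * laplace (remainder (p + N)) w)
    : R[i]^o -> R[i]^o) z.
Proof.
move=> N0 zN; apply: cderivableM; first exact: cderivable_Pprod.
apply: laplace_derivable; first exact: measurable_remainder.
case: N N0 zN => // N _ zN; rewrite addnS; apply: remainder_dom.
by rewrite -addnS natrD; lra.
Qed.

(** A point p - r with a_r = 0 counts as regular: [meromorphic] asks for holomorphy at every point
    that is not a genuine pole. *)
Definition regular_point (z : C) :=
  forall r, (r < p)%N -> a r != 0 -> z != (p - r)%:R.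

Lemma cderivable_zeta_cont (z : R[i]^o) : regular_point z ->
  cderivable (zeta_cont : R[i]^o -> R[i]^o) z.
Proof.
move=> H; have zN := NboundP z.
apply: (@near_eq_cderivable R (Fcont (Nbound z))).
  by apply: filterS (zeta_cont_near zN) => w ->.
apply: cderivableM; last exact: cderivable_invgamma.
apply: cderivableD; last exact: cderivable_tail.
by apply: cderivable_sum => r; apply: cderivable_Fterm => rp; exact: H.
Qed.

Lemma regular_point_near (z : R[i]^o) : regular_point z ->
  \forall w \near z, regular_point w.
Proof.
move=> H.
have K n : (n <= p)%N -> exists2 e : R, 0 < e & forall w : C, normc (w - z) < e ->
    forall r, (r < n)%N -> a r != 0 -> w != (p - r)%:R.
  elim: n => [|n ih] np; first by exists 1.
  have [e e0 He] := ih (ltnW np).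
  have [an|an] := eqVneq (a n) 0.
    exists e => // w we r; rewrite ltnS leq_eqVlt => /predU1P[->|rn].
      by rewrite an eqxx.
    exact: He.
  have zn := H n np an.
  exists (Num.min e (normc (z - (p - n)%:R))).
    by rewrite lt_min e0 normc_gt0 subr_eq0.
  move=> w; rewrite lt_min => /andP[we wz] r.
  rewrite ltnS leq_eqVlt => /predU1P[->|rn]; last exact: He.
  by move=> _; apply: contraTneq wz => ->; rewrite normc_distC ltxx.
have [e e0 He] := K p (leqnn p).
by apply: (nbhs_normc e0) => w we r rp; exact: He.
Qed.

Lemma holomorphic_zeta_cont (z : R[i]^o) : regular_point z ->
  holomorphic_at (zeta_cont : R[i]^o -> R[i]^o) z.
Proof.
move=> /regular_point_near; apply: filterS => w; exact: cderivable_zeta_cont.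
Qed.

(** The singularity sits in the single summand r of [Fcont 1]; N = 1 suffices because k = p - r >=
    1. The residue A(k) = a_r k / Gamma(k + 1), that is a_r / Gamma(k), is non-zero. *)
Lemma singular_point r : (r < p)%N -> a r != 0 ->
  exists A B : R[i]^o -> R[i]^o, [/\ holomorphic_at A (p - r)%:R,
   holomorphic_at B (p - r)%:R, A (p - r)%:R != 0 &
   \forall w \near ((p - r)%:R : R[i]^o),
     zeta_cont w = A w * (w - (p - r)%:R)^-1 + B w].
Proof.
move=> rp ar; pose k : R[i]^o := (p - r)%:R.
have k1 : 1 <= complex.Re k by rewrite Re_nat ler1n subn_gt0.
have kN : - (1%N)%:R < complex.Re k by lra.
pose A (w : R[i]^o) : R[i]^o := a r * Pprod 1 w * (gammac (w + 1%N%:R))^-1.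
pose B (w : R[i]^o) : R[i]^o :=
  (\sum_(s < p + 1) (if (s : nat) == r then 0 else Fterm 1 s w) +
   Pprod 1 w * laplace (remainder (p + 1)) w) * (gammac (w + 1%N%:R))^-1.
(* Radius 1 works: the other candidate poles are integers at distance at least 1 from k. *)
have near1 : \forall w \near k, - (1%N)%:R < complex.Re w /\
    forall s : nat, (s < p)%N -> s != r -> w != (p - s)%:R.
  apply: (@nbhs_normc R k _ 1) => // w wk; split.
    have := le_lt_trans (ler_normc_Re _) wk.
    by rewrite ReD ReN ltr_norml => /andP[]; lra.
  move=> s sp; apply: contraNneq => wE; move: wk; rewrite wE /k.
  wlog : r s rp sp {ar k k1 kN A B wE} / (s <= r)%N => [W|sr].
    have [/W|/ltnW/W] := leqP s r; first exact.
    by rewrite normc_distC eq_sym; exact.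
  rewrite -natrB ?leq_sub2l// -(rmorph_nat (real_complex R)) normc_real.
  rewrite ger0_norm// ltrn1 => H.
  rewrite eqn_leq sr/= leqNgt; apply/negP => /(ltn_sub2l sp).
  by rewrite ltnNge; move: H; rewrite ltnS leqn0 subn_eq0 => ->.
exists A, B; split.
- apply: filterS near1 => w [wN _]; rewrite /A.
  apply: cderivableM; last exact: cderivable_invgamma.
  by apply: cderivableM; [exact: cderivable_cst|exact: cderivable_Pprod].
- apply: filterS near1 => w [wN H]; rewrite /B.
  apply: cderivableM; last exact: cderivable_invgamma.
  apply: cderivableD; last exact: cderivable_tail.
  apply: cderivable_sum => s.
  have [sr|sr] := eqVneq (s : nat) r; first exact: cderivable_cst.
  by apply: cderivable_Fterm => sp _; exact: H.
- rewrite /A !mulf_neq0// /Pprod ?big_ord1 ?addr0.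
    rewrite -/k; apply/eqP => /(congr1 (@complex.Re R)) /=; lra.
  have k2 : 0 < complex.Re (k + 1%N%:R) by rewrite ReD (Re_nat 1); lra.
  by rewrite invr_eq0; apply: gammac_neq0; exact: k2.
apply: filterS near1 => w [wN _].
rewrite (zeta_contE wN) /Fcont /Fnum /A /B.
have rp1 : (r < p + 1)%N by rewrite addn1 ltnS ltnW.
rewrite (bigD1 (Ordinal rp1))//= [in RHS](bigD1 (Ordinal rp1))//= eqxx add0r.
have -> : \sum_(i < p + 1 | i != Ordinal rp1)
    (if (i : nat) == r then 0 else Fterm 1 i w) =
    \sum_(i < p + 1 | i != Ordinal rp1) a i * Qprod 1 i w.
  by apply: eq_bigr => i ir; rewrite ifF//; apply: contra_neqF ir => /eqP ir; exact: val_inj.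
rewrite {1}/Qprod rp.
ring.
Qed.

Lemma zeta_cont_simple_pole r : (r < p)%N -> a r != 0 ->
  simple_pole (zeta_cont : R[i]^o -> R[i]^o) (p - r)%:R.
Proof.
move=> rp ar; have [A [B [hA hB A0 near1]]] := singular_point rp ar.
set k : R[i]^o := (p - r)%:R in hA hB A0 near1 *.
have rem1 : removable (fun w : R[i]^o => (w - k) * zeta_cont w) k.
  exists (fun w => A w + (w - k) * B w).
    rewrite /holomorphic_at in hA hB *; apply: filterS2 hA hB => w dA dB.
    apply: (cderivableD dA); apply: cderivableM (dB).
    by apply: cderivableD; [exact: cderivable_id|exact: cderivable_cst].
  near=> w.
  have wk : w - k != 0 by rewrite subr_eq0; near: w; exact: nbhs_dnbhs_neq.
  have -> : zeta_cont w = A w * (w - k)^-1 + B w.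
    by near: w; apply: nbhs_dnbhs.
  by field.
split => //; split; last by exists 1%N; under eq_fun do rewrite expr1.
move=> [g hg gE].
(* If g removed the singularity, h would vanish on a punctured neighbourhood of k, hence at k by
   continuity; but h(k) = - A(k). *)
pose h (w : R[i]^o) : R[i]^o := (w - k) * g w + -1 * (A w + (w - k) * B w).
have h0 : h k = 0.
  apply: continuous_dnbhs_eq0.
    apply: cderivable_continuous.
    have dk : cderivable (fun w : R[i]^o => w - k) k.
      by apply: cderivableD; [exact: cderivable_id|exact: cderivable_cst].
    have dg : cderivable g k := nbhs_singleton hg.
    have dA : cderivable A k := nbhs_singleton hA.
    have dB : cderivable B k := nbhs_singleton hB.
    apply: (cderivableD (cderivableM dk dg)).
    have dC := cderivableD dA (cderivableM dk dB).
    exact: (cderivableM (@cderivable_cst R (-1) k) dC).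
  near=> w.
  have wk : w - k != 0 by rewrite subr_eq0; near: w; exact: nbhs_dnbhs_neq.
  rewrite /h; have <- : zeta_cont w = g w by near: w.
  have -> : zeta_cont w = A w * (w - k)^-1 + B w.
    by near: w; apply: nbhs_dnbhs.
  by field.
move/eqP: h0; rewrite /h subrr !mul0r add0r addr0 mulN1r oppr_eq0.
by apply/negP.
Unshelve. all: by end_near. Qed.

Lemma zeta_cont_removable (z : R[i]^o) : regular_point z ->
  removable (zeta_cont : R[i]^o -> R[i]^o) z.
Proof.
move=> H; exists (zeta_cont : R[i]^o -> R[i]^o); first exact: holomorphic_zeta_cont.
exact: nearW.
Qed.

Theorem mellin_continuation : exists f : R[i]^o -> R[i]^o,
  [/\ meromorphic f,
      forall z : R[i], p%:R < complex.Re z -> f z = zeta z,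
      pole f `<=` [set k%:R | k in [set k : nat | (1 <= k <= p)%N]] &
      forall z, pole f z -> simple_pole f z].
Proof.
have D z : regular_point z \/ exists r, [/\ (r < p)%N, a r != 0 & z = (p - r)%:R].
  have [H|H] := pselect (regular_point z); [by left|right].
  apply: contrapT => K; apply: H => r rp ar; apply/eqP => zE; apply: K.
  by exists r.
exists zeta_cont; split.
- move=> z; have [H|[r [rp ar ->]]] := D z; first by left; exact: holomorphic_zeta_cont.
  by right; have [] := zeta_cont_simple_pole rp ar.
- by move=> z pz; exact: Fcont_zeta.
- move=> z [nr _]; have [/zeta_cont_removable//|[r [rp ar ->]]] := D z.
  by exists (p - r)%N => //=; rewrite subn_gt0 rp leq_subr.
- move=> z [nr ?]; have [/zeta_cont_removable//|[r [rp ar ->]]] := D z.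
  exact: zeta_cont_simple_pole.
Qed.

End mellin_continuation.

Section mellin_transform_of_dirichlet_series.
Context {R : realType}.
Local Notation C := (R[i]).

(** The rate q1 < Re z controls u -> +oo, and the rate q2 > Re z controls u -> -oo. *)
Lemma laplace_dom_growth (tu : R -> C) (z : C) (q1 q2 K1 K2 : R) :
  measurable_C tu -> q1 < complex.Re z < q2 ->
  (forall u, normc (tu u) <= K1 * expR (q1 * u)) ->
  (forall u, normc (tu u) <= K2 * expR (q2 * u)) -> laplace_dom tu z.
Proof.
move=> mt /andP[zq1 zq2] H1 H2.
have E q K u : normc (tu u) <= K * expR (q * u) ->
    normc (cexp (- z * u%:C) * tu u) <= K * expR ((q - complex.Re z) * u).
  move=> H; rewrite Normc.normcM normc_cexp_lin ReN.
  rewrite (le_trans (ler_wpM2l (expR_ge0 _) H))// mulrCA -expRD -mulrDl.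
  by rewrite [- _ + q]addrC.
apply: (@exp_dominated_sides _ _ K1 (complex.Re z - q1) K2 (q2 - complex.Re z)).
- by apply: measurable_CM => //; exact: measurable_C_cexp.
- by rewrite subr_gt0.
- by rewrite subr_gt0.
- by move=> u _; rewrite -mulNr opprB; exact: E.
- by move=> u _; exact: E.
Qed.

Lemma exp_dominated_sum (I : Type) (s : seq I) (f : I -> R -> C) :
  (forall i, exp_dominated (f i)) -> exp_dominated (fun u => \sum_(i <- s) f i u).
Proof.
move=> H; elim: s => [|i s ih].
  under eq_fun do rewrite big_nil; split; first exact: measurable_C_cst.
  by exists 0, 1; split => // u; rewrite mul0r Normc.normc0.
by under eq_fun do rewrite big_cons; exact: exp_dominatedD.
Qed.

Lemma cint_sum (I : Type) (s : seq I) (f : I -> R -> C) :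
  (forall i, exp_dominated (f i)) ->
  cint (fun u => \sum_(i <- s) f i u) = \sum_(i <- s) cint (f i).
Proof.
move=> H; elim: s => [|i s ih].
  under eq_fun do rewrite big_nil; rewrite big_nil; apply/eqP.
  rewrite -normc_eq0 eq_le normc_ge0 andbT -(mul0r (exp_mass (1 : R))).
  apply: (@cint_le _ _ 0 1) => //; last by move=> u; rewrite mul0r Normc.normc0.
under eq_fun do rewrite big_cons; rewrite cintD ?big_cons ?ih//.
exact: exp_dominated_sum.
Qed.

Lemma laplace_dirichlet (I : Type) (s : seq I) (c : I -> C) (l : I -> R) (z : C) :
  0 < complex.Re z -> (forall i, 0 < l i) ->
  let f u := \sum_(i <- s) c i * (expR (- (l i * expR (- u))))%:C in
  laplace_dom f z /\
  laplace f z = (\sum_(i <- s) c i * cexp (- z * (ln (l i))%:C)) * gammac z.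
Proof.
move=> z0 l0 f.
pose g i u := c i * (cexp (- z * u%:C) * (expR (- (l i * expR (- u))))%:C).
have dl i : laplace_dom (fun u => (expR (- (l i * expR (- u))))%:C) z.
  have m : measurable_C (fun u => (expR (- (l i * expR (- u))))%:C).
    apply: measurable_C_real; apply: continuous_measurable_fun => u.
    apply: continuous_comp; last exact: continuous_expR.
    apply: cvgN; apply: cvgM; first exact: cvg_cst.
    apply: continuous_comp; last exact: continuous_expR.
    by apply: cvgN; exact: cvg_id.
  apply: (@laplace_dom_growth _ z 0 (complex.Re z + 1) 1
    (expR ((complex.Re z + 1) * (ln (complex.Re z + 1) - 1)) *
     expR (- ((complex.Re z + 1) * ln (l i)))) m).
  - by rewrite z0 ltrDl ltr01.
  - move=> u; rewrite normc_real ger0_norm ?expR_ge0// mul0r expR0 mulr1.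
    by rewrite -expR0 ler_expR oppr_le0 mulr_ge0 ?expR_ge0// ltW.
  - move=> u; rewrite normc_real ger0_norm ?expR_ge0//.
    have x1 : 0 < complex.Re z + 1 by lra.
    apply: (le_trans (expRN_le_pow x1 _)); first by rewrite mulr_gt0 ?expR_gt0.
    rewrite -mulrA ler_wpM2l ?expR_ge0// -expRD ler_expR lnM ?posrE ?expR_gt0//.
    by rewrite expRK le_eqVlt; apply/orP; left; apply/eqP; ring.
have dg i : exp_dominated (g i) by exact: exp_dominatedZ (dl i).
have E : (fun u => cexp (- z * u%:C) * f u) = (fun u => \sum_(i <- s) g i u).
  apply/funext => u; rewrite /f mulr_sumr; apply: eq_bigr => i _.
  by rewrite mulrCA.
split; first by rewrite /laplace_dom E; exact: exp_dominated_sum.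
rewrite /laplace E cint_sum// mulr_suml; apply: eq_bigr => i _.
rewrite -mulrA -gammac_scale//.
exact: (cintZ (c i) (dl i)).
Qed.

(** This replaces integrating a series term by term: the identity is exact for finite sums, and an
    approximation in both weights moves the transform by at most e * [exp_mass d], where d is the
    distance from Re z to the nearer rate. *)
Lemma laplace_dirichlet_series (tu : R -> C) (z zv : C) (q1 q2 : R) :
  measurable_C tu -> 0 < complex.Re z -> q1 < complex.Re z < q2 ->
  laplace_dom tu z ->
  (forall e : R, 0 < e -> exists (I : Type) (s : seq I) (c : I -> C) (l : I -> R),
    let f u := \sum_(i <- s) c i * (expR (- (l i * expR (- u))))%:C in
    [/\ forall i, 0 < l i, forall u, normc (tu u - f u) <= e * expR (q1 * u),
     forall u, normc (tu u - f u) <= e * expR (q2 * u) &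
     normc (zv - \sum_(i <- s) c i * cexp (- z * (ln (l i))%:C)) <= e]) ->
  laplace tu z = gammac z * zv.
Proof.
move=> mt z0 /andP[zq1 zq2] dt H.
pose d := Num.min (complex.Re z - q1) (q2 - complex.Re z).
have d0 : 0 < d by rewrite lt_min !subr_gt0 zq1.
pose B := exp_mass d + normc (gammac z).
have B0 : 0 <= B by rewrite addr_ge0 ?exp_mass_ge0 ?normc_ge0.
suff K e : 0 < e -> normc (laplace tu z - gammac z * zv) <= e * B.
  apply/eqP; rewrite -subr_eq0 -normc_eq0 eq_le normc_ge0 andbT.
  apply/ler_addgt0Pl => e e0; rewrite addr0.
  apply: (le_trans (K (e / (B + 1)) _)); first by rewrite divr_gt0// ltr_wpDl.
  rewrite mulrAC ler_pdivrMr ?ltr_wpDl// ler_wpM2l ?ltW//; lra.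
move=> e0; have [I [s [c [l [l0 H1 H2 H3]]]]] := H e e0.
pose f u := \sum_(i <- s) c i * (expR (- (l i * expR (- u))))%:C.
have [df Lf] := laplace_dirichlet s c z0 l0; rewrite -/f in df Lf.
pose S := \sum_(i <- s) c i * cexp (- z * (ln (l i))%:C).
rewrite -/S in Lf H3.
have -> : laplace tu z - gammac z * zv =
    (laplace tu z + -1 * laplace f z) - gammac z * (zv - S).
  by rewrite Lf; ring.
apply: (le_trans (normcB _ _)); rewrite [leRHS]mulrDr lerD//; last first.
  by rewrite Normc.normcM mulrC ler_wpM2r ?normc_ge0.
rewrite -laplaceZ// -laplaceD//; last exact: laplace_domZ.
have dD := laplace_domD dt (laplace_domZ (-1) df).
apply: cint_le => //; first by case: dD.
move=> u; rewrite Normc.normcM normc_cexp_lin ReN mulN1r.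
have [u0|u0] := leP 0 u.
  apply: (le_trans (ler_wpM2l (expR_ge0 _) (H1 u))).
  rewrite mulrCA -expRD ler_wpM2l ?(ltW e0)// ler_expR.
  have : d <= complex.Re z - q1 by rewrite ge_min lexx.
  rewrite ger0_norm//; nra.
apply: (le_trans (ler_wpM2l (expR_ge0 _) (H2 u))).
rewrite mulrCA -expRD ler_wpM2l ?(ltW e0)// ler_expR.
have : d <= q2 - complex.Re z by rewrite ge_min lexx orbT.
rewrite ltr0_norm//; nra.
Qed.

End mellin_transform_of_dirichlet_series.

(** * Hilbert spaces and the spectral theorem *)

Section hilbert_basics.
Context {R : realType} {H : hilbert R}.
Implicit Types (x y z : H) (k : R[i]) (b : H -> H).

(** The norm of H takes values in [R[i]]; this is its real-valued form. *)
Definition hn x : R := complex.Re `|x|.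

Lemma hnE x : `|x| = (hn x)%:C.
Proof. by rewrite /hn RRe_real// ger0_real. Qed.

Lemma hn_ge0 x : 0 <= hn x.
Proof. by rewrite -ler0c -hnE. Qed.

Lemma hn_eq0 x : (hn x == 0) = (x == 0).
Proof. by rewrite -(inj_eq (@complexI R)) -hnE normr_eq0. Qed.

Lemma hn0 : hn 0 = 0. Proof. by apply/eqP; rewrite hn_eq0. Qed.

Lemma hn_gt0 x : (0 < hn x) = (x != 0).
Proof. by rewrite lt_def hn_ge0 andbT hn_eq0. Qed.

Lemma hnN x : hn (- x) = hn x. Proof. by rewrite /hn normrN. Qed.

Lemma hnZ k x : hn (k *: x) = normc k * hn x.
Proof. by apply: complexI; rewrite rmorphM/= -!hnE normrZ. Qed.

Lemma hnD x y : hn (x + y) <= hn x + hn y.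
Proof. by rewrite -lecR rmorphD/= -!hnE ler_normD. Qed.

Lemma hnB x y : hn (x - y) <= hn x + hn y.
Proof. by rewrite -(hnN y) hnD. Qed.

Lemma hn_distC x y : hn (x - y) = hn (y - x).
Proof. by rewrite -hnN opprB. Qed.

Lemma hn_le_eq0 x : (forall e : R, 0 < e -> hn x <= e) -> x = 0.
Proof.
move=> h; apply/eqP; rewrite -hn_eq0 eq_le hn_ge0 andbT.
by apply/ler_addgt0Pl => e e0; rewrite addr0 h.
Qed.

Lemma ipC x y : ip x y = (ip y x)^*.
Proof. by rewrite hermC /= expr0 mul1r. Qed.

Lemma ipZl k x y : ip (k *: x) y = k * ip x y.
Proof. by rewrite linearZl_LR. Qed.

Lemma ipZr k x y : ip x (k *: y) = k^* * ip x y.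
Proof. by rewrite linearZr_LR. Qed.

Lemma ipDl x y z : ip (x + y) z = ip x z + ip y z.
Proof. by rewrite linearDl. Qed.

Lemma ipDr x y z : ip x (y + z) = ip x y + ip x z.
Proof. by rewrite linearDr. Qed.

Lemma ipNl x y : ip (- x) y = - ip x y. Proof. by rewrite linearNl. Qed.

Lemma ipNr x y : ip x (- y) = - ip x y. Proof. by rewrite linearNr. Qed.

Lemma ipBl x y z : ip (x - y) z = ip x z - ip y z.
Proof. by rewrite ipDl ipNl. Qed.

Lemma ip0l x : ip 0 x = 0. Proof. by rewrite linear0l. Qed.

Lemma ip0r x : ip x 0 = 0. Proof. by rewrite linear0r. Qed.

Lemma ip_suml (I : Type) (s : seq I) (P : pred I) (F : I -> H) y :
  ip (\sum_(i <- s | P i) F i) y = \sum_(i <- s | P i) ip (F i) y.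
Proof. by rewrite linear_sumlz. Qed.

Lemma ipxx x : ip x x = (hn x ^+ 2)%:C.
Proof. by rewrite -ip_norm hnE rmorphXn. Qed.

Lemma Re_ipxx x : complex.Re (ip x x) = hn x ^+ 2.
Proof. by rewrite ipxx. Qed.

Lemma ipxx_eq0 x : ip x x = 0 -> x = 0.
Proof.
rewrite ipxx => /complexI/eqP; rewrite sqrf_eq0 hn_eq0 => /eqP; exact.
Qed.

Lemma ip_eq0 x : (forall y, ip x y = 0) -> x = 0.
Proof. by move=> h; apply: ipxx_eq0. Qed.

Lemma ip_inj x y : (forall z, ip x z = ip y z) -> x = y.
Proof.
move=> h; apply/eqP; rewrite -subr_eq0; apply/eqP; apply: ip_eq0 => z.
by rewrite ipBl h subrr.
Qed.

Lemma Re_conj k : complex.Re k^* = complex.Re k. Proof. by case: k. Qed.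

Lemma conjC_real (r : R) : (r%:C)^* = r%:C. Proof. exact: conjc_real. Qed.

Lemma mulC_conj k : k * k^* = (normc k ^+ 2)%:C.
Proof.
case: k => c d; apply: complex_ext; rewrite ?ReM ?ImM/=.
  by rewrite sqr_sqrtr ?addr_ge0 ?sqr_ge0//; ring.
by ring.
Qed.

Lemma hn_sqrD x y : hn (x + y) ^+ 2 =
  hn x ^+ 2 + hn y ^+ 2 + 2 * complex.Re (ip x y).
Proof.
rewrite -!Re_ipxx ipDl !ipDr !ReD [ip y x]ipC Re_conj; ring.
Qed.

Lemma hn_sqrB x y : hn (x - y) ^+ 2 =
  hn x ^+ 2 + hn y ^+ 2 - 2 * complex.Re (ip x y).
Proof. rewrite hn_sqrD hnN ipNr ReN; ring. Qed.

Lemma cauchy_schwarz x y : normc (ip x y) <= hn x * hn y.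
Proof.
have [->|y0] := eqVneq y 0; first by rewrite ip0r hn0 mulr0 Normc.normc0.
have hy : 0 < hn y by rewrite hn_gt0.
rewrite -(@ler_pXn2r _ 2)// ?nnegrE ?normc_ge0 ?mulr_ge0 ?hn_ge0//.
pose k := ip x y * ((hn y ^- 2)%:C).
have := sqr_ge0 (hn (x - k *: y)); rewrite hn_sqrB hnZ ipZr.
have -> : complex.Re (k^* * ip x y) = normc (ip x y) ^+ 2 / hn y ^+ 2.
  have -> : k^* = (ip x y)^* * (hn y ^- 2)%:C by rewrite rmorphM/= conjC_real.
  by rewrite mulrAC [_^* * _]mulrC mulC_conj -rmorphM.
rewrite exprMn /k Normc.normcM normc_real ger0_norm ?invr_ge0 ?exprn_ge0 ?hn_ge0//.
have -> : (normc (ip x y) * hn y ^- 2) ^+ 2 * hn y ^+ 2 =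
   normc (ip x y) ^+ 2 / hn y ^+ 2 by field; rewrite gt_eqF.
set n := normc _ ^+ 2 => h.
have : n / hn y ^+ 2 <= hn x ^+ 2 by lra.
by rewrite ler_pdivrMr ?exprn_gt0// exprMn.
Qed.

Lemma normc_ip_lim x x' y : normc (ip x y - ip x' y) <= hn (x - x') * hn y.
Proof. by rewrite -ipBl cauchy_schwarz. Qed.

Lemma linear_op0 b : linear b -> b 0 = 0.
Proof. by move=> lb; have := lb (-1) 0 0; rewrite scaler0 addr0 scaleN1r addNr. Qed.

Lemma linear_opZ b k x : linear b -> b (k *: x) = k *: b x.
Proof. by move=> lb; have := lb k x 0; rewrite !addr0 (linear_op0 lb) addr0. Qed.

Lemma linear_opD b x y : linear b -> b (x + y) = b x + b y.
Proof. by move=> lb; have := lb 1 x y; rewrite !scale1r. Qed.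

Lemma linear_opB b x y : linear b -> b (x - y) = b x - b y.
Proof. by move=> lb; rewrite linear_opD// -scaleN1r linear_opZ// scaleN1r. Qed.

Lemma linear_op_sum b (I : Type) (s : seq I) (F : I -> H) : linear b ->
  b (\sum_(i <- s) F i) = \sum_(i <- s) b (F i).
Proof.
move=> lb; elim: s => [|i s ih]; first by rewrite !big_nil linear_op0.
by rewrite !big_cons linear_opD// ih.
Qed.

Lemma nbhs_hn (x : H) (P : set H) : (\forall y \near x, P y) <->
  exists2 e : R, 0 < e & forall y, hn (y - x) < e -> P y.
Proof.
split.
  move=> /nbhs_ballP[e /=]; rewrite ltcE => /andP[/eqP/= d2].
  case: e d2 => e ? /= -> e0 h; exists e => // y ye; apply: h.
  by rewrite -ball_normE /= hnE ltcR hn_distC.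
move=> [e e0 h]; apply/nbhs_ballP; exists e%:C; first by rewrite /= ltcR.
by move=> y; rewrite -ball_normE /= hnE ltcR hn_distC => /h.
Qed.

Lemma bounded_op_bound b : bounded_op b ->
  exists2 M : R, 0 < M & forall x, hn (b x) <= M * hn x.
Proof.
move=> [lb cb]; have : \forall y \near (0 : H), hn (b y - b 0) < 1.
  have /(_ (fun z => hn (z - b 0) < 1)) := cb 0; apply.
  by apply/nbhs_hn; exists 1.
move=> /nbhs_hn[e e0 he]; exists (2 / e) => [|x]; first by rewrite divr_gt0.
have [->|x0] := eqVneq x 0; first by rewrite linear_op0// hn0 mulr0.
have hx : 0 < hn x by rewrite hn_gt0.
pose k : R := e / 2 / hn x.
have k0 : 0 < k by rewrite !divr_gt0.
have := he (k%:C *: x); rewrite subr0 hnZ normc_real gtr0_norm//.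
have -> : k * hn x = e / 2 by rewrite /k; field; rewrite gt_eqF.
rewrite linear_op0// subr0 linear_opZ// hnZ normc_real gtr0_norm// => h.
have {}h : k * hn (b x) < 1 by apply: h; lra.
have -> : 2 / e * hn x = k^-1.
  by rewrite /k; field; rewrite !gt_eqF.
by rewrite -[leRHS]mulr1 ler_pdivlMl// ltW.
Qed.

Lemma linear_bounded_op b (M : R) : linear b ->
  (forall x, hn (b x) <= M * hn x) -> bounded_op b.
Proof.
move=> lb Hb; split => // x; apply/cvg_ballP => e.
move=> e0; apply/nbhs_hn.
case: e e0 => e i; rewrite ltcE => /andP[/eqP/= -> e0].
have M0 : 0 < `|M| + 1 by rewrite ltr_wpDl.
exists (e / (`|M| + 1)); first by rewrite divr_gt0.
move=> y; rewrite ltr_pdivlMr// => hy.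
rewrite -ball_normE /= hnE ltcR hn_distC -linear_opB//.
apply: le_lt_trans hy; rewrite mulrC; apply: (le_trans (Hb _)); rewrite ler_wpM2r ?hn_ge0//.
by rewrite (le_trans (ler_norm _))// lerDl.
Qed.

End hilbert_basics.

(** * Square summable families, Parseval's identity, bases and adjoints *)

Section orthonormal_sums.
Context {R : realType} {H : hilbert R}.
Implicit Types (x y z : H) (E : set H) (a : H -> R[i]) (A B : {fset H}).

Definition ortho E := forall e f, E e -> E f -> ip e f = (e == f)%:R :> R[i].

Definition osum a A : H := \sum_(e <- A) a e *: e.

(** Families are indexed by all of H and summed over finite subsets of H; vanishing outside E makes
    these sums run over E. *)
Definition supp_in E a := forall e, ~ E e -> a e = 0.

Definition net_lim (f : {fset H} -> R[i]) (l : R[i]) :=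
  forall e : R, 0 < e -> exists A, forall B, fsubset A B -> normc (f B - l) <= e.

Definition hnet_lim (f : {fset H} -> H) (l : H) :=
  forall e : R, 0 < e -> exists A, forall B, fsubset A B -> hn (f B - l) <= e.

Definition coef E x : H -> R[i] := fun e => if `[< E e >] then ip x e else 0.

Lemma supp_coef E x : supp_in E (coef E x).
Proof. by move=> e Ee; rewrite /coef asboolF. Qed.

Lemma coefE E x e : E e -> coef E x e = ip x e.
Proof. by move=> Ee; rewrite /coef asboolT. Qed.

Lemma sum_fset_delta (F : H -> R[i]) A f :
  \sum_(e <- A) F e * (e == f)%:R = if f \in A then F f else 0.
Proof.
have E (s : seq H) : uniq s -> \sum_(e <- s) F e * (e == f)%:R =
    if f \in s then F f else 0.
  elim: s => [|e s ih]; first by rewrite big_nil.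
  move=> /= /andP[es us]; rewrite big_cons ih// in_cons [f == e]eq_sym.
  have [ef|ef] := eqVneq e f.
    rewrite ef.
    by case: ifP => [fs|_] /=; [move: es; rewrite ef fs|rewrite mulr1 addr0].
  by rewrite mulr0 add0r.
exact: E (fset_uniq A).
Qed.

Lemma ip_osum E a A f : ortho E -> supp_in E a -> E f ->
  ip (osum a A) f = if f \in A then a f else 0.
Proof.
move=> oE sa Ef; rewrite /osum ip_suml -sum_fset_delta.
apply: eq_bigr => e _; rewrite ipZl; have [Ee|nE] := pselect (E e).
  by rewrite oE.
by rewrite sa// !mul0r.
Qed.

Lemma ip_osum_osum E a a' A : ortho E -> supp_in E a -> supp_in E a' ->
  ip (osum a A) (osum a' A) = \sum_(e <- A) a e * (a' e)^*.
Proof.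
move=> oE sa sa'; rewrite {2}/osum linear_sumr/=.
rewrite big_seq [RHS]big_seq; apply: eq_bigr => e eA.
rewrite ipZr mulrC; have [Ee|nE] := pselect (E e).
  by rewrite (ip_osum _ oE)// eA.
by rewrite sa// sa'// rmorph0 mulr0 mul0r.
Qed.

Lemma hn_osum E a A : ortho E -> supp_in E a ->
  hn (osum a A) ^+ 2 = \sum_(e <- A) normc (a e) ^+ 2.
Proof.
move=> oE sa; rewrite -Re_ipxx (ip_osum_osum _ oE)//.
under eq_bigr do rewrite mulC_conj.
by rewrite -rmorph_sum.
Qed.

Lemma bessel E x A : ortho E ->
  \sum_(e <- A) normc (coef E x e) ^+ 2 <= hn x ^+ 2.
Proof.
move=> oE; have sx := @supp_coef E x.
have := sqr_ge0 (hn (x - osum (coef E x) A)); rewrite hn_sqrB (hn_osum _ oE)//.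
suff -> : complex.Re (ip x (osum (coef E x) A)) =
  \sum_(e <- A) normc (coef E x e) ^+ 2 by lra.
rewrite /osum linear_sumr/= -(hn_osum _ oE)// -Re_ipxx (ip_osum_osum _ oE)//.
congr complex.Re; apply: eq_bigr => e _; rewrite ipZr mulrC.
have [Ee|nE] := pselect (E e); first by rewrite !coefE.
by rewrite sx// !rmorph0 !mulr0 // mul0r.
Qed.

Lemma sum_fsetDl (V : nmodType) (F : H -> V) A B : fsubset A B ->
  \sum_(e <- B) F e = \sum_(e <- A) F e + \sum_(e <- fsetD B A) F e.
Proof.
move=> AB; rewrite (@big_fsetID _ _ _ _ (mem A))/=.
have -> : [fset x in B | mem A x]%fset = A.
  apply/fsetP => e; rewrite !inE.
  by apply/andP/idP => [[]//|eA]; rewrite eA (fsubsetP AB).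
have -> // : [fset x in B | ~~ mem A x]%fset = fsetD B A.
by apply/fsetP => e; rewrite !inE andbC.
Qed.

(** Past a finite set whose square sum is within e^2 of the supremum, orthogonality bounds every
    increment by e; so the partial sums are Cauchy. *)
Lemma riesz_fischer E a (K : R) : ortho E -> supp_in E a ->
  (forall A, \sum_(e <- A) normc (a e) ^+ 2 <= K) ->
  exists y, hnet_lim (osum a) y.
Proof.
move=> oE sa aK.
pose S := [set r : R | exists A, r = \sum_(e <- A) normc (a e) ^+ 2].
have hS : has_sup S.
  split; first by exists (\sum_(e <- (fset0 : {fset H})) normc (a e) ^+ 2), fset0.
  by exists K => _ [A ->].
pose F := (osum a @ (@summability.totally H)).
have FF : ProperFilter F.
  by apply: fmap_proper_filter; exact: summability.totally_filter.
have tail (e : R) : 0 < e -> exists A, forall B, fsubset A B ->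
    hn (osum a B - osum a A) <= e.
  move=> e0; have e20 : 0 < e ^+ 2 by rewrite exprn_gt0.
  have [_ [A ->] HA] := sup_adherent e20 hS.
  exists A => B AB; rewrite -(@ler_pXn2r _ 2)// ?nnegrE ?hn_ge0 ?ltW//.
  rewrite {1}/osum (sum_fsetDl _ AB) addrAC subrr add0r -/(osum a _) (hn_osum _ oE)//.
  have : \sum_(e <- B) normc (a e) ^+ 2 <= sup S.
    by apply: ub_le_sup; [case: hS|exists B].
  rewrite (sum_fsetDl _ AB); lra.
have cF : cvg F.
  apply: cauchy_cvg; apply: cauchy_exP => e.
  rewrite ltcE => /andP[/eqP/= e2 e0]; case: e e2 e0 => e ? /= -> e0.
  have [|A HA] := tail (e / 2); first by rewrite divr_gt0.
  exists (osum a A), A => // B /= AB.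
  rewrite -ball_normE /= hnE ltcR hn_distC; apply: (le_lt_trans (HA _ AB)); lra.
exists (lim F) => e e0.
have [|A HA] := tail (e / 2); first by rewrite divr_gt0.
have : \forall y \near lim F, hn (y - lim F) < e / 2.
  by apply/nbhs_hn; exists (e / 2); rewrite ?divr_gt0.
move=> /cF[A' _ HA']; exists (fsetU A A') => B; rewrite fsubUset => /andP[AB A'B].
by apply/ltW; have := HA' _ A'B; rewrite /=; lra.
Qed.

Lemma hnet_ip f l z : hnet_lim f l -> net_lim (fun A => ip (f A) z) (ip l z).
Proof.
move=> fl e e0; have z0 : 0 < hn z + 1 by rewrite ltr_wpDl ?hn_ge0.
have [|A HA] := fl (e / (hn z + 1)); first by rewrite divr_gt0.
exists A => B /HA h; apply: (le_trans (normc_ip_lim _ _ _)).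
rewrite ler_pdivlMr// in h.
by apply: le_trans h; rewrite ler_wpM2l ?hn_ge0// lerDl.
Qed.

Lemma net_lim_unique f l l' : net_lim f l -> net_lim f l' -> l = l'.
Proof.
move=> fl fl'; apply/eqP; rewrite -subr_eq0 -normc_eq0 eq_le normc_ge0 andbT.
apply/ler_addgt0Pl => e e0; rewrite addr0.
have e20 : 0 < e / 2 by rewrite divr_gt0.
have [A HA] := fl _ e20; have [A' HA'] := fl' _ e20.
have h1 := HA (fsetU A A') (fsubsetUl _ _).
have h2 := HA' (fsetU A A') (fsubsetUr _ _).
have -> : l - l' = (f (fsetU A A') - l') - (f (fsetU A A') - l) by ring.
by apply: (le_trans (normcB _ _)); lra.
Qed.

Lemma net_lim_le f l (c : R[i]) (K : R) : net_lim f l ->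
  (exists A, forall B, fsubset A B -> normc (f B - c) <= K) -> normc (l - c) <= K.
Proof.
move=> fl [A' HA']; apply/ler_addgt0Pl => e e0; have [A HA] := fl e e0.
have h1 := HA (fsetU A A') (fsubsetUl _ _).
have h2 := HA' (fsetU A A') (fsubsetUr _ _).
have -> : l - c = (f (fsetU A A') - c) - (f (fsetU A A') - l) by ring.
by apply: (le_trans (normcB _ _)); lra.
Qed.

Lemma ip_hnet_osum E a y e : ortho E -> supp_in E a -> hnet_lim (osum a) y ->
  E e -> ip y e = a e.
Proof.
move=> oE sa ay Ee; apply: net_lim_unique (hnet_ip e ay) _.
move=> d d0; exists (fset1 e) => B; rewrite fsub1set => eB.
by rewrite (ip_osum _ oE)// eB subrr Normc.normc0 ltW.
Qed.

Lemma basis_expansion E x : orthonormal_basis E -> hnet_lim (osum (coef E x)) x.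
Proof.
move=> [oE tE].
have [y Hy] := riesz_fischer oE (@supp_coef E x) (fun A => bessel x A oE).
suff xy : x = y by move: Hy; rewrite -xy.
apply/eqP; rewrite -subr_eq0; apply/eqP; apply: tE => e Ee.
by rewrite ipBl (ip_hnet_osum oE (@supp_coef E x) Hy Ee) coefE// subrr.
Qed.

Lemma parseval E x y : orthonormal_basis E ->
  net_lim (fun A => \sum_(e <- A) coef E x e * (coef E y e)^*) (ip x y).
Proof.
move=> bE; have := hnet_ip y (basis_expansion x bE).
move=> h e e0; have [A HA] := h e e0; exists A => B /HA.
rewrite /osum ip_suml; congr (normc (_ - _) <= _); apply: eq_bigr => f _.
rewrite ipZl /coef; case: asboolP => _; last by rewrite !mul0r.
by rewrite [ip f y]ipC.
Qed.

Lemma eq_on_basis E (b c : H -> H) : orthonormal_basis E ->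
  bounded_op b -> bounded_op c -> (forall e, E e -> b e = c e) -> b = c.
Proof.
move=> bE bb bc bcE; apply/funext => x.
have [M M0 HM] := bounded_op_bound bb; have [N N0 HN] := bounded_op_bound bc.
apply/eqP; rewrite -subr_eq0; apply/eqP; apply: hn_le_eq0 => e e0.
have [|A HA] := basis_expansion x bE (e := e / (M + N)).
  by rewrite divr_gt0// addr_gt0.
have h := HA _ (fsubset_refl A).
rewrite ler_pdivlMr ?addr_gt0// in h.
set s := osum _ _ in h.
have bs : b s = c s.
  rewrite /s /osum (linear_op_sum _ _ bb.1) (linear_op_sum _ _ bc.1).
  apply: eq_bigr => f _; rewrite (linear_opZ _ _ bb.1) (linear_opZ _ _ bc.1).
  have [Ef|nE] := pselect (E f); first by rewrite bcE.
  by rewrite supp_coef// !scale0r.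
have -> : b x - c x = c (s - x) - b (s - x).
  by rewrite (linear_opB _ _ bb.1) (linear_opB _ _ bc.1) bs opprB [RHS]addrC addrA subrK.
apply: (le_trans (hnB _ _)); apply: le_trans h.
have := HM (s - x); have := HN (s - x); lra.
Qed.

(** The set P is all of H when a basis is wanted, and the set of eigenvectors in the spectral
    theorem. *)
Lemma exists_maximal_ortho (P : set H) : exists E,
  [/\ ortho E, E `<=` P &
   forall x, P x -> hn x = 1 -> (forall e, E e -> ip x e = 0) -> False].
Proof.
pose Q := [set E : set H | ortho E /\ E `<=` P].
have [F FQ tF|E [[oE EP] maxE]] := @Zorn_bigcup _ Q.
  split; last by move=> x [X FX Xx]; exact: (FQ _ FX).2.
  move=> e f [X FX Xe] [Y FY Yf].
  have [XY|YX] := tF _ _ FX FY.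
    by apply: (FQ _ FY).1 => //; exact: XY.
  by apply: (FQ _ FX).1 => //; exact: YX.
exists E; split => // x Px x1 xE.
have nEx : ~ E x.
  move=> Ex; have := xE x Ex; rewrite ipxx x1 expr1n => /eqP.
  by rewrite oner_eq0.
apply: (maxE (E `|` [set x])).
  split; first by move=> y Ey; left.
  by move/(_ x) => /(_ (or_intror erefl)).
split; last by move=> y [/EP//|->].
move=> e f [Ee|->] [Ef|->].
- exact: oE.
- rewrite ipC xE// rmorph0; case: eqP => // ex; exfalso; apply: nEx; by rewrite -ex.
- rewrite xE//; case: eqP => // ex; exfalso; apply: nEx; by rewrite ex.
- by rewrite eqxx ipxx x1 expr1n.
Qed.

Lemma normalize x : x != 0 -> hn ((hn x)^-1%:C *: x) = 1.
Proof.
move=> x0; have hx : 0 < hn x by rewrite hn_gt0.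
by rewrite hnZ normc_real ger0_norm ?invr_ge0 ?hn_ge0// mulVf// gt_eqF.
Qed.

Lemma exists_basis : exists E : set H, orthonormal_basis E.
Proof.
have [E [oE _ mE]] := exists_maximal_ortho setT.
exists E; split => // x xE; apply/eqP/negPn/negP => x0.
apply: (mE _ I (normalize x0)) => e Ee; by rewrite ipZl xE// mulr0.
Qed.

(** The coordinates of c y are forced to be the conjugates of <b e, y>. They are square summable
    because a partial sum v satisfies |v|^2 = <b v, y> <= M |y| |v|. *)
Lemma exists_adjoint (b : H -> H) : bounded_op b ->
  exists2 c, bounded_op c & is_adjoint b c.
Proof.
move=> bb; have [M M0 HM] := bounded_op_bound bb.
have [E bE] := exists_basis.
have ex y : exists w, forall x, ip (b x) y = ip x w.
  pose a e : R[i] := if `[< E e >] then (ip (b e) y)^* else 0.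
  have sa : supp_in E a by move=> e Ee; rewrite /a asboolF.
  have [A|w Hw] := @riesz_fischer E a ((M * hn y) ^+ 2) bE.1 sa.
    rewrite -(hn_osum A bE.1 sa); set v := osum a A.
    have Ev : (hn v ^+ 2)%:C = ip (b v) y.
      rewrite /v {2}/osum (linear_op_sum _ _ bb.1) ip_suml -ipxx.
      rewrite (ip_osum_osum _ bE.1 sa sa); apply: eq_bigr => e _.
      rewrite (linear_opZ _ _ bb.1) ipZl /a; case: asboolP => _.
        by rewrite conjCK.
      by rewrite !mul0r.
    have hv : hn v ^+ 2 <= M * hn y * hn v.
      rewrite -[hn v ^+ 2]ger0_norm ?sqr_ge0// -normc_real Ev.
      apply: (le_trans (cauchy_schwarz _ _)).
      by rewrite mulrAC ler_wpM2r ?hn_ge0.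
    have [v0|v0] := eqVneq (hn v) 0; first by rewrite v0 expr0n/= sqr_ge0.
    have vp : 0 < hn v by rewrite lt_def v0 hn_ge0.
    rewrite expr2 ler_pM2r// in hv.
    by rewrite lerXn2r ?nnegrE ?hn_ge0 ?mulr_ge0 ?hn_ge0// ltW.
  exists w => x.
  have E1 e : E e -> ip (b e) y = ip e w.
    move=> Ee; rewrite ipC [RHS]ipC (ip_hnet_osum bE.1 sa Hw Ee) /a asboolT//.
    by rewrite conjCK -ipC.
  apply: net_lim_unique (hnet_ip w (basis_expansion x bE)).
  move=> e e0; have y0 : 0 < M * hn y + 1.
    by rewrite ltr_wpDl// mulr_ge0 ?hn_ge0// ltW.
  have [|A HA] := basis_expansion x bE (e := e / (M * hn y + 1)).
    by rewrite divr_gt0.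
  exists A => B /HA h; set s := osum _ B in h *.
  have -> : ip s w = ip (b s) y.
    rewrite /s /osum (linear_op_sum _ _ bb.1) !ip_suml; apply: eq_bigr => f _.
    rewrite (linear_opZ _ _ bb.1) !ipZl.
    have [Ef|nE] := pselect (E f); first by rewrite E1.
    by rewrite supp_coef// !mul0r.
  rewrite -ipBl -(linear_opB _ _ bb.1); apply: (le_trans (cauchy_schwarz _ _)).
  rewrite ler_pdivlMr// in h; apply: le_trans h.
  rewrite mulrDr mulr1 mulrA [_ * M]mulrC.
  apply: (@le_trans _ _ (M * hn (s - x) * hn y)).
    by rewrite ler_wpM2r ?hn_ge0.
  by rewrite lerDl hn_ge0.
pose c y := xget 0 [set w | forall x, ip (b x) y = ip x w].
have adj : is_adjoint b c.
  by move=> x y; have := xgetPex 0 (ex y); apply.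
exists c => //; apply: (@linear_bounded_op _ _ _ M).
  move=> k y y'; apply/ip_inj => z; rewrite ipC [RHS]ipC; congr _^*.
  by rewrite -adj !ipDr !ipZr !adj.
move=> y; have [c0|c0] := eqVneq (hn (c y)) 0.
  by rewrite c0 mulr_ge0 ?hn_ge0 ?ltW.
have cp : 0 < hn (c y) by rewrite lt_def c0 hn_ge0.
rewrite -(ler_pM2r cp) -expr2.
rewrite -[_ ^+ 2]ger0_norm ?sqr_ge0// -normc_real -ipxx -adj.
apply: (le_trans (cauchy_schwarz _ _)); rewrite mulrAC ler_wpM2r ?hn_ge0//.
Qed.

End orthonormal_sums.

(* Makes c W + T W below an eigenvector of D. *)
Lemma quadratic_root (C : numClosedFieldType) (m l l' : C) : m != 0 ->
  exists c, c * l' + 1 = (l + c / m) * c.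
Proof.
move=> m0; pose s := sqrtC ((m * (l - l')) ^+ 2 + 4 * m).
have sE : s ^+ 2 = (m * (l - l')) ^+ 2 + 4 * m by rewrite sqrtCK.
clearbody s; exists ((s - m * (l - l')) / 2).
apply/esym/eqP; rewrite -subr_eq0.
have -> : (l + (s - m * (l - l')) / 2 / m) * ((s - m * (l - l')) / 2) -
    ((s - m * (l - l')) / 2 * l' + 1) =
    (s ^+ 2 - ((m * (l - l')) ^+ 2 + 4 * m)) / (4 * m) by field.
by rewrite sE subrr mul0r.
Qed.

(** * Diagonalisation of a self-adjoint operator with compact resolvent *)

Section spectral_theorem.
Context {R : realType} {H : hilbert R} (D : unbounded_op H).
Implicit Types (x y z : H) (k : R[i]).
Hypothesis sD : self_adjoint D.

Definition eigenvector (l : R) (e : H) := udom D e /\ D e = l%:C *: e.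

Lemma sa_lin k x y : udom D x -> udom D y ->
  udom D (k *: x + y) /\ D (k *: x + y) = k *: D x + D y.
Proof. by have [[_ h] _ _] := sD; exact: h. Qed.

Lemma sa_dom0 : udom D 0. Proof. by have [[]] := sD. Qed.

Lemma sa_D0 : D 0 = 0.
Proof.
have [_] := sa_lin (-1) sa_dom0 sa_dom0.
by rewrite scaler0 addr0 scaleN1r addNr.
Qed.

Lemma sa_domZ k x : udom D x -> udom D (k *: x).
Proof. by move=> dx; have [] := sa_lin k dx sa_dom0; rewrite addr0. Qed.

Lemma sa_Z k x : udom D x -> D (k *: x) = k *: D x.
Proof.
by move=> dx; have [_] := sa_lin k dx sa_dom0; rewrite !addr0 sa_D0 addr0.
Qed.

Lemma sa_sym x y : udom D x -> udom D y -> ip (D x) y = ip x (D y).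
Proof. by move=> dx dy; have [_ _ /(_ y (D y))[_ h]] := sD; exact: h. Qed.

Lemma sa_adj y z : (forall x, udom D x -> ip (D x) y = ip x z) ->
  udom D y /\ D y = z.
Proof. by have [_ _ /(_ y z)[]] := sD. Qed.

Lemma sa_eigen_real k x : x != 0 -> udom D x -> D x = k *: x ->
  eigenvector (complex.Re k) x.
Proof.
move=> x0 dx Dx; split => //; rewrite Dx; congr (_ *: _).
have := sa_sym dx dx; rewrite Dx ipZl ipZr => /(mulIf _) h.
have {h} : k = k^*.
  by apply: h; apply: contra_neq x0; exact: ipxx_eq0.
case: k {Dx} => u v [/eqP]; rewrite -subr_eq0 opprK -mulr2n mulrn_eq0/=.
by move=> /eqP ->.
Qed.

Lemma eigenvector_ortho (l l' : R) x y : eigenvector l x -> eigenvector l' y ->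
  l != l' -> ip x y = 0.
Proof.
move=> [dx Dx] [dy Dy] ll'; have := sa_sym dx dy.
rewrite Dx Dy ipZl ipZr conjC_real => /eqP.
rewrite -subr_eq0 -mulrBl mulf_eq0 subr_eq0 (inj_eq (@complexI R)) (negbTE ll').
by move=> /eqP.
Qed.

Variables (l : R[i]) (T : H -> H).
Hypothesis rT : is_resolvent D l T.
Hypothesis cT : compact_op T.

Lemma resolvent_inj x : T x = 0 -> x = 0.
Proof.
move=> Tx; have [_ /(_ x)[_ +] _] := rT.
by rewrite Tx sa_D0 scaler0 subr0.
Qed.

Lemma resolvent_D x : udom D (T x) /\ D (T x) = x + l *: T x.
Proof.
by have [_ /(_ x)[? h] _] := rT; split => //; rewrite -{2}h subrK.
Qed.

Lemma resolvent_eigen_neq (m : R) e : e != 0 -> eigenvector m e -> l != m%:C.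
Proof.
move=> e0 [de De]; apply: contra_neq e0 => lm.
have [_ _ /(_ e de)] := rT; rewrite De lm subrr.
by have [[lT _] _ _] := rT; rewrite (linear_op0 lT).
Qed.

Lemma compact_cluster (u : nat -> H) : (forall n, hn (u n) <= 1) ->
  exists y, forall (e : R) N, 0 < e -> exists2 n, (N <= n)%N & hn (T (u n) - y) < e.
Proof.
move=> u1; have [_] := cT; rewrite precompactE => cK.
have [|y [_ cy]] := cK ((T \o u) n @[n --> \oo]) _.
  exists 0%N => // n _ /=; apply: subset_closure; exists (u n) => //=.
  by rewrite hnE -[1]/(1%:C) lecR.
exists y => e N e0.
have FA : ((T \o u) n @[n --> \oo]) [set T (u n) | n in [set n | (N <= n)%N]].
  by exists N => // n /= Nn; exists n.
have nB : nbhs y [set z | hn (z - y) < e] by apply/nbhs_hn; exists e.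
have [z [/= [n Nn <-] nz]] := cy _ _ FA nB.
by exists n.
Qed.

(* Let V be the orthogonal complement of a maximal orthonormal set of
   eigenvectors, and S the adjoint of the resolvent T at l; both preserve V.  If
   V <> 0 and M = sup |T v| over the unit ball of V, a cluster point y of a
   maximising sequence T (u n) yields W = S y <> 0 in V with S T W = M^2 W.
   Hence D preserves the span of W and T W, which is at most two-dimensional and
   thus contains an eigenvector in V, contradicting maximality. *)
Lemma exists_eigenbasis : exists E : set H,
  orthonormal_basis E /\ forall e, E e -> exists m, eigenvector m e.
Proof.
have [E [oE EP maxE]] := exists_maximal_ortho [set e : H | exists m, eigenvector m e].
exists E; split => //; split => //.
pose V := [set v : H | forall e, E e -> ip v e = 0].
have max' x m : V x -> x != 0 -> ~ eigenvector m x.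
  move=> Vx x0 [dx Dx]; apply: (maxE _ _ (normalize x0)).
    exists m; split; first exact: sa_domZ.
    by rewrite sa_Z// Dx !scalerA mulrC.
  by move=> e Ee; rewrite ipZl Vx// mulr0.
move=> x0 Vx0; apply/eqP/negPn/negP => x0_neq0.
have [bT _ _] := rT; have [lT _] := bT.
have [S bS adj] := exists_adjoint bT; have [lS _] := bS.
(* S maps into the domain of D and is a right inverse of D minus the conjugate of l. *)
have SD z : udom D (S z) /\ D (S z) = z + l^* *: S z.
  apply: sa_adj => x dx; rewrite ipDr ipZr conjCK.
  have [_ _ /(_ x dx) Tx] := rT.
  by rewrite -[in ip x z]Tx adj ipBl ipZl subrK.
have e_neq0 e : E e -> e != 0.
  move=> Ee; apply: contra_eq_neq (oE e e Ee Ee) => ->.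
  by rewrite ip0l eqxx eq_sym oner_eq0.
have VT v : V v -> V (T v).
  move=> Vv e Ee; have [m [de De]] := EP _ Ee.
  have lm := resolvent_eigen_neq (e_neq0 _ Ee) (conj de De).
  have [dT DT] := resolvent_D v.
  have := sa_sym dT de; rewrite DT De ipDl ipZl ipZr Vv// add0r conjC_real => /eqP.
  by rewrite -subr_eq0 -mulrBl mulf_eq0 subr_eq0 (negbTE lm) => /eqP.
have VS v : V v -> V (S v).
  move=> Vv e Ee; have [m [de De]] := EP _ Ee.
  have lm := resolvent_eigen_neq (e_neq0 _ Ee) (conj de De).
  have [dS DS] := SD v.
  have := sa_sym dS de; rewrite DS De ipDl ipZl ipZr Vv// add0r => /eqP.
  rewrite -subr_eq0 -mulrBl -rmorphB mulf_eq0 conjC_eq0 subr_eq0 (negbTE lm).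
  by move=> /eqP.
have [K K0 HK] := bounded_op_bound bT.
have [K' K'0 HK'] := bounded_op_bound bS.
pose N := [set r : R | exists v, [/\ V v, hn v <= 1 & r = hn (T v)]].
have V0 : V 0 by move=> e _; rewrite ip0l.
have hN : has_sup N.
  split; first by exists (hn (T 0)), 0; rewrite hn0.
  exists K => _ [v [_ v1 ->]]; apply: (le_trans (HK v)).
  by rewrite ler_piMr// ltW.
pose M := sup N.
have VZ k v : V v -> V (k *: v) by move=> Vv e Ee; rewrite ipZl Vv// mulr0.
have MT v : V v -> hn (T v) <= M * hn v.
  move=> Vv; have [->|v0] := eqVneq v 0.
    by rewrite (linear_op0 lT) hn0 mulr0.
  have hv : 0 < hn v by rewrite hn_gt0.
  rewrite -ler_pdivrMr// mulrC -[(hn v)^-1]ger0_norm ?invr_ge0 ?hn_ge0//.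
  rewrite -normc_real -hnZ -(linear_opZ _ _ lT).
  apply: ub_le_sup; first by case: hN.
  by exists ((hn v)^-1%:C *: v); rewrite (normalize v0); split=> //; exact: VZ.
have M0 : 0 < M.
  have h : 0 < hn (T x0).
    by rewrite hn_gt0; apply: contra_neq x0_neq0; exact: resolvent_inj.
  have := lt_le_trans h (MT _ Vx0); rewrite pmulr_lgt0// hn_gt0//.
have MS v : V v -> hn (S v) <= M * hn v.
  move=> Vv; have [c0|c0] := eqVneq (hn (S v)) 0.
    by rewrite c0 mulr_ge0 ?hn_ge0 ?ltW.
  have cp : 0 < hn (S v) by rewrite lt_def c0 hn_ge0.
  rewrite -(ler_pM2r cp) -expr2.
  rewrite -[_ ^+ 2]ger0_norm ?sqr_ge0// -normc_real -ipxx -adj.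
  apply: (le_trans (cauchy_schwarz _ _)); rewrite mulrAC ler_wpM2r ?hn_ge0//.
  exact/MT/VS.
have M3 : 0 < 2 * M ^+ 3 by rewrite mulr_gt0// exprn_gt0.
(* A near-maximiser of |T v| is a near-eigenvector of S T for M^2: expand the square with <S T v, v>
   = |T v|^2 and |S T v| <= M |T v|. *)
have AM v : V v -> hn v <= 1 ->
    hn (S (T v) - (M ^+ 2)%:C *: v) ^+ 2 <= 2 * M ^+ 3 * (M - hn (T v)).
  move=> Vv v1; rewrite hn_sqrB hnZ normc_real ipZr conjC_real.
  have -> : ip (S (T v)) v = (hn (T v) ^+ 2)%:C.
    by rewrite ipC -adj ipxx conjC_real.
  rewrite -rmorphM /= ger0_norm ?sqr_ge0//.
  have h1 := MS _ (VT _ Vv); have h2 := MT _ Vv.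
  have t0 := hn_ge0 (T v); have s0 := hn_ge0 (S (T v)); have v0 := hn_ge0 v.
  have h3 : hn (T v) <= M by rewrite (le_trans h2)// ler_piMr// ltW.
  have h4 : hn (S (T v)) ^+ 2 <= M ^+ 2 * hn (T v) ^+ 2.
    by rewrite -exprMn lerXn2r ?nnegrE// mulr_ge0// ltW.
  have h5 : hn v ^+ 2 <= 1 by rewrite expr_le1.
  have h6 : (M ^+ 2 * hn v) ^+ 2 <= M ^+ 4.
    by rewrite exprMn -exprM ler_piMr// exprn_ge0 ?ltW.
  apply: (@le_trans _ _ (M ^+ 2 * ((M - hn (T v)) * (M + hn (T v))))).
    have -> : M ^+ 2 * ((M - hn (T v)) * (M + hn (T v))) =
      M ^+ 4 - M ^+ 2 * hn (T v) ^+ 2 by ring.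
    by lra.
  have -> : 2 * M ^+ 3 * (M - hn (T v)) = M ^+ 2 * ((M - hn (T v)) * (2 * M)) by ring.
  rewrite ler_wpM2l ?exprn_ge0 ?(ltW M0)// ler_wpM2l ?subr_ge0//; lra.
have ex_u n : exists v, [/\ V v, hn v <= 1 & M - n.+1%:R^-1 < hn (T v)].
  have [|_ [v [Vv v1 ->]] h] := @sup_adherent _ N (n.+1%:R^-1) _ hN.
    by rewrite invr_gt0 ltr0n.
  by exists v.
have [u Hu] := choice ex_u.
have [y Hy] : exists y, forall (e : R) N, 0 < e ->
    exists2 n, (N <= n)%N & hn (T (u n) - y) < e.
  by apply: compact_cluster => n; have [] := Hu n.
have approx (e : R) : 0 < e -> exists v, [/\ V v, hn (T v - y) < e,
    M - e < hn (T v) & hn (S (T v) - (M ^+ 2)%:C *: v) <= e].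
  (* The second bound on d turns M - |T v| < d into |S T v - M^2 v|^2 <= e^2 through [AM]. *)
  move=> e0; pose d := Num.min e (e ^+ 2 / (2 * M ^+ 3)).
  have d0 : 0 < d by rewrite lt_min e0 divr_gt0 ?exprn_gt0.
  have [n Nn h] := Hy e (Num.truncn d^-1) e0.
  have [Vu u1 hu] := Hu n; exists (u n).
  have nd : n.+1%:R^-1 < d.
    rewrite invf_plt ?posrE//; apply: (lt_le_trans (truncnS_gt _)).
    by rewrite ler_nat ltnS.
  have Md : M - d < hn (T (u n)) by apply: lt_trans hu; rewrite ltrD2l ltrN2.
  split => //; first by rewrite (le_lt_trans _ Md)// lerD2l lerN2 ge_min lexx.
  rewrite -(@ler_pXn2r _ 2)// ?nnegrE ?hn_ge0 ?(ltW e0)//.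
  apply: (le_trans (AM _ Vu u1)); rewrite mulrC -ler_pdivlMr//.
  apply: ltW; apply: (@lt_le_trans _ _ d); first by rewrite ltrBlDr -ltrBlDl.
  by rewrite ge_min lexx orbT.
have y_neq0 : y != 0.
  apply/eqP => y0; have M30 : 0 < M / 3 by rewrite divr_gt0.
  have [v [_ + + _]] := approx _ M30; rewrite y0 subr0; lra.
have Vy : V y.
  move=> e Ee; apply/eqP; rewrite -normc_eq0 eq_le normc_ge0 andbT.
  have e1 : hn e = 1.
    apply/eqP; rewrite -(@eqrXn2 _ 2)// ?hn_ge0// expr1n -Re_ipxx oE// eqxx.
    by rewrite Re_nat.
  apply/ler_addgt0Pl => d d0; rewrite addr0.
  have [v [Vv h _ _]] := approx d d0.
  have -> : ip y e = - ip (T v - y) e by rewrite ipBl VT// sub0r opprK.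
  rewrite normcN (le_trans (cauchy_schwarz _ _))// e1 mulr1; exact: ltW.
pose W := S y.
have VW : V W by exact: VS.
have W_neq0 : W != 0.
  apply: contra_neq y_neq0 => W0; have [_] := SD y.
  by rewrite -/W W0 sa_D0 scaler0 addr0.
have AW : S (T W) = (M ^+ 2)%:C *: W.
  apply/eqP; rewrite -subr_eq0; apply/eqP; apply: hn_le_eq0 => e e0.
  have M20 : 0 < M ^+ 2 by rewrite exprn_gt0.
  (* Z adds up the constants of the estimates [h4] and [h6], so that they total Z d = e. *)
  pose Z := K' * K * (K' + 1) + M ^+ 2 * (1 + (K' + 1)).
  have Z0 : 0 < Z by rewrite ltr_pwDr// ?mulr_gt0 ?mulr_ge0 ?addr_ge0 ?addr_gt0// ?ltW.
  have [v [Vv h1 _ h2]] := approx (e / Z) (divr_gt0 e0 Z0).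
  set d := e / Z in h1 h2.
  have d0 : 0 < d by rewrite divr_gt0.
  have h3 : hn (W - (M ^+ 2)%:C *: v) <= (K' + 1) * d.
    have -> : W - (M ^+ 2)%:C *: v = (S (T v) - (M ^+ 2)%:C *: v) - S (T v - y).
      by rewrite (linear_opB _ _ lS) -/W opprB [RHS]addrC addrA subrK.
    rewrite (le_trans (hnB _ _))// mulrDl mul1r addrC lerD//.
    by rewrite (le_trans (HK' _))// ler_wpM2l ?ltW.
  set w := (M ^+ 2)%:C *: v in h3.
  have -> : S (T W) - (M ^+ 2)%:C *: W =
      S (T (W - w)) + (M ^+ 2)%:C *: ((S (T v) - w) - (W - w)).
    rewrite (linear_opB _ _ lT) (linear_opB _ _ lS).
    have -> : S (T w) = (M ^+ 2)%:C *: S (T v).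
      by rewrite /w (linear_opZ _ _ lT) (linear_opZ _ _ lS).
    by rewrite opprB addrA subrK scalerBr addrA subrK.
  rewrite (le_trans (hnD _ _))// hnZ normc_real ger0_norm ?sqr_ge0//.
  have h4 : hn (S (T (W - w))) <= K' * K * ((K' + 1) * d).
    rewrite (le_trans (HK' _))// -mulrA ler_wpM2l ?(ltW K'0)//.
    exact: (le_trans (HK _) (ler_wpM2l (ltW K0) h3)).
  have h5 : hn ((S (T v) - w) - (W - w)) <= d + (K' + 1) * d.
    by rewrite (le_trans (hnB _ _))// lerD.
  have h6 := ler_wpM2l (ltW M20) h5.
  have eZ : e = Z * d by rewrite /d mulrC divfK// gt_eqF.
  have -> : e = K' * K * ((K' + 1) * d) + M ^+ 2 * (d + (K' + 1) * d).
    by rewrite eZ /Z; ring.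
  exact: lerD.
pose m : R[i] := (M ^+ 2)%:C; rewrite -/m in AW.
have m0 : m != 0.
  by rewrite -[0]/(0%:C) (inj_eq (@complexI R)) gt_eqF// exprn_gt0.
have [dW _] := SD y; rewrite -/W in dW.
set t := T W in AW.
have [dt Dt] := resolvent_D W; rewrite -/t in dt Dt.
(* S t = m W, so [SD] at t computes D on W. *)
have DW : D W = m^-1 *: t + l^* *: W.
  have [_] := SD t; rewrite AW sa_Z// => h.
  rewrite -[LHS]scale1r -(mulVf m0) -scalerA h scalerDr !scalerA.
  by rewrite [_ * l^* * m]mulrAC mulVf// mul1r.
have [c cE] := quadratic_root l l^* m0.
pose mu := l + c / m; rewrite -/mu in cE.
have [dz Dz] := sa_lin c dW dt.
set z := c *: W + t in dz Dz.
have Vz : V z by move=> e Ee; rewrite ipDl VZ// add0r VT.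
have Dz' : D z = mu *: z.
  rewrite Dz DW Dt scalerDr !scalerA [RHS]scalerDr scalerA -cE scalerDl scale1r.
  rewrite /mu [in RHS]scalerDl (addrC ((c / m) *: t)) -!addrA; congr (_ + _).
  by rewrite addrCA; congr (_ + _); rewrite addrC.
(* The combination z may vanish; then t is a multiple of W, and W itself is an eigenvector. *)
have [z0|z_neq0] := eqVneq z 0; last first.
  exact: (max' _ _ Vz z_neq0 (sa_eigen_real z_neq0 dz Dz')).
have tW : t = - c *: W.
  by rewrite scaleNr; apply/eqP; rewrite -subr_eq0 opprK addrC -/z z0.
have DW' : D W = (l^* - m^-1 * c) *: W.
  by rewrite DW tW scalerA mulrN -scalerDl addrC.
exact: (max' _ _ VW W_neq0 (sa_eigen_real W_neq0 dW DW')).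
Qed.

End spectral_theorem.

(** * Functional calculus and traces *)

Section net_limits.
Context {R : realType} {H : hilbert R}.
Implicit Types (f g : {fset H} -> R[i]) (l : R[i]).

Lemma net_limZ k f l : net_lim f l -> net_lim (fun A => k * f A) (k * l).
Proof.
move=> fl e e0; have k0 : 0 < normc k + 1 by rewrite ltr_wpDl ?normc_ge0.
have [|A HA] := fl (e / (normc k + 1)); first by rewrite divr_gt0.
exists A => B /HA h; rewrite -mulrBr Normc.normcM.
rewrite ler_pdivlMr// in h; apply: le_trans h; rewrite mulrC.
by rewrite ler_wpM2l ?normc_ge0// lerDl.
Qed.

Lemma net_limD f g l l' : net_lim f l -> net_lim g l' ->
  net_lim (fun A => f A + g A) (l + l').
Proof.
move=> fl gl e e0; have e20 : 0 < e / 2 by rewrite divr_gt0.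
have [A HA] := fl _ e20; have [A' HA'] := gl _ e20.
exists (fsetU A A') => B; rewrite fsubUset => /andP[/HA h1 /HA' h2].
by rewrite opprD addrACA (le_trans (le_normcD _ _))//; lra.
Qed.

Lemma net_lim_cst l : net_lim (fun _ : {fset H} => l) l.
Proof. by move=> e e0; exists fset0 => B _; rewrite subrr Normc.normc0 ltW. Qed.

Lemma net_lim_sum (I : Type) (s : seq I) (F : I -> {fset H} -> R[i]) (L : I -> R[i]) :
  (forall i, net_lim (F i) (L i)) ->
  net_lim (fun A => \sum_(i <- s) F i A) (\sum_(i <- s) L i).
Proof.
move=> h; elim: s => [|i s ih].
  by under eq_fun do rewrite big_nil; rewrite big_nil; exact: net_lim_cst.
by under eq_fun do rewrite big_cons; rewrite big_cons; exact: net_limD.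
Qed.

Lemma net_lim_cvg (x : H -> R[i]) l : net_lim (fun A => \sum_(e <- A) x e) l <->
  (summability.partial_sum x A @[A --> summability.totally] --> (l : R[i]^o)).
Proof.
have E A : summability.partial_sum x A = \sum_(e <- A) x e.
  by rewrite /summability.partial_sum big_seq_fsetE.
have FF := @summability.totally_filter H.
split=> [h|h e e0].
  apply/(@cvgrPdist_le _ R[i]^o) => e; rewrite ltcE => /andP[/eqP/= e2 e0].
  case: e e2 e0 => e ? /= -> e0.
  have [A HA] := h e e0; exists A => // B /= /HA.
  by rewrite E normC_normc lecR normc_distC.
move/(@cvgrPdist_le _ R[i]^o) : h => /(_ e%:C); rewrite ltcR => /(_ e0) [A _ HA].
by exists A => B /HA; rewrite /= E normC_normc lecR normc_distC.
Qed.

End net_limits.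

Section functional_calculus.
Context {R : realType} {H : hilbert R} (D : unbounded_op H).
Hypothesis sD : self_adjoint D.
Variables (E : set H) (lam : H -> R).
Hypothesis bE : orthonormal_basis E.
Hypothesis lamP : forall e, E e -> eigenvector D (lam e) e.
Implicit Types (f : R -> R[i]) (x y : H).

Lemma hn_basis e : E e -> hn e = 1.
Proof.
move=> Ee; apply/eqP; rewrite -(@eqrXn2 _ 2)// ?hn_ge0// expr1n -Re_ipxx bE.1// eqxx.
by rewrite Re_nat.
Qed.

(** Testing on the basis is enough: an eigenvector for l is orthogonal to every e with [lam e]
    different from l, so f(l) factors out of its Parseval sum. *)
Lemma fun_calc_graphP f x y : fun_calc_graph D f x y <->
  forall e, E e -> ip y e = f (lam e) * ip x e.
Proof.
split=> [h e Ee|h l g dg Dg]; first by have [dE DE] := lamP Ee; exact: h.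
apply: net_lim_unique (parseval y g bE) _.
have -> : (fun A : {fset H} => \sum_(e <- A) coef E y e * (coef E g e)^*) =
    (fun A : {fset H} => f l * \sum_(e <- A) coef E x e * (coef E g e)^*).
  apply/funext => A; rewrite mulr_sumr; apply: eq_bigr => e _.
  have [Ee|nE] := pselect (E e); last by rewrite !supp_coef// !mul0r mulr0.
  rewrite !coefE// h// mulrA.
  have [->//|le] := eqVneq (lam e) l.
  rewrite (eigenvector_ortho sD (conj dg Dg) (lamP Ee)) 1?eq_sym//.
  by rewrite rmorph0 !mulr0.
exact: net_limZ (parseval x g bE).
Qed.

Lemma basis_inj x y : (forall e, E e -> ip x e = ip y e) -> x = y.
Proof.
move=> h; apply/eqP; rewrite -subr_eq0; apply/eqP; apply: bE.2 => e Ee.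
by rewrite ipBl h// subrr.
Qed.

Lemma fun_calcE f x y : fun_calc_graph D f x y ->
  udom (fun_calc D f) x /\ fun_calc D f x = y.
Proof.
move=> g; split; first by exists y.
have := @xgetPex _ (0 : H) [set y | fun_calc_graph D f x y] (ex_intro _ y g).
move=> /= /fun_calc_graphP h; move/fun_calc_graphP : g => g.
by apply: basis_inj => e Ee; rewrite h// g.
Qed.

Lemma fun_calc_basis f e : E e ->
  udom (fun_calc D f) e /\ fun_calc D f e = f (lam e) *: e.
Proof.
move=> Ee; apply: fun_calcE; apply/fun_calc_graphP => g Eg.
rewrite ipZl bE.1//; have [<-//|] := eqVneq e g; by rewrite !mulr0.
Qed.

(** For f bounded on the eigenvalues the coordinates f(l_e) <x, e> are square summable for every x,
    so [fun_calc D f x] is never a default value. *)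
Lemma fun_calc_ip f (K : R) x : 0 <= K -> (forall e, E e -> normc (f (lam e)) <= K) ->
  (forall e, E e -> ip (fun_calc D f x) e = f (lam e) * ip x e) /\
  hn (fun_calc D f x) <= K * hn x.
Proof.
move=> K0 fK.
pose a e : R[i] := if `[< E e >] then f (lam e) * ip x e else 0.
have sa : supp_in E a by move=> e Ee; rewrite /a asboolF.
have ha (A : {fset H}) : \sum_(e <- A) normc (a e) ^+ 2 <= (K * hn x) ^+ 2.
  rewrite exprMn (@le_trans _ _ (\sum_(e <- A) K ^+ 2 * normc (coef E x e) ^+ 2))//.
    apply: ler_sum => e _; rewrite /a /coef; case: asboolP => Ee.
      rewrite Normc.normcM exprMn ler_wpM2r ?sqr_ge0//.
      by rewrite lerXn2r ?nnegrE ?normc_ge0// fK.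
    by rewrite !Normc.normc0 expr0n mulr0.
  rewrite -mulr_sumr ler_wpM2l ?sqr_ge0//; exact: bessel bE.1.
have [y Hy] := riesz_fischer bE.1 sa ha.
have ya e : E e -> ip y e = f (lam e) * ip x e.
  by move=> Ee; rewrite (ip_hnet_osum bE.1 sa Hy Ee) /a asboolT.
have [_ ->] : udom (fun_calc D f) x /\ fun_calc D f x = y.
  by apply: fun_calcE; apply/fun_calc_graphP.
split => //; apply/ler_addgt0Pl => e e0; have [A HA] := Hy e e0.
have h := HA A (fsubset_refl A).
have -> : y = osum a A - (osum a A - y) by rewrite opprB addrC subrK.
rewrite (le_trans (hnB _ _))// addrC lerD//.
rewrite -(@ler_pXn2r _ 2)// ?nnegrE ?hn_ge0 ?mulr_ge0 ?hn_ge0//.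
by rewrite (hn_osum _ bE.1 sa).
Qed.

(** [is_commutator] is a relation. Uniqueness turns the existence of a commutator of b inside an
    algebra into the membership of every commutator of b. *)
Lemma commutator_unique b c c' : is_commutator (abs_op D) b c ->
  is_commutator (abs_op D) b c' -> c = c'.
Proof.
move=> [_ bc hc] [_ bc' hc']; apply: (eq_on_basis bE bc bc') => e Ee.
have [dE _] := fun_calc_basis (fun l => `|l|%:C) Ee.
by rewrite -(hc e dE).2 -(hc' e dE).2.
Qed.

Lemma coef_expansion b x y : bounded_op b ->
  net_lim (fun B => \sum_(e <- B) coef E x e * ip (b e) y) (ip (b x) y).
Proof.
move=> bb; have [c _ adj] := exists_adjoint bb.
rewrite adj; have := hnet_ip (c y) (basis_expansion x bE).
congr net_lim; apply/funext => A; rewrite /osum ip_suml.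
by apply: eq_bigr => e _; rewrite ipZl adj.
Qed.

End functional_calculus.

(** * Trace of a bounded operator times a diagonal one *)

Section trace_formula.
Context {R : realType} {H : hilbert R}.
Variables (E : set H) (bE : orthonormal_basis E).
Variables (kap : H -> R[i]) (S : R).
Hypothesis skap : supp_in E kap.
Hypothesis sumkap : forall A : {fset H}, \sum_(e <- A) normc (kap e) <= S.

Lemma sum_tail (e : R) : 0 < e -> exists A, forall B, fsubset A B ->
  \sum_(e <- fsetD B A) normc (kap e) <= e.
Proof.
move=> e0.
pose W := [set r : R | exists A : {fset H}, r = \sum_(e <- A) normc (kap e)].
have hW : has_sup W.
  split; first by exists (\sum_(e <- (fset0 : {fset H})) normc (kap e)), fset0.
  by exists S => _ [A ->].
have [_ [A ->] HA] := sup_adherent e0 hW.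
exists A => B AB.
have : \sum_(e <- B) normc (kap e) <= sup W.
  by apply: ub_le_sup; [case: hW|exists B].
rewrite (sum_fsetDl _ AB); lra.
Qed.

Lemma normc_sum_kap (c : H -> R[i]) (M : R) (A : {fset H}) : 0 <= M ->
  (forall e, E e -> normc (c e) <= M) ->
  normc (\sum_(e <- A) kap e * c e) <= M * \sum_(e <- A) normc (kap e).
Proof.
move=> M0 cM; rewrite (le_trans (normc_sum _ _ _))// mulr_sumr ler_sum// => e _.
rewrite Normc.normcM mulrC; have [Ee|nE] := pselect (E e).
  by rewrite ler_wpM2r ?normc_ge0// cM.
by rewrite skap// Normc.normc0 !mulr0.
Qed.

(** The terms kap c are split as (kap c / sqrt |kap|) * sqrt |kap|. Both factors are square
    summable, so the sum is an inner product of two vectors and Parseval's identity gives its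
    convergence. *)
Lemma exists_sum (c : H -> R[i]) (M : R) : 0 <= M ->
  (forall e, E e -> normc (c e) <= M) ->
  exists t, net_lim (fun A => \sum_(e <- A) kap e * c e) t.
Proof.
move=> M0 cM.
pose a' e : R[i] := (Num.sqrt (normc (kap e)))%:C.
pose a e : R[i] := kap e * c e / a' e.
have n0 e : 0 <= normc (kap e) := normc_ge0 _.
have sa' : supp_in E a' by move=> e Ee; rewrite /a' skap// Normc.normc0 sqrtr0.
have sa : supp_in E a by move=> e Ee; rewrite /a skap// !mul0r.
have na' e : normc (a' e) ^+ 2 = normc (kap e).
  by rewrite normc_real ger0_norm ?sqrtr_ge0// sqr_sqrtr.
have suma' (A : {fset H}) : \sum_(e <- A) normc (a' e) ^+ 2 <= S.
  by under eq_bigr do rewrite na'; exact: sumkap.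
have [y' Hy'] := riesz_fischer bE.1 sa' suma'.
have [A|y Hy] := @riesz_fischer _ _ E a (M ^+ 2 * S) bE.1 sa.
  rewrite (@le_trans _ _ (\sum_(e <- A) M ^+ 2 * normc (kap e)))//; last first.
    by rewrite -mulr_sumr ler_wpM2l ?sqr_ge0.
  apply: ler_sum => e _; have [Ee|nE] := pselect (E e); last first.
    by rewrite sa// skap// Normc.normc0 expr0n mulr0.
  have [k0|k0] := eqVneq (kap e) 0.
    by rewrite /a k0 !mul0r Normc.normc0 expr0n mulr0.
  rewrite /a !Normc.normcM Normc.normcV !exprMn exprVn na'.
  rewrite -normc_gt0 in k0.
  have -> : normc (kap e) ^+ 2 * normc (c e) ^+ 2 / normc (kap e) =
     normc (c e) ^+ 2 * normc (kap e) by field; rewrite gt_eqF.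
  by rewrite ler_wpM2r// lerXn2r ?nnegrE ?normc_ge0// cM.
exists (ip y y'); have := parseval y y' bE; congr net_lim; apply/funext => A.
apply: eq_bigr => e _; have [Ee|nE] := pselect (E e); last first.
  by rewrite supp_coef// skap// !mul0r.
rewrite !coefE// (ip_hnet_osum bE.1 sa Hy Ee) (ip_hnet_osum bE.1 sa' Hy' Ee).
have [k0|k0] := eqVneq (kap e) 0; first by rewrite /a k0 !mul0r.
rewrite /a conjC_real divfK//.
apply: contra_neq k0 => a0; apply/eqP; rewrite -normc_eq0 -na' a0.
by rewrite Normc.normc0 expr0n.
Qed.

Lemma sum_approx (c : H -> R[i]) (M : R) t (A : {fset H}) (d : R) : 0 <= M ->
  (forall e, E e -> normc (c e) <= M) ->
  net_lim (fun A => \sum_(e <- A) kap e * c e) t ->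
  (forall B, fsubset A B -> \sum_(e <- fsetD B A) normc (kap e) <= d) ->
  normc (t - \sum_(e <- A) kap e * c e) <= M * d.
Proof.
move=> M0 cM ht hd; apply: (net_lim_le ht); exists A => B AB.
rewrite (sum_fsetDl _ AB) addrAC subrr add0r.
rewrite (le_trans (normc_sum_kap _ M0 cM))// ler_wpM2l//; exact: hd.
Qed.

(** In another basis F, exchanging sums writes the partial trace over G as the sum over e of kap e
    times the partial Parseval sum [g G e] of <b e, e>. These are bounded by M uniformly in G, so
    the tail of kap is uniformly negligible and Parseval's identity settles the finitely many
    remaining e. *)
Lemma is_trace_diag (b K : H -> H) (M : R) t : bounded_op b ->
  0 <= M -> (forall x, hn (b x) <= M * hn x) ->
  (forall x e, E e -> ip (K x) e = kap e * ip x e) ->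
  net_lim (fun A => \sum_(e <- A) kap e * ip (b e) e) t ->
  is_trace (b \o K) t.
Proof.
move=> bb M0 bM hK ht F bF; apply/net_lim_cvg.
pose g (G : {fset H}) e := \sum_(f <- G) coef F (b e) f * (coef F e f)^*.
have hE1 e : E e -> hn e = 1 by exact: hn_basis.
have gM G e : E e -> normc (g G e) <= M.
  move=> Ee; rewrite /g -(ip_osum_osum _ bF.1)//; try exact: supp_coef.
  have B x : hn (osum (coef F x) G) <= hn x.
    rewrite -(@ler_pXn2r _ 2)// ?nnegrE ?hn_ge0//.
    by rewrite (hn_osum _ bF.1 (@supp_coef _ _ F x)); exact: bessel bF.1.
  rewrite (le_trans (cauchy_schwarz _ _))// -[M]mulr1 ler_pM ?hn_ge0//.
    by rewrite (le_trans (B _))// (le_trans (bM _))// hE1// mulr1.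
  by rewrite (le_trans (B _))// hE1.
have cM e : E e -> normc (ip (b e) e) <= M.
  move=> Ee; rewrite (le_trans (cauchy_schwarz _ _))// (hE1 e Ee) mulr1.
  by rewrite (le_trans (bM _))// (hE1 e Ee) mulr1.
have SG G : net_lim (fun B => \sum_(e <- B) kap e * g G e)
   (\sum_(f <- G) (if `[< F f >] then ip ((b \o K) f) f else 0)).
  have -> : (fun B : {fset H} => \sum_(e <- B) kap e * g G e) =
     (fun B => \sum_(f <- G) (if `[< F f >] then
        \sum_(e <- B) coef E (K f) e * ip (b e) f else 0)).
    apply/funext => B; rewrite /g.
    under eq_bigr do rewrite mulr_sumr.
    rewrite exchange_big/=; apply: eq_bigr => f _; rewrite /coef.
    case: asboolP => Ff; last by rewrite big1// => e _; rewrite mul0r mulr0.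
    apply: eq_bigr => e _; case: asboolP => Ee; last by rewrite skap// !mul0r.
    by rewrite hK// -ipC mulrAC mulrA.
  apply: net_lim_sum => f; case: asboolP => Ff; last exact: net_lim_cst.
  exact: coef_expansion.
move=> d d0.
(* Each of the two tails costs at most d / 4 and the finite part d / 2; M + 1 allows M = 0. *)
have d1 : 0 < d / (4 * (M + 1)) by rewrite divr_gt0// mulr_gt0// ltr_wpDl.
have [A HA] := sum_tail d1.
have [||G0 HG] := (@net_lim_sum R H H A (fun e G => kap e * g G e)
    (fun e => kap e * ip (b e) e) _ (d / 2)).
- by move=> e; apply: net_limZ; exact: parseval.
- by rewrite divr_gt0.
exists G0 => G /HG h1.
have h2 := sum_approx M0 (gM G) (SG G) HA.
have h3 := sum_approx M0 cM ht HA.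
set s := \sum_(e <- G) _ in h2 *.
set s1 := \sum_(e <- A) kap e * g G e in h1 h2.
set s2 := \sum_(e <- A) _ in h1 h3.
have -> : s - t = (s - s1) + (s1 - s2) - (t - s2) by ring.
have h4 : M * (d / (4 * (M + 1))) <= d / 4.
  have -> : M * (d / (4 * (M + 1))) = (M / (M + 1)) * (d / 4).
    by field; rewrite gt_eqF// ltr_wpDl.
  by rewrite ler_piMl ?divr_ge0 ?(ltW d0)// ler_pdivrMr ?ltr_wpDl// mul1r lerDl.
apply: (le_trans (normcB _ _)); have := le_normcD (s - s1) (s1 - s2); lra.
Qed.

End trace_formula.

Section trace_uniqueness.
Context {R : realType} {H : hilbert R}.

Lemma trace_eq (T : H -> H) t : is_trace T t -> trace T = t.
Proof.
(* A basis must exist, as [is_trace] would otherwise hold vacuously for every value. *)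
move=> ht; have [E bE] := @exists_basis R H.
rewrite /trace; have /= h := @xgetPex _ (0 : R[i]) [set z | is_trace T z] (ex_intro _ t ht).
exact: net_lim_unique ((net_lim_cvg _ _).2 (h E bE)) ((net_lim_cvg _ _).2 (ht E bE)).
Qed.

End trace_uniqueness.

(** * Summability of the eigenvalues of a diagonal trace class operator *)

Section trace_class_diagonal.
Context {R : realType} {H : hilbert R}.
Implicit Types (x y : H).

(** Polarisation: the sesquilinear form P vanishes on the diagonal. At x + y this makes P
    antisymmetric, at x + i y symmetric, so P = 0. *)
Lemma positive_sym (S : H -> H) : linear S -> (forall x, 0 <= ip (S x) x) ->
  forall x y, ip (S x) y = ip x (S y).
Proof.
move=> lS S0; pose P x y := ip (S x) y - ip x (S y).
have Pxx x : P x x = 0.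
  have := S0 x; rewrite lecE /= => /andP[/eqP i0 _].
  rewrite /P [ip x _]ipC; apply: complex_ext; rewrite ?ReD ?ImD ?ReN ?ImN.
    by rewrite Re_conj subrr.
  by move: i0; case: (ip (S x) x) => u v /= ->; rewrite oppr0 subr0.
have P1 x y : P x y + P y x = 0.
  have := Pxx (x + y); have := Pxx x; have := Pxx y; rewrite /P.
  rewrite (linear_opD _ _ lS) !ipDl !ipDr => h1 h2 h3.
  by rewrite -h3 -[RHS]subr0 -{1}h1 -[RHS]subr0 -{1}h2; ring.
have P2 x y : P x y = P y x.
  have := Pxx (x + 'i *: y); have := Pxx x; have := Pxx y; rewrite /P.
  rewrite (linear_opD _ _ lS) (linear_opZ _ _ lS) !ipDl !ipDr !ipZl !ipZr => h1 h2 h3.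
  have i0 : 'i != 0 :> R[i] by rewrite -normc_gt0 /= expr0n expr1n add0r sqrtr1.
  have ci : ('i : R[i])^* = - 'i by apply: complex_ext => /=; rewrite ?oppr0.
  rewrite ci in h3; apply: (mulfI i0).
  have E : 'i * 'i = -1 :> R[i] by rewrite -expr2 sqr_i.
  apply/eqP; rewrite -subr_eq0; apply/eqP.
  rewrite -[RHS]oppr0 -h3 -[LHS]subr0 -{1}h2 -[LHS]subr0 -{1}(mulr0 (- ('i * 'i) : R[i])) -{1}h1.
  ring.
move=> x y; apply/eqP; rewrite -subr_eq0 -/(P x y).
have := P1 x y; rewrite -P2 -mulr2n -mulr_natr => /eqP.
by rewrite mulf_eq0 pnatr_eq0 orbF.
Qed.

Lemma esum_fset_le (F : set H) (r : H -> R) : (forall f, 0 <= r f) ->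
  (\esum_(f in F) (r f)%:E < +oo)%E ->
  exists C : R, forall G : {fset H},
    \sum_(f <- G) (if `[< F f >] then r f else 0) <= C.
Proof.
move=> r0 fin; exists (fine (\esum_(f in F) (r f)%:E)%E) => G.
rewrite -lee_fin fineK; last first.
  by rewrite ge0_fin_numE// esum_ge0// => f _; rewrite lee_fin.
pose G' := [fset f in G | `[< F f >]]%fset.
apply: ereal_sup_ubound; exists [set` G'].
  split; first exact: finite_fset.
  by move=> f /=; rewrite !inE => /andP[_ /asboolP].
rewrite fsbig_finite ?finite_fset//= set_fsetK.
rewrite -sumEFin (@big_fsetID _ _ _ _ (fun f => `[< F f >]) G)/=.
rewrite [X in (_ + X)%E]big_seq [X in (_ + X)%E]big1 ?adde0; last first.
  by move=> f; rewrite !inE => /andP[_ /negbTE ->].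
rewrite big_seq [RHS]big_seq; apply: eq_bigr => f.
by rewrite !inE => /andP[_ ->].
Qed.

Variables (E : set H) (k : H -> R) (K : H -> H).
Hypothesis bE : orthonormal_basis E.
Hypothesis k0 : forall e, 0 <= k e.
Hypothesis Ke : forall e, E e -> K e = (k e)%:C *: e.

(* S^2 e = k^2 e gives S v = - k v for v = S e - k e, and S >= 0 forces
   v = 0. *)
Lemma modulus_diag (S : H -> H) e : is_modulus K S -> E e -> 0 < k e ->
  S e = (k e)%:C *: e.
Proof.
move=> [bS posS [K' adj SS]] Ee ke; have [lS _] := bS.
have SSe : S (S e) = (k e ^+ 2)%:C *: e.
  apply: (basis_inj bE) => f Ef.
  have -> : S (S e) = K' (K e) by have := congr1 (fun h => h e) SS.
  rewrite ipC -adj Ke// Ke// ipZl ipZr conjC_real bE.1// ipZl bE.1// [f == e]eq_sym.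
  case: eqP => [->|_]; last by rewrite !mulr0 rmorph0.
  by rewrite !mulr1 -rmorphM conjC_real -expr2.
pose v := S e - (k e)%:C *: e.
suff v0 : v = 0 by apply/eqP; rewrite -subr_eq0 -/v v0.
have Sv : S v = - (k e)%:C *: v.
  rewrite /v (linear_opB _ _ lS) (linear_opZ _ _ lS) SSe scalerBr !scaleNr opprK.
  rewrite scalerA -rmorphM -expr2 addrC; congr (_ + _).
have := posS v; rewrite Sv ipZl ipxx mulNr -rmorphM -rmorphN ler0c oppr_ge0.
rewrite pmulr_rle0// => h; apply/eqP; rewrite -hn_eq0 -sqrf_eq0.
by rewrite eq_le h sqr_ge0.
Qed.

(* The span of the e in A with k e > 0 is stable under the symmetric operator S,
   so its orthogonal complement only adds a non-negative term. *)
Lemma modulus_ge (S : H -> H) f (A : {fset H}) : is_modulus K S ->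
  \sum_(e <- A) (if `[< E e >] then k e else 0) * normc (ip f e) ^+ 2 <=
  complex.Re (ip (S f) f).
Proof.
move=> mS; have [bS posS _] := mS; have [lS _] := bS.
have symS := positive_sym lS posS.
pose a e : R[i] := if `[< E e >] && (0 < k e) then ip f e else 0.
have sa : supp_in E a by move=> e Ee; rewrite /a asboolF.
pose g := osum a A; pose h := f - g.
have ge e : e \in A -> E e -> 0 < k e -> ip g e = ip f e.
  by move=> eA Ee ke; rewrite (ip_osum _ bE.1 sa Ee) eA /a asboolT//= ke.
have Sg : S g = \sum_(e <- A) ((k e)%:C * a e) *: e.
  rewrite /g /osum (linear_op_sum _ _ lS); apply: eq_bigr => e _.
  rewrite (linear_opZ _ _ lS) /a; case: ifP => [/andP[/asboolP Ee ke]|_].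
    by rewrite (modulus_diag mS)// scalerA mulrC.
  by rewrite scale0r mulr0 scale0r.
have Sgh : ip (S g) h = 0.
  rewrite Sg ip_suml big_seq big1// => e eA; rewrite ipZl /a.
  case: ifP => [/andP[/asboolP Ee ke]|_]; last by rewrite mulr0 mul0r.
  by rewrite [ip e h]ipC /h ipBl ge// subrr rmorph0 mulr0.
have Sgg : ip (S g) g = (\sum_(e <- A) (if `[< E e >] then k e else 0) * normc (ip f e) ^+ 2)%:C.
  rewrite Sg ip_suml rmorph_sum/= big_seq [RHS]big_seq; apply: eq_bigr => e eA.
  rewrite ipZl /a; case: asboolP => [Ee|_] /=; last by rewrite mulr0 !mul0r rmorph0.
  have := k0 e; rewrite le_eqVlt => /predU1P[<-|ke].
    by rewrite ltxx rmorph0 mulr0 !mul0r.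
  by rewrite ke rmorphM/= -mulrA [ip e g]ipC ge// mulC_conj.
have fE : f = g + h by rewrite /h addrC subrK.
clearbody h g.
have -> : ip (S f) f = ip (S g) g + ip (S h) h.
  rewrite fE (linear_opD _ _ lS) !ipDl !ipDr Sgh addr0 [ip (S h) g]symS.
  by rewrite [ip h _]ipC Sgh rmorph0 add0r.
rewrite Sgg ReD /= lerDl.
by have := posS h; rewrite lecE => /andP[].
Qed.

(** The basis F provided by [trace_class] has no relation to E. Sum [modulus_ge] over f in a finite
    subset G of F and exchange the sums; as G grows, Parseval's identity in F turns the weight of
    each e into |e|^2 = 1. *)
Lemma trace_class_diag_summable : trace_class K -> exists C : R,
  forall A : {fset H}, \sum_(e <- A) (if `[< E e >] then k e else 0) <= C.
Proof.
move=> [bK [S [F [mS bF fin]]]].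
have [_ posS _] := mS.
have r0 f : 0 <= complex.Re (ip (S f) f) by have := posS f; rewrite lecE => /andP[].
have [C HC] := esum_fset_le r0 fin.
exists C => A; set w := fun e => if `[< E e >] then k e else 0.
have w0 e : 0 <= w e by rewrite /w; case: ifP.
have hG (G : {fset H}) : \sum_(e <- A) w e * \sum_(f <- G) normc (coef F e f) ^+ 2 <= C.
  apply: le_trans (HC G); under eq_bigr do rewrite mulr_sumr.
  rewrite exchange_big/=; apply: ler_sum => f _; rewrite /coef.
  case: asboolP => Ff; last first.
    by rewrite big1// => e _; rewrite Normc.normc0 expr0n mulr0.
  apply: le_trans (modulus_ge f A mS); apply: ler_sum => e _.
  by rewrite ipC normc_conj.
have nl : net_lim (fun G : {fset H} => \sum_(e <- A) (w e)%:C *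
    \sum_(f <- G) coef F e f * (coef F e f)^*) (\sum_(e <- A) (w e)%:C * ip e e).
  by apply: net_lim_sum => e; apply: net_limZ; exact: parseval.
apply/ler_addgt0Pl => d d0; have [G HG] := nl d d0.
have := le_trans (ler_normc_Re _) (HG G (fsubset_refl G)).
have -> : \sum_(e <- A) (w e)%:C * (\sum_(f <- G) coef F e f * (coef F e f)^*) =
    (\sum_(e <- A) w e * \sum_(f <- G) normc (coef F e f) ^+ 2)%:C.
  rewrite rmorph_sum; apply: eq_bigr => e _; rewrite rmorphM rmorph_sum /=.
  by congr (_ * _); apply: eq_bigr => f _; rewrite mulC_conj.
have -> : \sum_(e <- A) (w e)%:C * ip e e = (\sum_(e <- A) w e)%:C.
  rewrite rmorph_sum; apply: eq_bigr => e _; rewrite /w.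
  by case: asboolP => Ee; rewrite ?rmorph0 ?mul0r// bE.1// eqxx mulr1.
rewrite ReD ReN /= ler_norml => /andP[+ _].
have := hG G; lra.
Qed.

End trace_class_diagonal.

(** * Heat traces and zeta functions *)

Section finite_kernel.
Context {R : realType} {H : hilbert R} (D : unbounded_op H).
Variables (l : R[i]) (T : H -> H).
Hypothesis rT : is_resolvent D l T.
Hypothesis cT : compact_op T.

(** On the kernel of D the operator - l T is the identity. For an orthonormal sequence f there, two
    images under T within 1 / (2 |l|) of a cluster point give |f n - f n'| <= 1, whereas this
    distance is the square root of 2. *)
Lemma finite_ortho_kernel (E : set H) : ortho E ->
  (forall e, E e -> eigenvector D 0 e) -> finite_set E.
Proof.
move=> oE EP; apply: contrapT => /infiniteP/pcard_leP[f].
have Ef n : E (f n) by exact: funS.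
have fn1 n : hn (f n) = 1.
  apply/eqP; rewrite -(@eqrXn2 _ 2)// ?hn_ge0// expr1n -Re_ipxx oE// eqxx.
  by rewrite Re_nat.
have [[lT _] _ _] := rT.
have Tf n : - l *: T (f n) = f n.
  have [dn Dn] := EP _ (Ef n); have [_ _ /(_ _ dn)] := rT.
  by rewrite Dn scale0r sub0r -scaleNr (linear_opZ _ _ lT).
have l0 : 0 < normc l.
  rewrite normc_gt0; apply/eqP => l0; have := fn1 0%N.
  by rewrite -Tf l0 oppr0 scale0r hn0 => /eqP; rewrite eq_sym oner_eq0.
have [|y Hy] := @compact_cluster _ _ _ cT (fun n => f n) _.
  by move=> n; rewrite fn1.
have e0 : 0 < (2 * normc l)^-1 by rewrite invr_gt0 mulr_gt0.
have [n _ hn1] := Hy _ 0%N e0.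
have [n' nn' hn2] := Hy _ n.+1 e0.
have : hn (f n - f n') <= 1.
  rewrite -(Tf n) -(Tf n') -scalerBr hnZ normcN.
  have -> : T (f n) - T (f n') = (T (f n) - y) - (T (f n') - y).
    by rewrite opprB addrA subrK.
  rewrite -ler_pdivlMl// mulr1.
  apply: (le_trans (hnB _ _)).
  have -> : (normc l)^-1 = (2 * normc l)^-1 + (2 * normc l)^-1.
    by field; rewrite gt_eqF.
  by rewrite lerD// ltW.
rewrite -(@ler_pXn2r _ 2)// ?nnegrE ?hn_ge0//.
rewrite hn_sqrB !fn1 oE// (_ : f n == f n' = false); first by rewrite /=; lra.
apply/eqP => ff; have /(_ (mem_set I) (mem_set I) ff) nE := @inj _ _ _ f n n'.
by move: nn'; rewrite nE ltnn.
Qed.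

End finite_kernel.

Lemma abs_powNE (R : realType) (z : R[i]) (l : R) :
  abs_powN z l = if l == 0 then 0 else cexp (- z * (ln `|l|)%:C).
Proof.
rewrite /abs_powN; case: eqP => // _; rewrite /cexp ReM ImM ReN ImN /=.
rewrite !mulr0 subr0 add0r !mulNr cosN sinN.
by apply: complex_ext; rewrite ?ReM ?ImM/=; ring.
Qed.

Section spectral_sums.
Context {R : realType} {H : hilbert R} (D : unbounded_op H).
Hypothesis sD : self_adjoint D.
Variables (E : set H) (lam : H -> R).
Hypothesis bE : orthonormal_basis E.
Hypothesis lamP : forall e, E e -> eigenvector D (lam e) e.
Variable Ker : {fset H}.
Hypothesis KerP : forall e, e \in Ker <-> E e /\ lam e = 0.

Definition nonker e := `[< E e >] && (lam e != 0).

Definition pw (q : R) e : R :=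
  if nonker e then expR (- (q * ln `|lam e|)) else 0.

Variable p : nat.
Hypothesis psum : forall q, p%:R < q ->
  exists S, forall A : {fset H}, \sum_(e <- A) pw q e <= S.
Variables (b : H -> H) (M : R).
Hypothesis bb : bounded_op b.
Hypothesis M0 : 0 <= M.
Hypothesis bM : forall x, hn (b x) <= M * hn x.

Local Notation c := (fun e => ip (b e) e).

Definition kz (z : R[i]) e : R[i] :=
  if nonker e then cexp (- z * (ln `|lam e|)%:C) else 0.

Definition kth (u : R) e : R[i] :=
  if nonker e then (expR (- (`|lam e| * expR (- u))))%:C else 0.

Lemma nonkerE e : E e -> nonker e = (lam e != 0).
Proof. by move=> Ee; rewrite /nonker asboolT. Qed.

Lemma nonker_supp e : ~ E e -> nonker e = false.
Proof. by move=> Ee; rewrite /nonker asboolF. Qed.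

Lemma pw_ge0 q e : 0 <= pw q e.
Proof. by rewrite /pw; case: ifP => // _; exact: expR_ge0. Qed.

Lemma normc_kz z e : normc (kz z e) = pw (complex.Re z) e.
Proof.
rewrite /kz /pw; case: ifP => _; last by rewrite Normc.normc0.
by rewrite normc_cexp_lin ReN mulNr.
Qed.

(** With s = t |l| and t = e^{-u}, [expRN_le_pow] reads e^{-t|l|} <= (q / e)^q t^{-q} |l|^{-q}: this
    is how p+ summability bounds the heat trace. *)
Lemma normc_kth u e q : 0 < q ->
  normc (kth u e) <= expR (q * (ln q - 1)) * expR (q * u) * pw q e.
Proof.
move=> q0; rewrite /kth /pw; case: ifP => [/andP[_ l0]|_]; last first.
  by rewrite Normc.normc0 mulr0.
have lp : 0 < `|lam e| by rewrite normr_gt0.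
rewrite normc_real ger0_norm ?expR_ge0//.
apply: (le_trans (expRN_le_pow q0 _)); first by rewrite mulr_gt0 ?expR_gt0.
rewrite -mulrA ler_wpM2l ?expR_ge0// -expRD ler_expR lnM ?posrE ?expR_gt0//.
by rewrite expRK le_eqVlt; apply/orP; left; apply/eqP; ring.
Qed.

Lemma supp_kz z : supp_in E (kz z).
Proof. by move=> e Ee; rewrite /kz nonker_supp. Qed.

Lemma supp_kth u : supp_in E (kth u).
Proof. by move=> e Ee; rewrite /kth nonker_supp. Qed.

Lemma normc_c e : E e -> normc (c e) <= M.
Proof.
move=> Ee; rewrite (le_trans (cauchy_schwarz _ _))// (hn_basis bE Ee) mulr1.
by rewrite (le_trans (bM _))// (hn_basis bE Ee) mulr1.
Qed.

Lemma sum_kth_le u q (A : {fset H}) : 0 < q ->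
  \sum_(e <- A) normc (kth u e) <=
  expR (q * (ln q - 1)) * expR (q * u) * \sum_(e <- A) pw q e.
Proof.
by move=> q0; rewrite mulr_sumr; apply: ler_sum => e _; exact: normc_kth.
Qed.

Lemma sum_kth_bounded u : exists S, forall A : {fset H},
  \sum_(e <- A) normc (kth u e) <= S.
Proof.
have pq : p%:R < p%:R + 1 :> R by rewrite ltrDl.
have q0 : 0 < p%:R + 1 :> R by rewrite ltr_wpDl.
have [S HS] := psum pq.
exists (expR ((p%:R + 1) * (ln (p%:R + 1) - 1)) * expR ((p%:R + 1) * u) * S) => A.
apply: (le_trans (sum_kth_le u A q0)).
by rewrite ler_wpM2l ?mulr_ge0 ?expR_ge0//; exact: HS.
Qed.

Lemma exists_theta : exists tu : R -> R[i], forall u,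
  net_lim (fun A => \sum_(e <- A) kth u e * c e) (tu u).
Proof.
have h u : exists t, net_lim (fun A => \sum_(e <- A) kth u e * c e) t.
  have [S HS] := sum_kth_bounded u.
  exact: (exists_sum bE (supp_kth u) HS M0 normc_c).
by have [tu Htu] := choice h; exists tu.
Qed.

Variable tu : R -> R[i].
Hypothesis tuP : forall u, net_lim (fun A => \sum_(e <- A) kth u e * c e) (tu u).

(** The bound is t^{-q} on the whole half-line: q close to p matters as t -> 0, and large q gives
    the decay as t -> +oo. *)
Lemma theta_growth q : p%:R < q -> exists K : R, forall u,
  normc (tu u) <= K * expR (q * u).
Proof.
move=> pq; have q0 : 0 < q by rewrite (le_lt_trans _ pq).
have [S HS] := psum pq.
exists (M * (expR (q * (ln q - 1)) * S)) => u.
rewrite -[tu u]subr0; apply: (net_lim_le (tuP u)); exists fset0 => B _.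
rewrite subr0 (le_trans (normc_sum_kap (supp_kth u) B M0 normc_c))//.
rewrite -mulrA ler_wpM2l// (le_trans (sum_kth_le u B q0))//.
by rewrite -!mulrA ler_wpM2l ?expR_ge0// mulrC ler_wpM2r ?expR_ge0.
Qed.

Lemma zeta_sum z : p%:R < complex.Re z ->
  net_lim (fun A => \sum_(e <- A) kz z e * c e) (trace (b \o abs_powN_op D z)).
Proof.
move=> pz; have [S HS] := psum pz.
have HS' (A : {fset H}) : \sum_(e <- A) normc (kz z e) <= S.
  by under eq_bigr do rewrite normc_kz; exact: HS.
have [t ht] := exists_sum bE (supp_kz z) HS' M0 normc_c.
rewrite (@trace_eq _ _ _ t)//.
have S0 : 0 <= S by have := HS fset0; rewrite big_seq_fset0.
(* A sum over a single basis vector bounds each |l|^{-z} by S. *)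
have nS e : E e -> normc (abs_powN z (lam e)) <= S.
  move=> Ee; have := HS' (fset1 e); rewrite big_seq_fset1.
  by rewrite /kz nonkerE// abs_powNE; case: eqP.
apply: (is_trace_diag bE (supp_kz z) HS' bb M0 bM _ ht) => x e Ee.
rewrite (fun_calc_ip sD bE lamP x S0 nS).1//; congr (_ * _).
by rewrite abs_powNE /kz nonkerE//; case: eqP.
Qed.

Definition k0 : R[i] := \sum_(e <- Ker) c e.

Lemma heat_trace u : trace (b \o heat_op D (expR (- u))) = tu u + k0.
Proof.
pose kk e : R[i] := if `[< E e >] && (lam e == 0) then 1 else 0.
pose kap e : R[i] := kth u e + kk e.
have sk : supp_in E kk by move=> e Ee; rewrite /kk asboolF.
have skap : supp_in E kap.
  by move=> e Ee; rewrite /kap supp_kth// sk// addr0.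
have kkK e : kk e = if e \in Ker then 1 else 0.
  rewrite /kk; case: ifPn => [/andP[/asboolP Ee /eqP l0]|nK].
    by rewrite (KerP e).2.
  case: ifPn => // /KerP[Ee l0]; move: nK.
  by rewrite asboolT// l0 eqxx.
have sumK (F : H -> R[i]) (B : {fset H}) : fsubset Ker B ->
    \sum_(e <- B) kk e * F e = \sum_(e <- Ker) F e.
  move=> KB; rewrite (sum_fsetDl _ KB) [X in _ + X]big_seq [X in _ + X]big1 ?addr0.
    rewrite big_seq [RHS]big_seq; apply: eq_bigr => e eK.
    by rewrite kkK eK mul1r.
  by move=> e; rewrite inE => /andP[/negbTE eK _]; rewrite kkK eK mul0r.
have [S HS] := sum_kth_bounded u.
have HS' (A : {fset H}) : \sum_(e <- A) normc (kap e) <= S + \sum_(e <- Ker) 1.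
  apply: (@le_trans _ _ (\sum_(e <- A) (normc (kth u e) + normc (kk e)))).
    by apply: ler_sum => e _; exact: le_normcD.
  rewrite big_split/= lerD//.
  apply: (@le_trans _ _ (\sum_(e <- fsetU Ker A) normc (kk e))).
    rewrite (sum_fsetDl _ (fsubsetUr Ker A)) lerDl sumr_ge0// => e _.
    exact: normc_ge0.
  rewrite (sum_fsetDl _ (fsubsetUl Ker A)) [X in _ + X]big_seq.
  rewrite [X in _ + X]big1 ?addr0.
    rewrite big_seq [leRHS]big_seq; apply: ler_sum => e eK.
    by rewrite kkK eK Normc.normc1.
  by move=> e; rewrite inE => /andP[/negbTE eK _]; rewrite kkK eK Normc.normc0.
apply: trace_eq.
have f1 e : E e -> normc ((expR (- (expR (- u) * `|lam e|)))%:C) <= 1.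
  by move=> Ee; rewrite normc_real ger0_norm ?expR_ge0.
apply: (is_trace_diag bE skap HS' bb M0 bM).
  move=> x e Ee.
  rewrite (@fun_calc_ip _ _ _ sD _ _ bE lamP (fun l => (expR (- (expR (- u) * `|l|)))%:C) 1 x ler01 f1).1//.
  congr (_ * _); rewrite /kap /kth /kk nonkerE// asboolT//=.
  have [->|l0] := eqVneq (lam e) 0; last by rewrite addr0 mulrC.
  by rewrite add0r normr0 mulr0 oppr0 expR0.
have -> : (fun A : {fset H} => \sum_(e <- A) kap e * c e) =
  (fun A => \sum_(e <- A) kth u e * c e + \sum_(e <- A) kk e * c e).
  apply/funext => A; rewrite -big_split/=; apply: eq_bigr => e _.
  by rewrite mulrDl.
apply: net_limD (tuP u) _ => d d0; exists Ker => B KB.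
by rewrite sumK// subrr Normc.normc0 ltW.
Qed.

Lemma theta_mellin z : measurable_C tu -> p%:R < complex.Re z ->
  laplace tu z = gammac z * trace (b \o abs_powN_op D z).
Proof.
move=> mtu pz; set x := complex.Re z in pz.
pose q1 := (p%:R + x) / 2; pose q2 := x + 1.
have pq1 : p%:R < q1 by rewrite /q1; lra.
have q1x : q1 < x by rewrite /q1; lra.
have xq2 : x < q2 by rewrite ltrDl.
have pq2 : p%:R < q2 by rewrite (lt_trans pz).
have q10 : 0 < q1 by rewrite (le_lt_trans _ pq1).
have q20 : 0 < q2 by rewrite (le_lt_trans _ pq2).
have x0 : 0 < x by rewrite (le_lt_trans _ pz).
have [K1 HK1] := theta_growth pq1; have [K2 HK2] := theta_growth pq2.
have zq : q1 < complex.Re z < q2 by rewrite -/x q1x.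
apply: (laplace_dirichlet_series mtu _ zq) => //.
  exact: (laplace_dom_growth mtu zq HK1 HK2).
move=> d d0.
have [S1 HS1] := psum pq1; have [S2 HS2] := psum pq2; have [S3 HS3] := psum pz.
(* w dominates the weights of both growth rates and of zeta_b(z), so that one finite set A serves
   the three approximations. *)
pose w e := pw q1 e + pw q2 e + pw x e.
have w0 e : 0 <= w e by rewrite /w !addr_ge0 ?pw_ge0.
have w1 e : pw q1 e <= w e by rewrite /w -addrA lerDl addr_ge0 ?pw_ge0.
have w2 e : pw q2 e <= w e by rewrite /w addrAC lerDr addr_ge0 ?pw_ge0.
have w3 e : pw x e <= w e by rewrite /w lerDr addr_ge0 ?pw_ge0.
pose C1 := expR (q1 * (ln q1 - 1)); pose C2 := expR (q2 * (ln q2 - 1)).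
have C10 : 0 < C1 := expR_gt0 _.
have C20 : 0 < C2 := expR_gt0 _.
pose Z := (M + 1) * (C1 + C2 + 1).
have Z0 : 0 < Z by rewrite mulr_gt0// ?ltr_wpDl// addr_ge0// ltW.
have [A HA] : exists A : {fset H}, forall B, fsubset A B ->
    \sum_(e <- fsetD B A) w e <= d / Z.
  have HS (A : {fset H}) : \sum_(e <- A) normc ((w e)%:C) <= S1 + S2 + S3.
    under eq_bigr do rewrite normc_real ger0_norm//.
    by rewrite /w !big_split/= !lerD.
  have [|A HA] := sum_tail HS (e := d / Z); first by rewrite divr_gt0.
  exists A => B /HA; under eq_bigr do rewrite normc_real ger0_norm//.
  by [].
have dZ : M * ((C1 + C2 + 1) * (d / Z)) <= d.
  have -> : M * ((C1 + C2 + 1) * (d / Z)) = d * (M / (M + 1)).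
    by rewrite /Z; field; rewrite !gt_eqF ?ltr_wpDl// addr_ge0// ltW.
  by rewrite ler_piMr ?(ltW d0)// ler_pdivrMr ?ltr_wpDl// mul1r lerDl.
have dZ0 : 0 <= d / Z by rewrite divr_ge0 ?ltW.
(* Vectors outside [nonker] get the coefficient 0; the value 1 merely makes all the l positive. *)
exists H, A, (fun e => if nonker e then c e else 0),
  (fun e => if nonker e then `|lam e| else 1).
have fE u : \sum_(e <- A) (if nonker e then c e else 0) *
    (expR (- ((if nonker e then `|lam e| else 1) * expR (- u))))%:C =
    \sum_(e <- A) kth u e * c e.
  apply: eq_bigr => e _; rewrite /kth; case: ifP => _; first by rewrite mulrC.
  by rewrite !mul0r.
have tail q C u : 0 < q -> C = expR (q * (ln q - 1)) -> (forall e, pw q e <= w e) ->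
    C <= C1 + C2 + 1 ->
    normc (tu u - \sum_(e <- A) kth u e * c e) <= d * expR (q * u).
  move=> q0 CE wq CC.
  apply: (le_trans (sum_approx (supp_kth u) M0 normc_c (tuP u)
      (d := C * expR (q * u) * (d / Z)) _)).
    move=> B AB; apply: (le_trans (sum_kth_le u _ q0)); rewrite -CE.
    rewrite ler_wpM2l ?mulr_ge0 ?expR_ge0 ?CE ?expR_ge0//.
    by apply: le_trans (HA B AB); exact: ler_sum.
  have -> : M * (C * expR (q * u) * (d / Z)) = (M * (C * (d / Z))) * expR (q * u).
    by ring.
  rewrite ler_wpM2r ?expR_ge0//; apply: le_trans dZ.
  by rewrite ler_wpM2l// ler_wpM2r.
split.
- by move=> e; rewrite /nonker; case: ifP => [/andP[_]|_]; rewrite ?normr_gt0.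
- move=> u; rewrite fE; apply: (tail q1 C1) => //; lra.
- move=> u; rewrite fE; apply: (tail q2 C2) => //; lra.
have -> : \sum_(e <- A) (if nonker e then c e else 0) *
    cexp (- z * (ln (if nonker e then `|lam e| else 1))%:C) =
    \sum_(e <- A) kz z e * c e.
  apply: eq_bigr => e _; rewrite /kz; case: ifP => _; first by rewrite mulrC.
  by rewrite !mul0r.
apply: (le_trans (sum_approx (supp_kz z) M0 normc_c (zeta_sum pz)
      (d := d / Z) _)).
  move=> B AB; under eq_bigr do rewrite normc_kz.
  by apply: le_trans (HA B AB); exact: ler_sum.
apply: le_trans dZ; rewrite ler_wpM2l// ler_peMl//; lra.
Qed.

End spectral_sums.

(** * From the heat expansion to the hypotheses of the continuation theorem *)

Section heat_expansion.
Context {R : realType}.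

(** theta arises as a limit over finite sets, which says nothing of measurability. It is recovered
    as e^{pu} phi(e^{-u}) - k0 from the continuity of phi. *)
Lemma measurable_expansion_ker (p : nat) (phi : R -> R[i]) (tr tu : R -> R[i]) (k0 : R[i]) :
  (forall t, phi t = (t ^+ p)%:C * tr t) ->
  {in `]0, +oo[%R, continuous (phi : R -> R[i]^o)} ->
  (forall u, tr (expR (- u)) = tu u + k0) ->
  measurable_C tu.
Proof.
move=> phiE cphi trE.
have E u : tu u = (expR (p%:R * u))%:C * phi (expR (- u)) + - k0.
  rewrite phiE trE mulrA -rmorphM -expRM_natl -expRD.
  have -> : p%:R * u + p%:R * - u = 0 by ring.
  by rewrite expR0 rmorph1 mul1r addrK.
have cc (g : R[i] -> R) (gD : forall x y, g x - g y = g (x - y))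
    (gN : forall x, `|g x| <= normc x) :
    continuous (fun u => g (phi (expR (- u)))).
  move=> u; apply/cvgrPdist_lt => e e0.
  have h : {for expR (- u), continuous (phi : R -> R[i]^o)}.
    by apply: cphi; rewrite in_itv/= expR_gt0.
  have h2 : (phi (expR (- v)) : R[i]^o) @[v --> u] --> (phi (expR (- u)) : R[i]^o).
    apply: (@continuous_comp _ _ _ (fun v : R => expR (- v)) (phi : R -> R[i]^o)) => //.
    apply: continuous_comp; last exact: continuous_expR.
    by apply: cvgN; exact: cvg_id.
  move/(@cvgrPdist_lt _ R[i]^o) : h2 => /(_ e%:C); rewrite ltcR => /(_ e0).
  apply: filterS => v; rewrite normC_normc ltcR => h3.
  by rewrite gD (le_lt_trans (gN _)).
have mphi : measurable_C (fun u => phi (expR (- u))).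
  split; apply: continuous_measurable_fun; apply: cc.
  - by move=> x y; rewrite ReD ReN.
  - exact: ler_normc_Re.
  - by move=> x y; rewrite ImD ImN.
  - exact: ler_normc_Im.
have -> : tu = (fun u => (expR (p%:R * u))%:C * phi (expR (- u)) + - k0).
  by apply/funext.
apply: measurable_CD; last exact: measurable_C_cst.
apply: measurable_CM => //; apply: measurable_C_real.
by apply: continuous_measurable_fun; exact: expR_lin_continuous.
Qed.

(** Removing the kernel subtracts k0 t^p and so only changes a_p. When n < p this term is not among
    the first n + 1; it goes into the error, whence |k0| in the constant. *)
Lemma expansion_of_power_expansion (p : nat) (phi tr tu : R -> R[i]) (k0 : R[i])
    (a : nat -> R[i]) :
  (forall t, phi t = (t ^+ p)%:C * tr t) ->
  (forall u, tr (expR (- u)) = tu u + k0) ->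
  (forall N : nat, exists eps M : R, [/\ 0 < eps, 0 < M & forall t : R, 0 < t -> t < eps ->
      `|phi t - \sum_(r < N.+1) a r * t%:C ^+ r| <= (M * t ^+ N.+1)%:C]) ->
  let a' r := if r == p then a r - k0 else a r in
  forall n, exists e M : R, [/\ 0 <= e, 0 <= M &
    forall u, e < u -> normc (tu u - expansion p a' n.+1 u) <=
      M * expR ((p%:R - n.+1%:R) * u)].
Proof.
move=> phiE trE aP a' n; have [eps [M [eps0 M0 HM]]] := aP n.
(* The maximum with 0 ensures t <= 1, so that t^p <= t^{n+1} when n < p. *)
exists (Num.max 0 (- ln eps)), (M + normc k0); split.
- by rewrite le_max lexx.
- by rewrite addr_ge0 ?normc_ge0 ?ltW.
move=> u; rewrite gt_max => /andP[u0 ue]; pose t := expR (- u).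
have t0 : 0 < t by exact: expR_gt0.
have te : t < eps by rewrite -[eps]lnK ?posrE// ltr_expR; lra.
have t1 : t <= 1 by rewrite -expR0 ler_expR; lra.
have tX k : t ^+ k = expR (k%:R * - u) by rewrite expRM_natl.
have := HM t t0 te; rewrite normC_normc lecR => h.
have ep : 0 < expR (p%:R * u) by exact: expR_gt0.
pose P : R[i] := (expR (p%:R * u))%:C; pose tc : R[i] := t%:C.
rewrite -/tc in h; pose S := \sum_(r < n.+1) a r * tc ^+ r; rewrite -/S in h.
pose K : R[i] := if (p < n.+1)%N then k0 * tc ^+ p else 0.
have PtE k : (expR ((p%:R - k%:R) * u))%:C = P * tc ^+ k.
  rewrite /P /tc -rmorphXn -rmorphM tX -expRD; congr (expR _)%:C; ring.
have tE : tu u = P * (phi t - k0 * tc ^+ p).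
  have Ptp : P * tc ^+ p = 1.
    by rewrite -PtE subrr mul0r expR0 rmorph1.
  have trt : tr t = tu u + k0 by exact: trE.
  by rewrite phiE trt -/tc rmorphXn -/tc mulrBr mulrA Ptp mulrCA Ptp mul1r mulr1 addrK.
have eE : expansion p a' n.+1 u = P * (S - K).
  rewrite /expansion; under eq_bigr => r _ do rewrite PtE mulrCA.
  rewrite -mulr_sumr; congr (P * _).
  have -> : \sum_(r < n.+1) a' r * tc ^+ r =
      \sum_(r < n.+1) (a r * tc ^+ r - (if (r : nat) == p then k0 * tc ^+ p else 0)).
    apply: eq_bigr => r _; rewrite /a'; case: eqP => [->|_]; last by rewrite subr0.
    by rewrite mulrBl.
  by rewrite sumrB -big_mkcond/= (big_ord1_eq _ (fun=> k0 * tc ^+ p)).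
have -> : tu u - expansion p a' n.+1 u = P * ((phi t - S) - (k0 * tc ^+ p - K)).
  by rewrite tE eE -mulrBr; congr (P * _); rewrite !opprB addrACA [RHS]addrACA; ring.
have nP : normc P = expR (p%:R * u) by rewrite normc_real ger0_norm ?expR_ge0.
have hK : normc (k0 * tc ^+ p - K) <= normc k0 * t ^+ n.+1.
  rewrite /K; case: ltnP => pn.
    by rewrite subrr Normc.normc0 mulr_ge0 ?normc_ge0// exprn_ge0// ltW.
  rewrite subr0 Normc.normcM normcX normc_real ger0_norm ?(ltW t0)//.
  by rewrite ler_wpM2l ?normc_ge0// ler_wiXn2l// ltW.
rewrite Normc.normcM nP.
have -> : (M + normc k0) * expR ((p%:R - n.+1%:R) * u) =
    expR (p%:R * u) * (M * t ^+ n.+1 + normc k0 * t ^+ n.+1).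
  rewrite -mulrDl mulrCA tX -expRD; congr (_ * expR _); ring.
rewrite ler_wpM2l ?(ltW ep)// (le_trans (normcB _ _))// lerD//.
Qed.

End heat_expansion.

Section spectral_data.
Context {R : realType} (T : spectral_triple R).
Local Notation D := (st_D T).
Local Notation H := (st_H T).

Lemma exists_spectral_data : exists (E : set H) (lam : H -> R) (Ker : {fset H}),
  [/\ orthonormal_basis E, forall e, E e -> eigenvector D (lam e) e &
      forall e, e \in Ker <-> E e /\ lam e = 0].
Proof.
have sD := st_D_self_adjoint T.
have [l [Tr [rT cT]]] := st_D_compact_resolvent T.
have [E [bE EP]] := exists_eigenbasis sD rT cT.
pose lam e : R := xget 0 [set m | eigenvector D m e].
have lamP e : E e -> eigenvector D (lam e) e.
  by move=> /EP[m em]; exact: (@xgetPex _ 0 [set m | eigenvector D m e] (ex_intro _ m em)).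
have fK : finite_set [set e | E e /\ lam e = 0].
  apply: (finite_ortho_kernel rT cT).
    by move=> e f [Ee _] [Ef _]; exact: bE.1.
  by move=> e [Ee l0]; rewrite -l0; exact: lamP.
have [Ker KerE] := finite_fsetP.1 fK.
exists E, lam, Ker; split => // e; split => [eK|h].
  have : [set` Ker] e by [].
  by rewrite -KerE.
by have : [set` Ker] e by rewrite -KerE.
Qed.

Lemma summable_eigenvalues (p : nat) (E : set H) (lam : H -> R) :
  summable_plus T p%:R -> orthonormal_basis E ->
  (forall e, E e -> eigenvector D (lam e) e) ->
  forall q, p%:R < q -> exists S, forall A : {fset H}, \sum_(e <- A) pw E lam q e <= S.
Proof.
move=> sT bE lamP q pq.
pose k e : R := if lam e == 0 then 0 else expR (- (q * ln `|lam e|)).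
have k0 e : 0 <= k e by rewrite /k; case: ifP => // _; exact: expR_ge0.
have Ke e : E e -> abs_powN_op D q%:C e = (k e)%:C *: e.
  move=> Ee; have [_ ->] := fun_calc_basis (st_D_self_adjoint T) bE lamP (abs_powN q%:C) Ee.
  congr (_ *: _); rewrite abs_powNE /k; case: eqP => // _.
  by rewrite -rmorphN/= -rmorphM/= cexp_real mulNr.
have [S HS] := trace_class_diag_summable bE k0 Ke (sT _ pq).
exists S => A; apply: le_trans (HS A); rewrite le_eqVlt; apply/orP; left.
apply/eqP; apply: eq_bigr => e _; rewrite /pw /nonker /k.
by case: asboolP => //= _; case: eqP.
Qed.

Lemma zeta_continuation (p : nat) (b : H -> H) : summable_plus T p%:R ->
  bounded_op b ->
  has_power_expansion (fun t : R => (t ^+ p)%:C * trace (b \o heat_op D t)) ->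
  exists f : R[i]^o -> R[i]^o,
  [/\ meromorphic f,
      forall z : R[i], p%:R < complex.Re z -> f z = zeta b z,
      pole f `<=` [set k%:R | k in [set k : nat | (1 <= k <= p)%N]] &
      forall z, pole f z -> simple_pole f z].
Proof.
move=> sT bb [cphi [a aP]].
have sD := st_D_self_adjoint T.
have [E [lam [Ker [bE lamP KerP]]]] := exists_spectral_data.
have psum := summable_eigenvalues sT bE lamP.
have [M /ltW M0 bM] := bounded_op_bound bb.
have [tu tuP] := exists_theta bE psum M0 bM.
have trE := heat_trace sD bE lamP KerP psum bb M0 bM tuP.
have phiE (t : R) : (t ^+ p)%:C * trace (b \o heat_op D t) =
  (t ^+ p)%:C * trace (b \o heat_op D t) by [].
have mtu := measurable_expansion_ker phiE cphi trE.
apply: (mellin_continuation mtu).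
- exact: (theta_growth bE psum M0 bM tuP).
- by move=> z; exact: (theta_mellin sD bE lamP psum bb M0 bM tuP mtu).
- exact: (expansion_of_power_expansion phiE trE aP).
Qed.

End spectral_data.

Lemma dom_delta_subalgebra (R : realType) (H : hilbert R) (D : unbounded_op H)
    (B : set (H -> H)) : B `<=` bounded_op ->
  (forall b, B b -> exists2 c, is_commutator (abs_op D) b c & B c) ->
  forall n b, B b -> dom_delta D n b.
Proof.
move=> bB dB; elim=> [b /bB//|n ih b /dB[c bc Bc]].
by exists c => //; exact: ih.
Qed.

Theorem proposition3p2 (R : realType) (p : nat) (T : spectral_triple R)
    (T_summable : summable_plus T p%:R)
    (T_heat : weak_heat_expansion T p) :
  regular T /\
  exists Sigma : set R[i],
    [/\ simple_dimension_spectrum T p%:R Sigma,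
        finite_set Sigma &
        Sigma `<=` [set k%:R | k in [set k : nat | (1 <= k <= p)%N]]].
Proof.
have [B [[algB _] AB [dB cB] _ heatB]] := T_heat.
have [bB _ _ _] := algB.
have genB : @algA R T `|` @comm_algA R T `<=` B by move=> b [/AB|/cB].
split.
  by move=> n b /genB; exact: dom_delta_subalgebra.
exists [set k%:R | k in [set k : nat | (1 <= k <= p)%N]]; split => //.
  move=> b db; have Bb : B b.
    (* B is one of the algebras that [delta_algebra] intersects; its closure under delta rests on
       the uniqueness of commutators. *)
    apply: db; split=> //; split=> // c c' /dB[c'' cc'' Bc''] cc'.
    have [E [lam [Ker [bE lamP _]]]] := exists_spectral_data T.
    by rewrite (commutator_unique (st_D_self_adjoint T) bE lamP cc' cc'').
  exact: zeta_continuation (bB _ Bb) (heatB _ Bb).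
apply: finite_image; apply: (sub_finite_set _ (finite_II p.+1)).
by move=> k /= /andP[_]; rewrite ltnS.
Qed.
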